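(* Let $T\in(0,+\infty)$, let $u_0\in L^2(\mathbb{R}^d;\mathbb{R}^d)$ be such that $\operatorname{div}u_0=0$, and let $u,U\in X_{u_0}$, that is, $u$ and $U$ are admissible weak solutions on $\mathbb{R}^d\times(0,T)$ of the incompressible Euler equations with initial datum $u_0$, each belonging to $L^\infty([0,T];L^{2+\sigma}(\mathbb{R}^d;\mathbb{R}^d))$ for some $\sigma>0$. If $$\nabla^sU\in L^1([0,T];L^{\exp}(\mathbb{R}^d;\mathbb{R}^{d\times d})),$$ then $u=U$.
   Context: The incompressible Euler equations on $\mathbb{R}^d\times(0,T)$ are $\partial_tu+\operatorname{div}(u\otimes u)+\nabla p=0$, $\operatorname{div}u=0$, $u(\cdot,0)=u_0$. Weak solution: given $u_0\in L^2(\mathbb{R}^d;\mathbb{R}^d)$ with $\operatorname{div}u_0=0$ (in the sense of distributions), a function $u\in L^\infty([0,T];L^2(\mathbb{R}^d;\mathbb{R}^d))$ is a weak solution of the Euler equations with initial datum $u_0$ if for a.e. $\tau\in(0,T)$ $$\int_0^\tau\int_{\mathbb{R}^d}(u\cdot\partial_t\varphi+u\otimes u:\nabla\varphi)\,dx\,dt=\int_{\mathbb{R}^d}u(x,\tau)\cdot\varphi(x,\tau)\,dx-\int_{\mathbb{R}^d}u_0(x)\cdot\varphi(x,0)\,dx,\qquad \int_{\mathbb{R}^d}u(x,\tau)\cdot\nabla q(x)\,dx=0,$$ for all $\varphi\in\mathrm{Lip}(\mathbb{R}^d\times(0,T);\mathbb{R}^d)\cap\mathrm{Lip}((0,T);L^2(\mathbb{R}^d;\mathbb{R}^d)\cap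 W^{1,\infty}(\mathbb{R}^d;\mathbb{R}^d))$ with $\operatorname{div}\varphi=0$ and all $q\in W^{1,2}(\mathbb{R}^d)$. Any weak solution is always identified with its representative in $C([0,T];w\text{-}L^2(\mathbb{R}^d;\mathbb{R}^d))$ (continuous in time for the weak topology of $L^2$). Admissible: a weak solution $u$ with initial datum $u_0$ is admissible if $\int_{\mathbb{R}^d}|u(x,t)|^2dx\le\int_{\mathbb{R}^d}|u_0(x)|^2dx$ for a.e. $t\in(0,T)$. $X_{u_0}$ is the set of admissible weak solutions $u$ with initial datum $u_0$ for which there exists $\sigma>0$ (depending on $u$) with $u\in L^\infty([0,T];L^{2+\sigma}(\mathbb{R}^d;\mathbb{R}^d))$. $\nabla^sU=\frac12(\nabla U+(\nabla U)^{T})$ is the symmetric part of the distributional spatial gradient. $L^{\exp}(\mathbb{R}^d)$ is the Orlicz space of measurable functions $f$ such that $\int_{\mathbb{R}^d}\psi(|f|/\beta)\,dx<+\infty$ for some $\beta>0$, where $\psi(s)=e^s-1$, with the Luxemburg norm $\|f\|_{L^{\exp}}=\inf\{\beta>0:\int_{\mathbb{R}^d}\psi(|f|/\beta)\,dx\le1\}$; for matrix-valued functions $|f|$ is the Euclidean (Frobenius) norm. *)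

(* Defs.v *)
From HB Require Import structures.
From mathcomp Require Import all_boot all_order all_algebra.
From mathcomp Require Import all_classical all_reals all_analysis.

Set Implicit Arguments.
Unset Strict Implicit.
Unset Printing Implicit Defensive.

Import Order.TTheory GRing.Theory Num.Theory.
Import numFieldNormedType.Exports.

Local Open Scope classical_set_scope.
Local Open Scope ring_scope.

(* The sigma-algebra on 'M[R]_(m, n) is generated by the entries, i.e. it is the
   product sigma-algebra; it coincides with the Borel sigma-algebra. *)
Section matrix_measurable.
Variables (R : realType) (m n : nat).

Definition entry_preimages : set (set 'M[R]_(m, n)) :=
  [set A | exists (i : 'I_m) (j : 'I_n), exists2 B : set R,
     measurable B & A = (fun M : 'M[R]_(m, n) => M i j) @^-1` B].

Let mx_measurable := <<s entry_preimages >>.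

Let mx_measurable0 : mx_measurable set0.
Proof. exact: sigma_algebra0. Qed.

Let mx_measurableC A : mx_measurable A -> mx_measurable (~` A).
Proof. exact: sigma_algebraC. Qed.

Let mx_measurable_bigcup (F : (set 'M[R]_(m, n))^nat) :
  (forall k, mx_measurable (F k)) -> mx_measurable (\bigcup_k F k).
Proof. exact: sigma_algebra_bigcup. Qed.

HB.instance Definition _ := @isMeasurable.Build default_measure_display
  'M[R]_(m, n) mx_measurable mx_measurable0 mx_measurableC mx_measurable_bigcup.

End matrix_measurable.

Lemma measurable_entry (R : realType) m n (i : 'I_m) (j : 'I_n) :
  measurable_fun [set: 'M[R]_(m, n)] (fun M : 'M[R]_(m, n) => M i j).
Proof.
move=> _ B mB; rewrite setTI; apply: sub_sigma_algebra.
by exists i, j; exists B.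
Qed.

Lemma measurable_fun_matrix d (T : measurableType d) (R : realType) m n
    (D : set T) (f : T -> 'M[R]_(m, n)) : measurable D ->
  (forall i j, measurable_fun D (fun x => f x i j)) -> measurable_fun D f.
Proof.
move=> mD mf; apply: (measurability (@entry_preimages R m n)) => //.
move=> _ [_ [i [j [B mB ->]]] <-].
exact: (mf i j mD B mB).
Qed.

(* Lebesgue measure on R^(n.+1) is the image of the product of the Lebesgue
   measures of R and R^n under (a, v) |-> (a, v_1, ..., v_n). *)
Section lebesgue_step.
Variables (R : realType) (n : nat).
Variable mu : {sigma_finite_measure set 'rV[R]_n -> \bar R}.

Definition rV_cons (p : measurableTypeR R * 'rV[R]_n) : 'rV[R]_n.+1 :=
  row_mx (const_mx p.1 : 'rV[R]_1) p.2.

Let rV_behead (v : 'rV[R]_n.+1) : 'rV[R]_n := rsubmx (v : 'rV[R]_(1 + n)).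

Lemma measurable_rV_cons : measurable_fun setT rV_cons.
Proof.
apply: measurable_fun_matrix => // i j.
have [k ->|k ->] := split_ordP (j : 'I_(1 + n)).
  rewrite [X in measurable_fun _ X](_ : _ = fst); first exact: measurable_fst.
  by apply/funext => p; rewrite /rV_cons [LHS](@row_mxEl _ 1 1 n) mxE.
rewrite [X in measurable_fun _ X](_ : _ = fun p => (p.2 : 'rV[R]_n) i k).
  exact: (measurableT_comp (measurable_entry i k) measurable_snd).
by apply/funext => p; rewrite /rV_cons [LHS](@row_mxEr _ 1 1 n).
Qed.

Let measurable_rV_head :
  measurable_fun setT (fun v : 'rV[R]_n.+1 => v 0 0 : measurableTypeR R).
Proof. exact: measurable_entry. Qed.

Let measurable_rV_behead : measurable_fun setT rV_behead.
Proof.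
apply: measurable_fun_matrix => // i j; rewrite /rV_behead.
under eq_fun do rewrite mxE.
exact: measurable_entry.
Qed.

Definition lebesgue_step : set 'rV[R]_n.+1 -> \bar R :=
  pushforward (lebesgue_measure \x mu)%E rV_cons.

Let preimage_rV_cons A : measurable A -> measurable (rV_cons @^-1` A).
Proof.
by move=> mA; rewrite -[X in measurable X]setTI; exact: measurable_rV_cons.
Qed.

Let lebesgue_step0 : lebesgue_step set0 = 0%E.
Proof. by rewrite /lebesgue_step /pushforward preimage_set0 measure0. Qed.

Let lebesgue_step_ge0 A : (0 <= lebesgue_step A)%E.
Proof. by rewrite /lebesgue_step /pushforward; exact: measure_ge0. Qed.

Let lebesgue_step_sigma_additive : semi_sigma_additive lebesgue_step.
Proof.
move=> F mF tF mUF; rewrite /lebesgue_step /pushforward preimage_bigcup.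
apply: measure_semi_sigma_additive.
- by move=> k; exact: preimage_rV_cons.
- apply/trivIsetP => /= i j _ _ ij; rewrite -preimage_setI.
  by move/trivIsetP : tF => /(_ _ _ _ _ ij) ->//; rewrite preimage_set0.
- by rewrite -preimage_bigcup; exact: preimage_rV_cons.
Qed.

HB.instance Definition _ := isMeasure.Build _ _ _ lebesgue_step
  lebesgue_step0 lebesgue_step_ge0 lebesgue_step_sigma_additive.

Let rV_uncons (v : 'rV[R]_n.+1) : measurableTypeR R * 'rV[R]_n :=
  (v 0 0, rV_behead v).

Lemma rV_cons0 p : rV_cons p 0 0 = p.1.
Proof.
rewrite /rV_cons (_ : 0 = lshift n (0 : 'I_1)); last exact: val_inj.
by rewrite [LHS](@row_mxEl _ 1 1 n) mxE.
Qed.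

Lemma rV_consS p i : rV_cons p 0 (lift ord0 i) = p.2 0 i.
Proof.
rewrite /rV_cons (_ : lift ord0 i = rshift 1 i); last exact: val_inj.
by rewrite [LHS](@row_mxEr _ 1 1 n).
Qed.

Let rV_uncons_cons p : rV_uncons (rV_cons p) = p.
Proof.
rewrite /rV_uncons rV_cons0 [RHS]surjective_pairing; congr pair.
by rewrite /rV_behead /rV_cons row_mxKr.
Qed.

Let rV_cons_uncons v : rV_cons (rV_uncons v) = v.
Proof.
rewrite /rV_uncons /rV_behead /rV_cons /= -[RHS](@hsubmxK _ _ 1 n).
suff -> : const_mx (v 0 0) = lsubmx (v : 'rV[R]_(1 + n)) by [].
by apply/rowP => i; rewrite !mxE ord1; congr (v _ _); exact: val_inj.
Qed.

Let measurable_rV_uncons : measurable_fun setT rV_uncons.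
Proof. exact: measurable_fun_pair. Qed.

Let lebesgue_step_sigma_finite : sigma_finite setT lebesgue_step.
Proof.
have /sigma_finiteP[F [FT ndF Foo]] := sigma_finiteT (@lebesgue_measure R).
have /sigma_finiteP[G [GT ndG Goo]] := sigma_finiteT mu.
exists (fun k => rV_uncons @^-1` (F k `*` G k)).
  rewrite -preimage_bigcup -[LHS](preimage_setT rV_uncons); congr (_ @^-1` _).
  rewrite -setXTT FT GT predeqE => -[x y]; split.
    move=> [/= [k _ Fkx] [l _ Gly]]; exists (maxn k l) => //; split.
    - by move: x Fkx; exact/subsetPset/ndF/leq_maxl.
    - by move: y Gly; exact/subsetPset/ndG/leq_maxr.
  by move=> [k _ []/= ? ?]; split; exists k.
move=> k; have [mFk Fk] := Foo k; have [mGk Gk] := Goo k; split.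
  rewrite -[X in measurable X]setTI.
  by apply: measurable_rV_uncons => //; exact: measurableX.
rewrite /lebesgue_step /pushforward -comp_preimage.
rewrite (_ : rV_uncons \o rV_cons = id); last exact/funext/rV_uncons_cons.
rewrite preimage_id.
by rewrite product_measure1E// lte_mul_pinfty// ge0_fin_numE.
Qed.

HB.instance Definition _ := Measure_isSigmaFinite.Build _ _ _ lebesgue_step
  lebesgue_step_sigma_finite.

End lebesgue_step.

Fixpoint lebesgue_rV (R : realType) (n : nat) :
    {sigma_finite_measure set 'rV[R]_n -> \bar R} :=
  if n is n'.+1 then lebesgue_step (lebesgue_rV R n')
  else \d_(0 : 'rV[R]_0).

Lemma measurable_box (R : realType) (n : nat) (B : 'I_n -> set R) :
  (forall i, measurable (B i)) ->
  measurable [set v : 'rV[R]_n | forall i, B i (v 0 i)].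
Proof.
move=> mB.
rewrite [X in measurable X](_ : _ =
    \bigcap_(i in [set: 'I_n]) (fun v : 'rV[R]_n => v 0 i) @^-1` B i).
  apply: fin_bigcap_measurable => // i _; rewrite -[X in measurable X]setTI.
  exact: measurable_entry.
by apply/seteqP; split => v /= Bv i => [_|]; exact: Bv.
Qed.

Lemma lebesgue_rV_box (R : realType) (n : nat) (B : 'I_n -> set R) :
  (forall i, measurable (B i)) ->
  lebesgue_rV R n [set v | forall i, B i (v 0 i)] =
  (\prod_(i < n) lebesgue_measure (B i : set (measurableTypeR R)))%E.
Proof.
elim: n B => [|n IHn] B mB.
  by rewrite big_ord0 /= diracE mem_set//= => -[].
rewrite big_ord_recl -(IHn (fun i => B (lift ord0 i))); last first.
  by move=> i; exact: mB.
rewrite /= /lebesgue_step /pushforward -product_measure1E; last 2 first.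
- exact: mB.
- exact: (measurable_box (fun i => mB (lift ord0 i))).
congr (_ _); apply/seteqP; split => p /=.
  move=> Bp; split => [|i].
    by have := Bp ord0; rewrite rV_cons0.
  by have := Bp (lift ord0 i); rewrite rV_consS.
move=> [Ba Bv] i; have [j ->|->] := unliftP ord0 i; last by rewrite rV_cons0.
by rewrite rV_consS; exact: Bv.
Qed.

(* Euclidean (Frobenius) structure; vectors are row vectors. *)
Definition mxdot (R : realType) m n (A B : 'M[R]_(m, n)) : R :=
  \sum_i \sum_j A i j * B i j.

Definition mxnorm2 (R : realType) m n (A : 'M[R]_(m, n)) : R :=
  Num.sqrt (mxdot A A).

Section function_spaces.
Variables (R : realType) (d : nat).
Local Notation Rd := 'rV[R]_d.
Local Notation leb := (lebesgue_rV R d).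

Definition Lpnorm (p : \bar R) m n (f : Rd -> 'M[R]_(m, n)) : \bar R :=
  Lnorm leb p (fun x => (mxnorm2 (f x))%:E).

Definition in_Lp (p : \bar R) m n (f : Rd -> 'M[R]_(m, n)) : Prop :=
  measurable_fun setT f /\ (Lpnorm p f < +oo)%E.

Definition loc_integrable (f : Rd -> R) : Prop :=
  measurable_fun setT f /\
  forall K : set Rd, compact K -> (\int[leb]_(x in K) `|f x|%:E < +oo)%E.

Definition basis_vector (i : 'I_d) : Rd := delta_mx 0 i.

Fixpoint of_class_C (k : nat) (f : Rd -> R) : Prop :=
  continuous f /\
  if k is k'.+1 then
    forall i, (forall x, derivable f x (basis_vector i)) /\
              of_class_C k' (fun x => 'D_(basis_vector i) f x)
  else True.

Definition test_function (psi : Rd -> R) : Prop :=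
  (forall k, of_class_C k psi) /\ compact (closure [set x | psi x != 0]).

(* The distribution d_i f, as a functional on test functions. *)
Definition distr_partial (f : Rd -> R) (i : 'I_d) (psi : Rd -> R) : R :=
  - \int[leb]_x (f x * 'D_(basis_vector i) psi x).

Definition distr_div (v : Rd -> Rd) (psi : Rd -> R) : R :=
  \sum_i distr_partial (fun x => v x 0 i) i psi.

Definition div_free (v : Rd -> Rd) : Prop :=
  forall psi, test_function psi -> distr_div v psi = 0.

(* The (i, j) entry of the distributional gradient is d_j v_i. *)
Definition distr_sym_grad (v : Rd -> Rd) (i j : 'I_d) (psi : Rd -> R) : R :=
  (distr_partial (fun x => v x 0 i) j psi +
   distr_partial (fun x => v x 0 j) i psi) / 2.

Definition represents (g : Rd -> R) (L : (Rd -> R) -> R) : Prop :=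
  loc_integrable g /\
  forall psi, test_function psi -> \int[leb]_x (g x * psi x) = L psi.

Definition weak_gradient (q : Rd -> R) (g : Rd -> Rd) : Prop :=
  forall i, represents (fun x => g x 0 i) (distr_partial q i).

Definition weak_jacobian (v : Rd -> Rd) (G : Rd -> 'M[R]_d) : Prop :=
  forall i j,
    represents (fun x => G x i j) (distr_partial (fun x => v x 0 i) j).

Definition sym_gradient (v : Rd -> Rd) (S : Rd -> 'M[R]_d) : Prop :=
  forall i j, represents (fun x => S x i j) (distr_sym_grad v i j).

(* q belongs to W^{1,2}, with weak gradient g. *)
Definition in_W12 (q : Rd -> R) (g : Rd -> Rd) : Prop :=
  [/\ measurable_fun setT q, finite_norm leb 2%:E q, in_Lp 2%:E g &
      weak_gradient q g].

(* v belongs to L^2 \cap W^{1,oo}, with weak Jacobian matrix G. *)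
Definition in_L2_W1oo (v : Rd -> Rd) (G : Rd -> 'M[R]_d) : Prop :=
  [/\ in_Lp 2%:E v, in_Lp +oo%E v, in_Lp +oo%E G & weak_jacobian v G].

Definition exp_modular m n (f : Rd -> 'M[R]_(m, n)) (beta : R) : \bar R :=
  \int[leb]_x (expR (mxnorm2 (f x) / beta) - 1)%:E.

Definition in_Lexp m n (f : Rd -> 'M[R]_(m, n)) : Prop :=
  measurable_fun setT f /\
  exists2 beta : R, 0 < beta & (exp_modular f beta < +oo)%E.

Definition Lexp_norm m n (f : Rd -> 'M[R]_(m, n)) : \bar R :=
  ereal_inf [set beta%:E | beta in [set beta : R |
    0 < beta /\ (exp_modular f beta <= 1)%E]].

End function_spaces.

Section euler.
Variables (R : realType) (d : nat) (T : R).
Local Notation Rd := 'rV[R]_d.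
Local Notation leb := (lebesgue_rV R d).
Local Notation lam := (@lebesgue_measure R).

Definition jointly_measurable m n (f : R -> Rd -> 'M[R]_(m, n)) : Prop :=
  measurable_fun (`[0, T] `*` [set: Rd])
    (fun z : measurableTypeR R * Rd => f z.1 z.2).

Definition in_Linf_Lp (p : \bar R) (u : R -> Rd -> Rd) : Prop :=
  jointly_measurable u /\
  exists M : R, \forall t \ae lam, t \in `[0, T] -> (Lpnorm p (u t) <= M%:E)%E.

(* Since L^exp is not separable, measurability in time is meant as joint
   measurability, which is weaker than strong measurability. *)
Definition in_L1_Lexp m n (S : R -> Rd -> 'M[R]_(m, n)) : Prop :=
  [/\ jointly_measurable S,
      \forall t \ae lam, t \in `[0, T] -> in_Lexp (S t) &
      (\int[lam]_(t in `[0%R, T]) Lexp_norm (S t) < +oo)%E].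

(* phi is a divergence-free test field, and G t is the spatial weak Jacobian
   matrix of phi t.  A Lipschitz field on ]0, T[ x R^d is identified with its unique
   Lipschitz extension to [0, T] x R^d. *)
Definition euler_test_field (phi : R -> Rd -> Rd) (G : R -> Rd -> 'M[R]_d) :
    Prop :=
  [/\ [lipschitz phi z.1 z.2 | z in `[0, T] `*` [set: Rd] : set (R^o * Rd)],
      forall t, t \in `]0, T[ -> in_L2_W1oo (phi t) (G t),
      exists C : R, forall s t : R, s \in `]0, T[ -> t \in `]0, T[ ->
        [/\ (Lpnorm 2%:E (phi t \- phi s)%R <= (C * `|t - s|)%:E)%E,
            (Lpnorm +oo%E (phi t \- phi s)%R <= (C * `|t - s|)%:E)%E &
            (Lpnorm +oo%E (G t \- G s)%R <= (C * `|t - s|)%:E)%E] &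
      forall t, t \in `]0, T[ -> \forall x \ae leb, \tr (G t x) = 0].

(* The time derivative of phi is the classical one, which exists almost
   everywhere since phi is Lipschitz. *)
Definition weak_solution (u0 : Rd -> Rd) (u : R -> Rd -> Rd) : Prop :=
  in_Linf_Lp 2%:E u /\
  \forall tau \ae lam, tau \in `]0, T[ ->
    (forall phi G, euler_test_field phi G ->
       \int[lam]_(t in `[0, tau]) \int[leb]_x
         (mxdot (u t x) (derive1 (phi^~ x) t) +
          mxdot ((u t x)^T *m u t x) (G t x)) =
       \int[leb]_x mxdot (u tau x) (phi tau x) -
       \int[leb]_x mxdot (u0 x) (phi 0 x)) /\
    (forall q g, in_W12 q g -> \int[leb]_x mxdot (u tau x) (g x) = 0).

Definition admissible (u0 : Rd -> Rd) (u : R -> Rd -> Rd) : Prop :=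
  \forall t \ae lam, t \in `]0, T[ ->
    (\int[leb]_x (mxnorm2 (u t x) ^+ 2)%:E <=
     \int[leb]_x (mxnorm2 (u0 x) ^+ 2)%:E)%E.

Definition in_X (u0 : Rd -> Rd) (u : R -> Rd -> Rd) : Prop :=
  [/\ weak_solution u0 u, admissible u0 u &
      exists2 sigma : R, 0 < sigma & in_Linf_Lp (2 + sigma)%:E u].

Definition sym_gradient_in_L1_Lexp (U : R -> Rd -> Rd) : Prop :=
  exists2 S : R -> Rd -> 'M[R]_d, in_L1_Lexp S &
    \forall t \ae lam, t \in `[0, T] -> sym_gradient (U t) (S t).

Definition eq_as_L2_valued (u v : R -> Rd -> Rd) : Prop :=
  \forall t \ae lam, t \in `[0, T] -> \forall x \ae leb, u t x = v t x.

(* w is the representative of u in C([0, T]; w-L^2). *)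
Definition weakly_continuous_repr (u w : R -> Rd -> Rd) : Prop :=
  [/\ forall t, t \in `[0, T] -> in_Lp 2%:E (w t),
      forall v : Rd -> Rd, in_Lp 2%:E v ->
        {within `[0, T], continuous (fun t => \int[leb]_x mxdot (w t x) (v x))} &
      eq_as_L2_valued u w].

End euler.

(* Main.v *)
(* Let [w := u - U], let [K] be the convolution with a smooth even mollifier, and test the
   equation of [u] with [K K U(t)] and that of [U] with [K K u(t)], for fixed [t].  The
   equation of [U] also gives [|K (U(t) - U(s))|^2 = O(|t - s|)] in L^2, so the difference
   between [<u(t), K K U(t)>] and the time integral of the fluxes has increments of order
   [|t - s|^(3/2)] along a dense set of times: it is constant, without any derivative in
   time.  When the mollification is removed, the energy inequalities and the identity
   [div (U (x) U) = 2 S U - grad (|U|^2 / 2)], [S] the symmetric gradient, yield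
   [int |w(t)|^2 <= 2 int_0^t int |w|^2 |S|].  If [m(s)] controls the Luxemburg norm of
   [S(s)], splitting at [|S| = L m(s)] and using the [L^(2 + sigma)] bound of [w] gives
   [int |w|^2 |S| <= m(s) (L int |w|^2 + C exp(- c L))] for all [L >= 1]; optimised in [L],
   this is a modulus of order [x log (1/x)], and Osgood's criterion forces [w = 0]. *)
Require Import Defs.
From mathcomp Require Import all_boot all_order all_algebra.
From mathcomp Require Import all_classical all_reals all_analysis.
From mathcomp Require Import measurable_realfun ring lra.

Set Implicit Arguments.
Unset Strict Implicit.
Unset Printing Implicit Defensive.

Import Order.TTheory GRing.Theory Num.Theory.
Import numFieldNormedType.Exports.

Local Open Scope classical_set_scope.
Local Open Scope ring_scope.

(** * Square-integrable functions *)

(** Testing the equation of one solution with the other fails twice: the solutions lack the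
    regularity in space of a test field, and a test field must be Lipschitz in time. Mollification
    cures the first defect; freezing the time in the test field avoids the second, and a function of
    two times is then followed along the diagonal. Since the weak equation holds at almost every
    time only, this is done on a dense set of good times. In the flux [u (x) u : grad U] only the
    symmetric gradient of [U] counts. In [U (x) U : grad u] the gradient of [u] is out of control,
    and the transport identity replaces it by the strain of [U]. Together the two terms give the
    strain tested on [w], because the strain tested on [U] itself integrates to 0. The strain is
    unbounded, but all its powers are integrable, and the exponent [2 + sigma] makes [|w|^2 |S|]
    integrable through a Young inequality. This inequality produces powers of the strain, whereas
    only the first power of [m(s)] is integrable in time: in the bounds, [S(s)] is therefore divided
    by [m(s)] beforehand. *)

Section real_sequences.
Context (R : realType).
Implicit Types (u v : nat -> R).

Lemma cvgn_le u (l c : R) : u @ \oo --> l -> (forall k, u k <= c) -> l <= c.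
Proof.
move=> ul uc; rewrite -(cvg_lim (@norm_hausdorff _ _) ul).
by apply: limr_le; [apply/cvg_ex; exists l|exact: nearW].
Qed.

Lemma cvgn_unique u (l c : R) : u @ \oo --> l -> u @ \oo --> c -> l = c.
Proof. by move=> ul uc; apply: (cvg_unique _ ul uc); exact: norm_hausdorff. Qed.

Lemma cvgn_near u (l e : R) : 0 < e -> u @ \oo --> l ->
  exists k0, forall k, (k0 <= k)%N -> `|u k - l| <= e.
Proof.
move=> e0 /cvgrPdist_le/(_ e e0)[k0 _ H]; exists k0 => k k0k.
by rewrite distrC; exact: H.
Qed.

Lemma cvgn_dist u (l : R) : (forall e : R, 0 < e ->
  exists k0, forall k, (k0 <= k)%N -> `|u k - l| <= e) -> u @ \oo --> l.
Proof.
move=> H; apply/cvgrPdist_le => e /H[k0 k0P]; exists k0 => // k /k0P.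
by rewrite distrC.
Qed.

Lemma cvgn_squeeze u v (l : R) : (forall k, `|u k - l| <= v k) -> v @ \oo --> (0 : R) ->
  u @ \oo --> l.
Proof.
move=> uv v0; apply: cvgn_dist => e e0; have [k0 k0P] := cvgn_near e0 v0.
exists k0 => k /k0P; rewrite subr0 => vk; apply: (le_trans (uv k)).
exact: (le_trans (ler_norm _)).
Qed.

End real_sequences.
Section real_integrals.
Context d (X : measurableType d) (R : realType) (mu : {measure set X -> \bar R}).
Implicit Types f g h : X -> R.

Definition intg f := mu.-integrable setT (EFin \o f).

Lemma intg_measurable f : intg f -> measurable_fun setT f.
Proof. by move=> /integrableP[/measurable_EFinP]. Qed.

Lemma intg_le f g : measurable_fun setT f -> (forall x, `|f x| <= g x) ->
  intg g -> intg f.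
Proof.
move=> mf fg ig; apply: (le_integrable _ _ _ ig) => //.
  exact/measurable_EFinP.
by move=> x _; rewrite lee_fin (le_trans (fg x))// ler_norm.
Qed.

Lemma intgD f g : intg f -> intg g -> intg (fun x => f x + g x).
Proof. by move=> a b; have := integrableD measurableT a b. Qed.

Lemma intgZ (k : R) f : intg f -> intg (fun x => k * f x).
Proof. by move=> a; have := integrableZl measurableT k a. Qed.

Lemma intgN f : intg f -> intg (fun x => - f x).
Proof. by move=> a; have := integrableN a. Qed.

Lemma intgB f g : intg f -> intg g -> intg (fun x => f x - g x).
Proof. by move=> ? ?; apply: intgD => //; exact: intgN. Qed.

Lemma intg_norm f : intg f -> intg (fun x => `|f x|).
Proof. exact: integrable_norm. Qed.

Lemma intg_sum (I : Type) (s : seq I) (F : I -> X -> R) :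
  (forall i, intg (F i)) -> intg (fun x => \sum_(i <- s) F i x).
Proof.
move=> iF; have := @integrable_sum _ _ _ mu setT measurableT I s predT
  (fun i x => (F i x)%:E) (fun i _ => iF i).
by rewrite /intg; under eq_fun do rewrite sumEFin.
Qed.

Lemma intg0 : intg (fun=> 0).
Proof. exact: (@integrable0 _ _ _ mu setT). Qed.

Lemma RintD f g : intg f -> intg g ->
  \int[mu]_x (f x + g x) = \int[mu]_x f x + \int[mu]_x g x.
Proof. by move=> a b; exact: RintegralD. Qed.

Lemma RintB f g : intg f -> intg g ->
  \int[mu]_x (f x - g x) = \int[mu]_x f x - \int[mu]_x g x.
Proof. by move=> a b; exact: RintegralB. Qed.

Lemma RintZ (k : R) f : intg f -> \int[mu]_x (k * f x) = k * \int[mu]_x f x.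
Proof. by move=> a; exact: RintegralZl. Qed.

Lemma Rint_sum (I : Type) (s : seq I) (F : I -> X -> R) :
  (forall i, intg (F i)) ->
  \int[mu]_x \sum_(i <- s) F i x = \sum_(i <- s) \int[mu]_x F i x.
Proof.
move=> iF; elim: s => [|i s IHs].
  under eq_Rintegral do rewrite big_nil.
  by rewrite big_nil /Rintegral integral0.
under eq_Rintegral do rewrite big_cons.
by rewrite big_cons -IHs RintD//; exact: intg_sum.
Qed.

Lemma Rint0 : \int[mu]_x (0 : R) = 0.
Proof. by rewrite /Rintegral integral0. Qed.

(** Integrability is not assumed: negation swaps the positive and negative parts, and when one of
    them is infinite [fine] sends both sides to 0. *)
Lemma RintN f : \int[mu]_x (- f x) = - \int[mu]_x f x.
Proof.
rewrite /Rintegral; under eq_integral do rewrite EFinN.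
rewrite integralE [in RHS]integralE.
rewrite (_ : (fun x => - (f x)%:E)%E = (\- (EFin \o f))%E)//.
rewrite funeposN funenegN.
have pos (g : X -> \bar R) : (forall x, 0 <= g x)%E -> (0 <= \int[mu]_x g x)%E.
  by move=> g0; apply: integral_ge0.
move: (pos _ (funepos_ge0 (EFin \o f))) (pos _ (funeneg_ge0 (EFin \o f))).
case: integral => [a||] //; case: integral => [b||] //= _ _; rewrite ?oppr0//.
by rewrite opprB.
Qed.

Lemma Rint_le f g : intg f -> intg g -> (forall x, f x <= g x) ->
  \int[mu]_x f x <= \int[mu]_x g x.
Proof. by move=> iF ig fg; apply: le_Rintegral => // x _; exact: fg. Qed.

Lemma Rint_abs_le f g : measurable_fun setT f -> intg g ->
  (forall x, `|f x| <= g x) -> `|\int[mu]_x f x| <= \int[mu]_x g x.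
Proof.
move=> mf ig fg; have iF := intg_le mf fg ig.
apply: (le_trans (le_normr_Rintegral measurableT iF)).
by apply: Rint_le => //; exact: intg_norm.
Qed.

Lemma EFin_Rint f : intg f -> (\int[mu]_x (f x)%:E)%E = (\int[mu]_x f x)%:E.
Proof. by move=> iF; rewrite /Rintegral fineK//; exact: integrable_fin_num. Qed.

Lemma ge0_intg f : measurable_fun setT f -> (forall x, 0 <= f x) ->
  (\int[mu]_x (f x)%:E < +oo)%E -> intg f.
Proof.
move=> mf f0 fi; apply/integrableP; split; first exact/measurable_EFinP.
apply: le_lt_trans fi; apply: ge0_le_integral => //=.
- by apply/measurable_EFinP; exact: measurableT_comp.
- exact/measurable_EFinP.
- by move=> x _; rewrite lee_fin ger0_norm.
Qed.

Lemma Rint0_ae f : intg f -> (forall x, 0 <= f x) -> \int[mu]_x f x = 0 ->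
  \forall x \ae mu, f x = 0.
Proof.
move=> iF f0 If.
have : (\int[mu]_x `|(EFin \o f) x| = 0)%E.
  rewrite (_ : (fun x => _) = EFin \o f); last first.
    by apply/funext => x /=; rewrite ger0_norm.
  by rewrite EFin_Rint// If.
have mf : measurable_fun setT (EFin \o f) by apply/measurable_EFinP; exact: intg_measurable.
move/(ae_eq_integral_abs mu measurableT mf).
by apply: filterS => x /(_ I)/= [].
Qed.

Lemma ae_eq_Rint f g : measurable_fun setT f -> measurable_fun setT g ->
  (\forall x \ae mu, f x = g x) -> \int[mu]_x f x = \int[mu]_x g x.
Proof.
move=> mf mg fg; congr fine; apply: ae_eq_integral => //.
- exact/measurable_EFinP.
- exact/measurable_EFinP.
- by apply: filterS fg => x -> _.
Qed.

Lemma Rint_dominated (F : nat -> X -> R) f g :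
  (forall n, measurable_fun setT (F n)) -> measurable_fun setT f ->
  (\forall x \ae mu, F ^~ x @ \oo --> f x) -> intg g ->
  (\forall x \ae mu, forall n, `|F n x| <= g x) ->
  (fun n => \int[mu]_x F n x) @ \oo --> \int[mu]_x f x.
Proof.
move=> mF mf Ff ig Fg.
have [] := @dominated_convergence _ _ _ mu setT measurableT
  (fun n => EFin \o F n) (EFin \o f) (EFin \o g).
- by move=> n; exact/measurable_EFinP.
- exact/measurable_EFinP.
- by apply: filterS Ff => x Fx _; apply/fine_cvgP; split; [exact: nearW|].
- exact: ig.
- by apply: filterS Fg => x Fx n _; rewrite lee_fin.
move=> iF _ cF.
apply: fine_cvg; move: cF; rewrite fineK//; exact: integrable_fin_num.
Qed.

Definition L2 f := measurable_fun setT f /\ intg (fun x => f x ^+ 2).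

Definition N2 f := \int[mu]_x (f x ^+ 2).

Lemma N2_ge0 f : 0 <= N2 f.
Proof. by apply: Rintegral_ge0 => x _; exact: sqr_ge0. Qed.

Lemma L2M f g : L2 f -> L2 g -> intg (fun x => f x * g x).
Proof.
move=> [mf if2] [mg ig2].
apply: (@intg_le _ (fun x => f x ^+ 2 + g x ^+ 2)).
- exact: measurable_funM.
- move=> x; rewrite normrM -[f x ^+ 2]real_normK ?num_real//.
  rewrite -[g x ^+ 2]real_normK ?num_real//.
  have := sqr_ge0 (`|f x| - `|g x|).
  have : 0 <= `|f x| * `|g x| by rewrite mulr_ge0.
  by nra.
- exact: intgD.
Qed.

Lemma L2_le f g : measurable_fun setT f -> L2 g ->
  (forall x, `|f x| <= `|g x|) -> L2 f.
Proof.
move=> mf [mg ig] fg; split => //; apply: intg_le ig.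
  exact: measurable_funX.
move=> x; rewrite normrX -[leRHS]real_normK ?num_real//.
by rewrite lerXn2r ?nnegrE.
Qed.

Lemma L2D f g : L2 f -> L2 g -> L2 (fun x => f x + g x).
Proof.
move=> Lf Lg; have [mf if2] := Lf; have [mg ig2] := Lg.
split; first exact: measurable_funD.
under eq_fun do rewrite sqrrD -mulr_natl.
apply: intgD => //; apply: intgD => //; apply: intgZ; exact: L2M.
Qed.

Lemma L2Z (k : R) f : L2 f -> L2 (fun x => k * f x).
Proof.
move=> [mf if2]; split; first exact: measurable_funM.
by under eq_fun do rewrite exprMn; exact: intgZ.
Qed.

Lemma L2N f : L2 f -> L2 (fun x => - f x).
Proof.
move=> [mf if2]; split; first exact: measurableT_comp.
by under eq_fun do rewrite sqrrN.
Qed.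

Lemma L2B f g : L2 f -> L2 g -> L2 (fun x => f x - g x).
Proof. by move=> Lf Lg; apply: L2D => //; exact: L2N. Qed.

Lemma L20 : L2 (fun=> 0).
Proof. by split => //; under eq_fun do rewrite expr0n/=; exact: intg0. Qed.

Lemma L2_norm f : L2 f -> L2 (fun x => `|f x|).
Proof.
move=> Lf; apply: (L2_le _ Lf); last by move=> x; rewrite normr_id.
by apply: measurableT_comp => //; case: Lf.
Qed.

Lemma L2_bounded (C : R) f h : L2 f -> measurable_fun setT h ->
  (forall x, `|h x| <= C) -> L2 (fun x => f x * h x).
Proof.
move=> Lf mh hC.
apply: (@L2_le _ (fun x => C * f x)); last 2 first.
- exact: L2Z.
- move=> x; rewrite mulrC !normrM ler_wpM2r// (le_trans (hC x))// ler_norm//.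
- by apply: measurable_funM => //; case: Lf.
Qed.

Lemma cauchy_schwarz f g : L2 f -> L2 g ->
  (\int[mu]_x (f x * g x)) ^+ 2 <= N2 f * N2 g.
Proof.
move=> Lf Lg; set b := \int[mu]_x _.
have ifg : intg (fun x => f x * g x) by exact: L2M.
(* The quadratic form [N2 (s f + t g)] in [s] and [t] is nonnegative. *)
have key (s t : R) : 0 <= s ^+ 2 * N2 f + 2 * s * t * b + t ^+ 2 * N2 g.
  have -> : s ^+ 2 * N2 f + 2 * s * t * b + t ^+ 2 * N2 g =
      \int[mu]_x ((s * f x + t * g x) ^+ 2).
    rewrite /N2 /b -!RintegralZl//; [|by case: Lg|by case: Lf].
    rewrite -RintegralD//; [|by apply: intgZ; case: Lf|exact: intgZ].
    rewrite -RintegralD//; first by apply: eq_Rintegral => x _; ring.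
    - by apply: intgD; apply: intgZ => //; case: Lf.
    - by apply: intgZ; case: Lg.
  by apply: Rintegral_ge0 => x _; exact: sqr_ge0.
have A0 := N2_ge0 f; have B0 := N2_ge0 g.
have [B1|B1] := ltP 0 (N2 g).
  have := key (N2 g) (- b).
  have -> : N2 g ^+ 2 * N2 f + 2 * N2 g * - b * b + (- b) ^+ 2 * N2 g =
    N2 g * (N2 f * N2 g - b ^+ 2) by ring.
  by rewrite pmulr_rge0// subr_ge0.
have B2 : N2 g = 0 by apply/eqP; rewrite eq_le B1 B0.
rewrite B2 mulr0.
(* With [N2 g = 0] the form at [(- b, t)] is [b^2 (N2 f - 2 t)], which a large [t] makes negative
   unless [b = 0]. *)
have := key (- b) (N2 f + 1); rewrite B2.
have := key (- b) (N2 f + 2); rewrite B2.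
have : 0 <= b ^+ 2 by exact: sqr_ge0.
by nra.
Qed.

Lemma cauchy_schwarz_abs f g : L2 f -> L2 g ->
  `|\int[mu]_x (f x * g x)| <= Num.sqrt (N2 f) * Num.sqrt (N2 g).
Proof.
move=> Lf Lg; rewrite -sqrtrM ?N2_ge0// -sqrtr_sqr.
by rewrite ler_sqrt ?mulr_ge0 ?N2_ge0//; exact: cauchy_schwarz.
Qed.

Lemma N2_le f g : L2 g -> measurable_fun setT f ->
  (forall x, `|f x| <= `|g x|) -> N2 f <= N2 g.
Proof.
move=> Lg mf fg; apply: Rint_le => [||x]; last 2 first.
- by case: Lg.
- rewrite -real_normK ?num_real// -[leRHS]real_normK ?num_real//.
  by rewrite lerXn2r ?nnegrE.
- by case: (L2_le mf Lg fg).
Qed.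

Lemma N2D_le f g : L2 f -> L2 g ->
  N2 (fun x => f x + g x) <= 2 * N2 f + 2 * N2 g.
Proof.
move=> Lf Lg; rewrite /N2 -!RintegralZl//; [|by case: Lg|by case: Lf].
rewrite -RintegralD//; [|by apply: intgZ; case: Lf|by apply: intgZ; case: Lg].
apply: Rint_le.
- by case: (L2D Lf Lg).
- by apply: intgD; apply: intgZ; [case: Lf|case: Lg].
- by move=> x; have := sqr_ge0 (f x - g x); nra.
Qed.

Lemma N2Z (k : R) f : L2 f -> N2 (fun x => k * f x) = k ^+ 2 * N2 f.
Proof.
move=> [mf if2]; rewrite /N2 -RintegralZl//.
by apply: eq_Rintegral => x _; rewrite exprMn.
Qed.

Lemma sqrt_N2_bounded (C : R) f h : 0 <= C -> L2 f -> measurable_fun setT h ->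
  (forall x, `|h x| <= C) -> Num.sqrt (N2 (fun x => f x * h x)) <= Num.sqrt (N2 f) * C.
Proof.
move=> C0 Lf mh hC.
have -> : Num.sqrt (N2 f) * C = Num.sqrt (N2 (fun x => C * f x)).
  by rewrite N2Z// sqrtrM ?sqr_ge0// sqrtr_sqr ger0_norm// mulrC.
rewrite ler_sqrt ?N2_ge0//; apply: N2_le; first exact: L2Z.
  by apply: measurable_funM => //; case: Lf.
by move=> x; rewrite !normrM (ger0_norm C0) (mulrC C) ler_wpM2l.
Qed.

End real_integrals.

Section parametric_integrals.
Context d1 d2 (X : measurableType d1) (Y : measurableType d2) (R : realType).
Context (m1 : {sigma_finite_measure set X -> \bar R}).
Context (m2 : {sigma_finite_measure set Y -> \bar R}).

Lemma measurable_Rint_param (F : X * Y -> R) : measurable_fun setT F ->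
  measurable_fun setT (fun x => \int[m2]_y F (x, y)).
Proof.
move=> mF; have mE : measurable_fun setT (EFin \o F) by exact/measurable_EFinP.
apply: (measurableT_comp (fine_measurable measurableT)).
under eq_fun do rewrite integralE.
apply: emeasurable_funB.
  have := measurable_fun_fubini_tonelli_F (m2 := m2) (EFin \o F)^\+%E
    (measurable_funepos mE) (funepos_ge0 _).
  apply: eq_measurable_fun => x _.
  by apply: eq_integral => y _; rewrite !funeposE.
have := measurable_fun_fubini_tonelli_F (m2 := m2) (EFin \o F)^\-%E
    (measurable_funeneg mE) (funeneg_ge0 _).
apply: eq_measurable_fun => x _.
by apply: eq_integral => y _; rewrite !funenegE.
Qed.

Lemma measurable_section (F : X * Y -> R) x : measurable_fun setT F ->
  measurable_fun setT (fun y => F (x, y)).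
Proof. by move=> mF; exact: measurableT_comp. Qed.

(** Every section is assumed integrable, so that [fine] loses nothing on the inner integrals and
    Fubini's theorem can be read on real numbers. *)
Lemma Rint_swap (F : X * Y -> R) : measurable_fun setT F ->
  (forall x, intg m2 (fun y => F (x, y))) ->
  (forall y, intg m1 (fun x => F (x, y))) ->
  intg m1 (fun x => \int[m2]_y `|F (x, y)|) ->
  \int[m1]_x \int[m2]_y F (x, y) = \int[m2]_y \int[m1]_x F (x, y).
Proof.
move=> mF i2 i1 iF.
have mE : measurable_fun setT (EFin \o F) by exact/measurable_EFinP.
have iE : (m1 \x m2)%E.-integrable setT (EFin \o F).
  apply/(integrable12ltyP m1 m2 mE).
  rewrite (_ : (fun x => _) = fun x => (\int[m2]_y `|F (x, y)|)%:E).
    by rewrite EFin_Rint// ltry.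
  by apply/funext => x; rewrite -EFin_Rint//; exact: intg_norm.
have := Fubini iE; rewrite /Rintegral => FE.
congr fine; transitivity (\int[m1]_x \int[m2]_y (F (x, y))%:E)%E.
  by apply: eq_integral => x _; rewrite EFin_Rint.
by rewrite FE; apply: eq_integral => y _; rewrite -EFin_Rint.
Qed.

Lemma intg_swap (F : X * Y -> R) : measurable_fun setT F ->
  (forall x, intg m2 (fun y => F (x, y))) ->
  (forall y, intg m1 (fun x => F (x, y))) ->
  intg m1 (fun x => \int[m2]_y `|F (x, y)|) ->
  intg m2 (fun y => \int[m1]_x `|F (x, y)|).
Proof.
move=> mF i2 i1 iF.
have mE : measurable_fun setT (EFin \o F) by exact/measurable_EFinP.
have iE : (m1 \x m2)%E.-integrable setT (EFin \o F).
  apply/(integrable12ltyP m1 m2 mE).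
  rewrite (_ : (fun x => _) = fun x => (\int[m2]_y `|F (x, y)|)%:E).
    by rewrite EFin_Rint// ltry.
  by apply/funext => x; rewrite -EFin_Rint//; exact: intg_norm.
apply: ge0_intg.
- apply: (measurableT_comp (fine_measurable measurableT)).
  have := measurable_fun_fubini_tonelli_G (m1 := m1) (fun z => `|F z|%:E).
  apply => //; apply/measurable_EFinP; exact: measurableT_comp.
- by move=> y; apply: Rintegral_ge0.
- have /(integrable21ltyP m1 m2 mE) := iE.
  rewrite (_ : (fun x => _) = fun y => (\int[m1]_x `|F (x, y)|)%:E)//.
  by apply/funext => y; rewrite -EFin_Rint//; exact: intg_norm.
Qed.

End parametric_integrals.

(** * Lebesgue measure on boxes and under translations *)

Section boxes.
Context (R : realType) (n : nat).
Implicit Types (a b : 'I_n -> R) (v x y : 'rV[R]_n).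

Definition obox a b : set 'rV[R]_n := [set v | forall i, v 0 i \in `]a i, b i[].

Definition oboxes : set (set 'rV[R]_n) := [set A | exists a b, A = obox a b].

Lemma measurable_obox a b : measurable (obox a b).
Proof.
exact: (@measurable_box R n (fun i => [set` `]a i, b i[]) (fun i => measurable_itv _)).
Qed.

Lemma setI_closed_oboxes : setI_closed oboxes.
Proof.
move=> _ _ [a [b ->]] [a' [b' ->]].
exists (fun i => Num.max (a i) (a' i)), (fun i => Num.min (b i) (b' i)).
apply/seteqP; split => v /=.
  move=> [va va'] i; move: (va i) (va' i); rewrite !in_itv/= => /andP[? ?] /andP[? ?].
  by rewrite gt_max lt_min; apply/andP; split; apply/andP.
move=> vm; split => i; move: (vm i); rewrite !in_itv/= gt_max lt_min;
  by move=> /andP[/andP[? ?] /andP[? ?]]; apply/andP.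
Qed.

Lemma bigcup_obox : \bigcup_k obox (fun=> - k%:R) (fun=> k%:R) = setT.
Proof.
apply/seteqP; split => // v _.
exists (Num.truncn (\sum_i `|v 0 i|)).+1 => // i; rewrite /= in_itv/= -ltr_norml.
apply: le_lt_trans (truncnS_gt _).
by rewrite (bigD1 i)//= lerDl sumr_ge0.
Qed.

Lemma measurable_rV_oboxes : (measurable : set (set 'rV[R]_n)) = <<s oboxes >>.
Proof.
apply/seteqP; split; last first.
  apply: smallest_sub; first exact: sigma_algebra_measurable.
  by move=> _ [a [b ->]]; exact: measurable_obox.
apply: smallest_sub; first exact: smallest_sigma_algebra.
move=> _ [i [j [B mB ->]]].
pose T := g_sigma_algebraType oboxes.
suff : measurable_fun [set: T] (fun v : T => (v : 'rV[R]_n) i j).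
  by move=> /(_ measurableT B mB); rewrite setTI.
apply: (measurability _ (RGenOInfty.measurableE R)).
move=> _ [_ [x ->] <-]; rewrite setTI ord1.
(* The half-space [x < v j] is the union of boxes whose lower face in direction [j] is at [x] and
   whose other faces recede to infinity. *)
rewrite [X in measurable X](_ : _ = \bigcup_k
   obox (fun l => if l == j then x else - k%:R) (fun=> k%:R)).
  by apply: bigcupT_measurable => k; apply: sub_sigma_algebra; eexists; eexists.
apply/seteqP; split => v /=; rewrite in_itv/= andbT.
  move=> xv; have : [set: 'rV[R]_n] v by [].
  rewrite -bigcup_obox => -[k _ vk]; exists k => // l.
  by move: (vk l); rewrite !in_itv/=; case: eqP => // -> /andP[_ ->]; rewrite xv.
by move=> [k _ /(_ j)]; rewrite eqxx in_itv/= => /andP[].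
Qed.

Lemma lebesgue_obox a b : (forall i, a i <= b i) ->
  lebesgue_rV R n (obox a b) = (\prod_i (b i - a i))%:E.
Proof.
move=> ab.
rewrite [LHS](lebesgue_rV_box (B := fun i => [set` `]a i, b i[])); last first.
  by move=> i; exact: measurable_itv.
rewrite -prodEFin; apply: eq_bigr => i _.
rewrite lebesgue_measure_itv/= lte_fin; case: ltP => // ba.
have /eqP : a i == b i by rewrite eq_le ab ba.
by move=> ->; rewrite subrr.
Qed.

Lemma lebesgue_obox_lty a b : (lebesgue_rV R n (obox a b) < +oo)%E.
Proof.
apply: (@le_lt_trans _ _ (lebesgue_rV R n (obox a (fun i => Num.max (a i) (b i))))).
  apply: le_measure; rewrite ?inE; [exact: measurable_obox|exact: measurable_obox|].
  move=> v vab i; move: (vab i); rewrite !in_itv/= => /andP[-> vb].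
  by rewrite lt_max vb orbT.
by rewrite lebesgue_obox ?ltry// => i; rewrite le_max lexx.
Qed.

(** Boxes form a generating pi-system with an exhausting sequence of finite volume; the invariances
    below thus reduce to comparing volumes of boxes. *)
Lemma lebesgue_rV_unique (m : {measure set 'rV[R]_n -> \bar R}) :
  (forall a b, m (obox a b) = lebesgue_rV R n (obox a b)) ->
  forall A, measurable A -> m A = lebesgue_rV R n A.
Proof.
move=> mbox; apply: (measure_unique oboxes
   (fun k => obox (fun=> - k%:R) (fun=> k%:R))).
- exact: measurable_rV_oboxes.
- exact: setI_closed_oboxes.
- by move=> k; eexists; eexists.
- exact: bigcup_obox.
- by move=> _ [a [b ->]]; exact: mbox.
- by move=> k; rewrite mbox; exact: lebesgue_obox_lty.
Qed.

End boxes.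

(** * Borel sets and invariance of Lebesgue measure *)

Section rV_borel.
Context (R : realType) (n : nat).
Implicit Types (x y v : 'rV[R]_n) (A K : set 'rV[R]_n).

(** The sigma-algebra is the product one, so topology has to be tied to it: an open set is the union
    of the countably many boxes with rational vertices that it contains. *)
Lemma open_measurable_rV A : open A -> measurable A.
Proof.
move=> oA.
pose I : set ({ffun 'I_n -> rat} * {ffun 'I_n -> rat}) :=
  [set p : {ffun 'I_n -> rat} * {ffun 'I_n -> rat} |
    obox (fun i => ratr (p.1 i)) (fun i => ratr (p.2 i)) `<=` A].
have -> : A = \bigcup_(p in I) obox (fun i => ratr (p.1 i)) (fun i => ratr (p.2 i)).
  apply/seteqP; split => [v Av|v [p Ip]]; last exact: Ip.
  have : nbhs v A by apply: open_nbhs_nbhs; split.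
  (* A neighbourhood of a matrix is given by one neighbourhood per entry, so the rational bounds can
     be chosen coordinate by coordinate. *)
  move=> [P Pv PA].
  have /choice[e eP] : forall i, exists p : rat * rat, ratr p.1 < v 0 i < ratr p.2 /\
      (forall z : R, ratr p.1 < z < ratr p.2 -> P 0 i z).
    move=> i; have /nbhs_ballP[e /= e0 eP] := Pv 0 i.
    have [q1 q1v] : exists q : rat, ratr q \in `](v 0 i - e), (v 0 i)[.
      by apply: rat_in_itvoo; rewrite ltrBlDr ltrDl.
    have [q2 q2v] : exists q : rat, ratr q \in `](v 0 i), (v 0 i + e)[.
      by apply: rat_in_itvoo; rewrite ltrDl.
    exists (q1, q2); move: q1v q2v; rewrite /= !in_itv/= => /andP[a b] /andP[c f].
    split; first by rewrite b c.
    move=> z /= /andP[g h]; apply: eP.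
    by rewrite /ball/= ltr_norml; apply/andP; split; lra.
  exists ([ffun i => (e i).1], [ffun i => (e i).2]) => /=.
    move=> w /= wb; apply: PA => i j; rewrite ord1.
    by apply: (eP j).2; move: (wb j); rewrite in_itv /= !ffunE.
  by move=> i; rewrite in_itv/= !ffunE; exact: (eP i).1.
rewrite bigcup_mkcond; apply: countable_bigcupT_measurable => [|p]; first exact: countableP.
by case: ifPn => // _; exact: measurable_obox.
Qed.

Lemma continuous_measurable_rV (f : 'rV[R]_n -> R) : continuous f ->
  measurable_fun setT f.
Proof.
move=> cf; apply: (measurability _ (RGenOInfty.measurableE R)).
move=> _ [_ [x ->] <-]; rewrite setTI; apply: open_measurable_rV.
by apply: open_comp => // z _; exact: cf.
Qed.

Definition cube (r : R) : set 'rV[R]_n := obox (fun=> - r) (fun=> r).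

Lemma cubeP r v : cube r v <-> forall i, `|v 0 i| < r.
Proof.
by split => vr i; move: (vr i); rewrite in_itv/= ltr_norml.
Qed.

Lemma compact_cube K : compact K -> exists2 r : R, 0 < r & K `<=` cube r.
Proof.
move=> /compact_bounded[M [_ MK]].
exists (`|M| + 2); first by rewrite ltr_wpDl.
move=> v Kv; apply/cubeP => i.
have /(MK _)/(_ v Kv) : M < `|M| + 1 by rewrite (le_lt_trans (ler_norm _))// ltrDl.
move=> vM; apply: (@le_lt_trans _ _ `|v|); last by apply: (le_lt_trans vM); lra.
rewrite [leRHS]mx_normrE; exact: (le_bigmax _ _ (0, i)).
Qed.

Lemma measurable_compact_rV K : compact K -> measurable K.
Proof.
move=> cK; rewrite -[K]setCK; apply: measurableC; apply: open_measurable_rV.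
by apply: closed_openC; apply: compact_closed => //; exact: norm_hausdorff.
Qed.

Lemma measurable_addrV x : measurable_fun setT (fun v : 'rV[R]_n => v + x).
Proof.
apply: measurable_fun_matrix => // i j; rewrite ord1.
under eq_fun do rewrite mxE.
by apply: measurable_funD => //; exact: measurable_entry.
Qed.

Lemma measurable_subrV x : measurable_fun setT (fun v : 'rV[R]_n => x - v).
Proof.
apply: measurable_fun_matrix => // i j; rewrite ord1.
under eq_fun do rewrite !mxE.
by apply: measurable_funB => //; exact: measurable_entry.
Qed.

Lemma obox0 (a b : 'I_n -> R) i : b i <= a i -> obox a b = set0.
Proof.
move=> ba; rewrite -subset0 => v /(_ i); rewrite in_itv/= => /andP[av vb].
by have := lt_trans av vb; rewrite ltNge ba.
Qed.

(** The product formula is for ordered faces; a box with a crossed pair of faces is empty, and so is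
    any box with the same signed side lengths. *)
Lemma lebesgue_obox_eq (a b a' b' : 'I_n -> R) :
  (forall i, b' i - a' i = b i - a i) ->
  lebesgue_rV R n (obox a' b') = lebesgue_rV R n (obox a b).
Proof.
move=> ab; have [[i bai]|] := pselect (exists i, b i <= a i).
  by rewrite (obox0 bai) (@obox0 a' b' i)// -subr_le0 ab subr_le0.
move=> /forallNP abn.
have ab1 i : a i <= b i by rewrite ltW// ltNge; apply/negP.
rewrite !lebesgue_obox//; first by under eq_bigr do rewrite ab.
by move=> i; rewrite -subr_ge0 ab subr_ge0.
Qed.

Lemma lebesgue_addrV x A : measurable A ->
  lebesgue_rV R n ((fun v => v + x) @^-1` A) = lebesgue_rV R n A.
Proof.
pose phi : {mfun 'rV[R]_n >-> 'rV[R]_n} := mfun_Sub (mem_set (measurable_addrV x)).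
apply: (@lebesgue_rV_unique R n (pushforward (lebesgue_rV R n) phi)).
move=> a b; rewrite [LHS](_ : _ = lebesgue_rV R n (obox (fun i => a i - x 0 i) (fun i => b i - x 0 i))).
  by apply: lebesgue_obox_eq => i; ring.
congr (lebesgue_rV R n _); apply/seteqP; split => v /= vab i; move: (vab i);
  by rewrite !in_itv/= mxE ltrBlDr ltrBrDr.
Qed.

Lemma lebesgue_subrV x A : measurable A ->
  lebesgue_rV R n ((fun v => x - v) @^-1` A) = lebesgue_rV R n A.
Proof.
pose phi : {mfun 'rV[R]_n >-> 'rV[R]_n} := mfun_Sub (mem_set (measurable_subrV x)).
apply: (@lebesgue_rV_unique R n (pushforward (lebesgue_rV R n) phi)).
move=> a b; rewrite [LHS](_ : _ = lebesgue_rV R n (obox (fun i => x 0 i - b i) (fun i => x 0 i - a i))).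
  by apply: lebesgue_obox_eq => i; ring.
congr (lebesgue_rV R n _); apply/seteqP; split => v /= vab i; move: (vab i);
  rewrite !in_itv/= !mxE => /andP[u w]; apply/andP; split; lra.
Qed.

End rV_borel.

Section measure_preserving.
Context d (X : measurableType d) (R : realType) (mu : {measure set X -> \bar R}).
Variable phi : {mfun X >-> X}.
Hypothesis phi_mu : forall A, measurable A -> mu (phi @^-1` A) = mu A.

Lemma ge0_integral_preserving (f : X -> \bar R) : measurable_fun setT f ->
  (forall x, 0 <= f x)%E -> (\int[mu]_x f (phi x) = \int[mu]_x f x)%E.
Proof.
move=> mf f0; transitivity (\int[pushforward mu phi]_x f x)%E; last first.
  by apply: eq_measure_integral => A mA _; exact: phi_mu.
by rewrite ge0_integral_pushforward.
Qed.

Lemma intg_preserving (f : X -> R) : intg mu f -> intg mu (fun x => f (phi x)).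
Proof.
move=> /integrableP[/measurable_EFinP mf fi]; apply/integrableP; split.
  apply/measurable_EFinP; exact: measurableT_comp.
rewrite (ge0_integral_preserving (f := fun x => `|(f x)%:E|%E))//.
by apply: measurableT_comp => //; exact/measurable_EFinP.
Qed.

Lemma Rint_preserving (f : X -> R) : measurable_fun setT f ->
  \int[mu]_x f (phi x) = \int[mu]_x f x.
Proof.
move=> /measurable_EFinP mf; congr fine; rewrite integralE [RHS]integralE.
congr (_ - _)%E.
- rewrite -(ge0_integral_preserving (measurable_funepos mf)) //.
  by apply: eq_integral => x _; rewrite !funeposE.
- rewrite -(ge0_integral_preserving (measurable_funeneg mf)) //.
  by apply: eq_integral => x _; rewrite !funenegE.
Qed.

End measure_preserving.

Section rV_invariance.
Context (R : realType) (n : nat).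
Local Notation leb := (lebesgue_rV R n).
Implicit Types (f : 'rV[R]_n -> R) (x : 'rV[R]_n).

Let add_mfun x : {mfun 'rV[R]_n >-> 'rV[R]_n} := mfun_Sub (mem_set (measurable_addrV x)).
Let sub_mfun x : {mfun 'rV[R]_n >-> 'rV[R]_n} := mfun_Sub (mem_set (measurable_subrV x)).

Lemma intg_addrV x f : intg leb f -> intg leb (fun v => f (v + x)).
Proof. by apply: (intg_preserving (phi := add_mfun x)) => A; exact: lebesgue_addrV. Qed.

Lemma intg_subrV x f : intg leb f -> intg leb (fun v => f (x - v)).
Proof. by apply: (intg_preserving (phi := sub_mfun x)) => A; exact: lebesgue_subrV. Qed.

Lemma L2_addrV x f : L2 leb f -> L2 leb (fun v => f (v + x)).
Proof.
move=> [mf if2]; split; last exact: (intg_addrV x if2).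
exact: (measurableT_comp mf (measurable_addrV x)).
Qed.

Lemma Rint_addrV x f : measurable_fun setT f ->
  \int[leb]_v f (v + x) = \int[leb]_v f v.
Proof. by apply: (Rint_preserving (phi := add_mfun x)) => A; exact: lebesgue_addrV. Qed.

Lemma Rint_subrV x f : measurable_fun setT f ->
  \int[leb]_v f (x - v) = \int[leb]_v f v.
Proof. by apply: (Rint_preserving (phi := sub_mfun x)) => A; exact: lebesgue_subrV. Qed.

Lemma measurable_sub2 (k : 'rV[R]_n -> R) : measurable_fun setT k ->
  measurable_fun setT (fun z : 'rV[R]_n * 'rV[R]_n => k (z.1 - z.2)).
Proof.
move=> mk; apply: (measurableT_comp mk).
apply: measurable_fun_matrix => // i j.
under eq_fun do rewrite !mxE.
apply: measurable_funB.
  by apply: (measurableT_comp (measurable_entry i j)).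
by apply: (measurableT_comp (measurable_entry i j)).
Qed.

Lemma intg_indic_cube r : intg leb (\1_(cube r)).
Proof.
apply: ge0_intg => //.
- exact: (measurable_indic (measurable_obox _ _)).
- rewrite integral_indic ?setIT//; last exact: measurable_obox.
  exact: lebesgue_obox_lty.
Qed.

End rV_invariance.

(** * Test functions and difference quotients *)

Section smooth_bump.
Context (R : realType).
Implicit Types (f g : R -> R) (n k : nat).

Lemma is_deriveP (V W : normedModType R) (a v : V) (f : V -> W) df :
  is_derive a v f df <->
  (fun h : R => h^-1 *: (f (h *: v + a) - f a)) @ 0^' --> df.
Proof.
split => [[dfa <-]|fdf]; first exact: dfa.
split; first by apply/cvg_ex; exists df.
by apply: cvg_lim fdf; exact: norm_hausdorff.
Qed.

(** Derivatives are witnesses, so that the closure properties are inductions on [k] over explicit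
    formulas. *)
Fixpoint smoothn k f : Prop :=
  continuous f /\ if k is k'.+1 then
    exists2 f', (forall x : R, is_derive x (1 : R) f (f' x)) & smoothn k' f' else True.

Lemma smoothn_continuous k f : smoothn k f -> continuous f.
Proof. by case: k => [|k] []. Qed.

Lemma is_derive_continuous f f' : (forall x : R, is_derive x (1 : R) f (f' x)) -> continuous f.
Proof.
move=> ff' x; apply: differentiable_continuous; apply/derivable1_diffP.
by case: (ff' x).
Qed.

Lemma smoothnS k f : smoothn k.+1 f -> smoothn k f.
Proof.
elim: k f => [|k IHk] f [cf [f' ff' sf']]; split => //.
by exists f' => //; exact: IHk.
Qed.

Lemma smoothnD k f g : smoothn k f -> smoothn k g -> smoothn k (fun x => f x + g x).
Proof.
elim: k f g => [|k IHk] f g [cf Sf] [cg Sg]; split => //.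
- by move=> x; apply: cvgD; [exact: cf|exact: cg].
- by move=> x; apply: cvgD; [exact: cf|exact: cg].
- move: Sf Sg => [f' ff' sf'] [g' gg' sg'].
  by exists (fun x => f' x + g' x); [move=> x; exact: is_deriveD|exact: IHk].
Qed.

Lemma smoothnM k f g : smoothn k f -> smoothn k g -> smoothn k (fun x => f x * g x).
Proof.
elim: k f g => [|k IHk] f g [cf Sf] [cg Sg]; split => //.
- by move=> x; apply: cvgM; [exact: cf|exact: cg].
- by move=> x; apply: cvgM; [exact: cf|exact: cg].
- move: (Sf) (Sg) => [f' ff' sf'] [g' gg' sg'].
  exists (fun x => f x * g' x + g x * f' x).
    by move=> x; exact: (@is_deriveM _ _ f g).
  by apply: smoothnD; apply: IHk => //; apply: smoothnS; split.
Qed.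

Lemma smoothn_cst k (c : R) : smoothn k (fun=> c).
Proof.
elim: k c => [|k IHk] c; split => //; try exact: cst_continuous.
by exists (fun=> 0) => // x; exact: is_derive_cst.
Qed.

Lemma smoothn_affine k (a b : R) f : smoothn k f -> smoothn k (fun x => f (a * x + b)).
Proof.
have caf : continuous (fun x : R => a * x + b).
  by move=> x; apply: cvgD; [apply: cvgM; [exact: cvg_cst|exact: cvg_id]|exact: cvg_cst].
elim: k f => [|k IHk] f [cf Sf]; split => //.
- by move=> x; apply: continuous_comp; [exact: caf|exact: cf].
- by move=> x; apply: continuous_comp; [exact: caf|exact: cf].
- move: Sf => [f' ff' sf'].
  exists (fun x => f' (a * x + b) * a); last first.
    by apply: smoothnM; [exact: IHk|exact: smoothn_cst].
  move=> x; apply: (@is_derive1_comp _ f (fun x => a * x + b)).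
  have := is_deriveD (is_deriveZ a (is_derive_id x (1 : R))) (is_derive_cst b x 1).
  by rewrite addr0 [_ *: _]mulr1.
Qed.

(** The power [x^-n] makes the family closed under differentiation: the derivative at index [n]
    combines the indices [n + 1] and [n + 2], and smoothness becomes an induction on the order. *)
Definition bump0 n (x : R) : R := if 0 < x then x^-1 ^+ n * expR (- x^-1) else 0.

(** From [exp y >= y^(n+2) / (n+2)!] at [y = 1/x]. The square on the right yields the derivative 0
    at the origin for every [n]. *)
Lemma bump0_le n (x : R) : `|bump0 n x| <= n.+2`!%:R * x ^+ 2.
Proof.
rewrite /bump0; case: ifPn => [x0|_]; last by rewrite normr0 mulr_ge0// sqr_ge0.
have y0 : 0 < x^-1 by rewrite invr_gt0.
rewrite ger0_norm; last by rewrite mulr_ge0 ?expR_ge0// exprn_ge0// ltW.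
have F0 : 0 < n.+2`!%:R :> R by rewrite ltr0n fact_gt0.
have := expR_ge1Dxn n.+1 (ltW y0) => H.
have {}H : x^-1 ^+ n.+2 <= n.+2`!%:R * expR x^-1.
  by rewrite -ler_pdivrMl// mulrC (le_trans _ H)// lerDr.
have -> : x^-1 ^+ n = x^-1 ^+ n.+2 * x ^+ 2.
  by rewrite -addn2 exprD -mulrA -exprMn mulVf ?gt_eqF// expr1n mulr1.
rewrite mulrAC ler_wpM2r ?sqr_ge0//.
rewrite expRN ler_pdivrMr ?expR_gt0//.
Qed.

Lemma is_derive_bump0 n (x : R) :
  is_derive x 1 (bump0 n) (- n%:R * bump0 n.+1 x + bump0 n.+2 x).
Proof.
have [x0|x0|->] := ltgtP x 0.
- rewrite {2 3}/bump0 ltNge (ltW x0)/= mulr0 addr0.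
  apply: (near_eq_is_derive _ (is_derive_cst (0 : R) x (1 : R))).
  have : \forall y \near x, y < 0 by exact: lt_nbhsl.
  by apply: filterS => y y0; rewrite /bump0 ltNge (ltW y0).
- suff : is_derive x (1 : R) (fun x : R => x^-1 ^+ n * expR (- x^-1))
      (- n%:R * bump0 n.+1 x + bump0 n.+2 x).
    apply: near_eq_is_derive.
    have : \forall y \near x, 0 < y by exact: lt_nbhsr.
    by apply: filterS => y y0; rewrite /bump0 y0.
  rewrite /bump0 x0.
  have dV : is_derive x 1 (fun y : R => y^-1) (- x ^- 2).
    have := @is_deriveV R id x 1 1 (lt0r_neq0 x0) (is_derive_id _ _).
    by rewrite [_ *: _]mulr1.
  have dE : is_derive x 1 (fun y : R => expR (- y^-1)) (expR (- x^-1) * x ^- 2).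
    apply: (@is_derive1_comp _ expR (fun y => - y^-1)).
    by have := is_deriveN dV; rewrite opprK.
  have := is_deriveM (is_deriveX n dV) dE.
  rewrite (_ : _ * _ = (fun y : R => y^-1 ^+ n * expR (- y^-1)))//; last first.
    by rewrite exprfctE.
  move=> D; apply: is_derive_eq; rewrite exprfctE.
  rewrite /GRing.scale/=.
  have -> : x ^- 2 = x^-1 ^+ 2 by rewrite exprVn.
  case: n {D} => [|n]; first by rewrite !expr0; ring.
  rewrite succnK; move: (expR (- x^-1)) (n.+1%:R : R) (x^-1) => e c y.
  by rewrite !exprS; ring.
- rewrite {2 3}/bump0 ltxx mulr0 addr0; apply/is_deriveP.
  apply/cvgrPdist_le => e e0.
  have F0 : 0 < n.+2`!%:R :> R by rewrite ltr0n fact_gt0.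
  near=> h; rewrite sub0r normrN addr0 [_ *: 1]mulr1.
  have -> : bump0 n 0 = 0 by rewrite /bump0 ltxx.
  rewrite subr0 normrZ.
  apply: (@le_trans _ _ (`|h^-1| * (n.+2`!%:R * h ^+ 2))).
    by rewrite ler_wpM2l// bump0_le.
  have h0 : h != 0 by near: h; exact: nbhs_dnbhs_neq.
  rewrite -(real_normK (num_real h)) normfV.
  have -> : `|h|^-1 * (n.+2`!%:R * `|h| ^+ 2) = n.+2`!%:R * `|h|.
    by field; rewrite normr_eq0.
  rewrite mulrC -ler_pdivlMr//.
  near: h; apply: dnbhs0_le; by rewrite divr_gt0.
Unshelve. all: by end_near. Qed.

Lemma smoothn_bump0 k n : smoothn k (bump0 n).
Proof.
elim: k n => [|k IHk] n; split => //;
  try exact: (is_derive_continuous (is_derive_bump0 n)).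
exists (fun x => - n%:R * bump0 n.+1 x + bump0 n.+2 x); first exact: is_derive_bump0.
by apply: smoothnD => //; apply: smoothnM => //; exact: smoothn_cst.
Qed.

(** One factor vanishes for [x <= - 1/(m+1)], the other for [x >= 1/(m+1)]. Normalisation is
    postponed to [moll]. *)
Definition bump (m : nat) (x : R) : R :=
  bump0 0 (m.+1%:R * x + 1) * bump0 0 (- m.+1%:R * x + 1).

Lemma smoothn_bump k m (c : R) : smoothn k (fun x => bump m (x - c)).
Proof.
have -> : (fun x => bump m (x - c)) = (fun x => bump m (1 * x + - c)).
  by apply/funext => x; rewrite mul1r.
apply: (@smoothn_affine k 1 (- c) (bump m)).
by apply: smoothnM; apply: smoothn_affine; exact: smoothn_bump0.
Qed.

Lemma bumpN m x : bump m (- x) = bump m x.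
Proof. by rewrite /bump mulrC !mulrN !mulNr opprK. Qed.

Lemma bump0_ge0 n x : 0 <= bump0 n x.
Proof.
rewrite /bump0; case: ifPn => // x0.
by rewrite mulr_ge0 ?expR_ge0// exprn_ge0// invr_ge0 ltW.
Qed.

Lemma bump_ge0 m x : 0 <= bump m x.
Proof. by rewrite mulr_ge0// bump0_ge0. Qed.

Lemma bump_eq0 m x : m.+1%:R^-1 <= `|x| -> bump m x = 0.
Proof.
move=> mx; have : 1 <= m.+1%:R * `|x| by rewrite -ler_pdivrMl ?ltr0n// mulr1.
rewrite -(ger0_norm (ler0n R m.+1)) -normrM ler_normr => /orP[] H.
  by rewrite /bump mulrC /bump0 ifF ?mul0r//; apply/negbTE; rewrite -leNgt; lra.
by rewrite /bump /bump0 ifF ?mul0r//; apply/negbTE; rewrite -leNgt; lra.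
Qed.

Lemma bump_gt0 m x : `|x| < m.+1%:R^-1 -> 0 < bump m x.
Proof.
move=> xm; have : m.+1%:R * `|x| < 1 by rewrite -ltr_pdivlMl ?mulr1// ltr0n.
rewrite -(ger0_norm (ler0n R m.+1)) -normrM ltr_norml => /andP[H1 H2].
rewrite /bump /bump0 ![(if _ then _ else _)]ifT; try lra.
by rewrite !expr0 !mul1r mulr_gt0// expR_gt0.
Qed.

End smooth_bump.

Section test_functions.
Context (R : realType) (n : nat).
Local Notation Rn := 'rV[R]_n.
Local Notation leb := (lebesgue_rV R n).
Local Notation e_ := (@basis_vector R n).
Implicit Types (f : Rn -> R) (h : 'I_n -> R -> R) (x y : Rn) (i : 'I_n).

Definition tensor h x : R := \prod_i h i (x 0 i).

Lemma continuous_prod_seq (s : seq 'I_n) h : (forall i, continuous (h i)) ->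
  continuous (fun x : Rn => \prod_(i <- s) h i (x 0 i)).
Proof.
move=> ch; elim: s => [|i s IHs] x.
  rewrite (_ : (fun _ => _) = cst 1); first exact: cst_continuous.
  by apply/funext => y; rewrite big_nil.
have C1 : {for x, continuous (fun y : Rn => h i (y 0 i))}.
  apply: (@continuous_comp _ _ _ (fun y : Rn => y 0 i) (h i)); last exact: ch.
  exact: coord_continuous.
rewrite (_ : (fun _ => _) = (fun y : Rn => h i (y 0 i) * \prod_(i <- s) h i (y 0 i))).
  exact: (continuousM C1 (IHs x)).
by apply/funext => y; rewrite big_cons.
Qed.

Lemma continuous_tensor h : (forall i, continuous (h i)) -> continuous (tensor h).
Proof. by move=> ch; exact: continuous_prod_seq. Qed.

Lemma basis_shift x i (t : R) j :
  (t *: e_ i + x) 0 j = (if j == i then t + x 0 j else x 0 j).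
Proof.
rewrite !mxE eqxx/=; case: eqP => _; first by rewrite mulr1.
by rewrite mulr0 add0r.
Qed.

Lemma is_derive_tensor h i (h' : R -> R) x :
  is_derive (x 0 i) (1 : R) (h i) (h' (x 0 i)) ->
  is_derive x (e_ i) (tensor h) (tensor (fun j => if j == i then h' else h j) x).
Proof.
move=> /is_deriveP D; apply/is_deriveP.
have E (y : R) : tensor h (y *: e_ i + x) = h i (y + x 0 i) * \prod_(j | j != i) h j (x 0 j).
  rewrite /tensor (bigD1 i)//= basis_shift eqxx; congr (_ * _).
  by apply: eq_bigr => j ji; rewrite basis_shift (negbTE ji).
have -> : tensor (fun j => if j == i then h' else h j) x =
    h' (x 0 i) * \prod_(j | j != i) h j (x 0 j).
  rewrite /tensor (bigD1 i)//= eqxx; congr (_ * _).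
  by apply: eq_bigr => j ji; rewrite (negbTE ji).
have -> : tensor h x = h i (x 0 i) * \prod_(j | j != i) h j (x 0 j).
  by rewrite /tensor (bigD1 i).
under eq_fun do rewrite E -mulrBl [_ *: _]mulrA.
apply: cvgMl.
rewrite (_ : (fun y : R => _) = (fun y : R => y^-1 *: (h i (y%:A + x 0 i) - h i (x 0 i))))//.
by apply/funext => y; rewrite [y%:A]mulr1.
Qed.

(** A derivative along a basis vector replaces one factor by its derivative, so tensor products are
    preserved along the induction on [k]. *)
Lemma of_class_C_tensor k h : (forall i, smoothn k (h i)) -> of_class_C k (tensor h).
Proof.
elim: k h => [|k IHk] h sh; split => //; try by apply: continuous_tensor => i;
  apply: smoothn_continuous.
move=> i; have [_ [h' hh' sh']] := sh i.
have D x := is_derive_tensor (hh' (x 0 i)).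
split; first by move=> x; case: (D x).
have -> : (fun x => 'D_(e_ i) (tensor h) x) =
    tensor (fun j => if j == i then h' else h j).
  by apply/funext => x; case: (D x).
by apply: IHk => j; case: eqP => // _; exact: smoothnS.
Qed.

Lemma of_class_CZ k (c : R) f : of_class_C k f -> of_class_C k (fun x : Rn => c * f x).
Proof.
have cM g : continuous g -> continuous (fun x : Rn => c * g x).
  by move=> cg x; apply: (continuousM _ (cg x)); exact: cst_continuous.
elim: k f => [|k IHk] f [cf Cf]; first by split => //; exact: cM.
split; first exact: cM.
move=> i; have [df Cdf] := Cf i.
have D x : is_derive x (e_ i) (fun x => c * f x) (c * 'D_(e_ i) f x).
  by apply: is_deriveZ; split.
split; first by move=> x; case: (D x).
have -> : (fun x => 'D_(e_ i) (fun x => c * f x) x) = (fun x => c * 'D_(e_ i) f x).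
  by apply/funext => x; case: (D x).
exact: IHk.
Qed.

Definition ccube (r : R) : set Rn := [set v | forall i, v 0 i \in `[- r, r]].

Lemma compact_ccube r : compact (ccube r).
Proof.
have := @rV_compact R n (fun=> [set` `[- r, r]]) (fun=> @segment_compact R _ _).
by [].
Qed.

Lemma ccubeP r v : ccube r v <-> forall i, `|v 0 i| <= r.
Proof. by split => vr i; move: (vr i); rewrite in_itv/= ler_norml. Qed.

Lemma compact_closure_support f r : (forall x, ~ ccube r x -> f x = 0) ->
  compact (closure [set x : Rn | f x != 0]).
Proof.
move=> f0; apply: (@subclosed_compact _ _ (ccube r)).
- exact: closed_closure.
- exact: compact_ccube.
- have cc : closed (ccube r).
    by apply: compact_closed; [exact: norm_hausdorff|exact: compact_ccube].
  rewrite [X in _ `<=` X](closure_id (ccube r)).1//.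
  apply: closure_subset => x /=; apply: contra_neqP => nx; exact: f0.
Qed.

Lemma tensor0 h i x : h i (x 0 i) = 0 -> tensor h x = 0.
Proof. by move=> hi0; rewrite /tensor (bigD1 i)//= hi0 mul0r. Qed.

Lemma test_function_tensor (c r : R) h : (forall k i, smoothn k (h i)) ->
  (forall i (z : R), r < `|z| -> h i z = 0) ->
  test_function (fun x => c * tensor h x).
Proof.
move=> sh h0; split; first by move=> k; apply: of_class_CZ; exact: of_class_C_tensor.
apply: (@compact_closure_support _ r) => x /ccubeP /existsNP[i /negP].
by rewrite -ltNge => /(h0 i) hi0; rewrite (tensor0 hi0) mulr0.
Qed.

End test_functions.

(** * Integration by parts through difference quotients *)

Section difference_quotients.
Context (R : realType) (n : nat).
Local Notation Rn := 'rV[R]_n.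
Local Notation leb := (lebesgue_rV R n).
Local Notation e_ := (@basis_vector R n).
Implicit Types (psi A B C M N P : Rn -> R) (x y : Rn) (i : 'I_n).

(* [A] has derivative [A'] in the direction [i], with difference quotients of
   step at most 1 and values on segments of length 1 dominated by [M]. *)
Record ddiff i A A' M : Prop := DDiff {
  ddiff_meas : measurable_fun setT A ;
  ddiff_dom : forall x t, 0 <= t <= 1 -> `|A (x + t *: e_ i)| <= M x ;
  ddiff_lip : forall x t, 0 <= t <= 1 -> `|A (x + t *: e_ i) - A x| <= t * M x ;
  ddiff_lim : forall x,
    (fun k => k.+1%:R * (A (x + k.+1%:R^-1 *: e_ i) - A x)) @ \oo --> A' x }.

Arguments ddiff_lim {i A A' M} _ x.

Lemma natV_itv k : 0 <= (k.+1%:R^-1 : R) <= 1.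
Proof. by rewrite invr_ge0 ler0n/= invf_le1 ?ltr0n// ler1n. Qed.

Section facts.
Context i A A' M (H : ddiff i A A' M).

Lemma ddiff_le x : `|A x| <= M x.
Proof. by have := ddiff_dom H x (t := 0); rewrite lexx ler01 scale0r addr0; exact. Qed.

Lemma ddiff_ge0 x : 0 <= M x. Proof. exact: le_trans (ddiff_le x). Qed.

Lemma ddiff_quot x k : `|k.+1%:R * (A (x + k.+1%:R^-1 *: e_ i) - A x)| <= M x.
Proof.
rewrite normrM ger0_norm// -ler_pdivlMl ?ltr0n//.
exact: (ddiff_lip H x (natV_itv k)).
Qed.

Lemma measurable_ddiff_quot k :
  measurable_fun setT (fun x => k.+1%:R * (A (x + k.+1%:R^-1 *: e_ i) - A x)).
Proof.
apply: measurable_funM => //; apply: measurable_funB; last exact: ddiff_meas H.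
by apply: measurableT_comp; [exact: ddiff_meas H|exact: measurable_addrV].
Qed.

Lemma ddiff_meas' : measurable_fun setT A'.
Proof.
apply: (measurable_fun_cvg measurable_ddiff_quot) => x _; exact: ddiff_lim H x.
Qed.

Lemma ddiff_le' x : `|A' x| <= M x.
Proof.
by apply: (cvgn_le (cvg_norm (ddiff_lim H x))) => k; exact: ddiff_quot.
Qed.

(** Each difference quotient has integral 0 by translation invariance, and [M] dominates all of
    them. *)
Lemma ddiff_Rint0 : intg leb M -> \int[leb]_x A' x = 0.
Proof.
move=> iM.
have iA : intg leb A by apply: (intg_le (ddiff_meas H) ddiff_le iM).
have c0 : (fun k => \int[leb]_x (k.+1%:R * (A (x + k.+1%:R^-1 *: e_ i) - A x)))
    @ \oo --> \int[leb]_x A' x.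
  apply: (Rint_dominated measurable_ddiff_quot ddiff_meas' _ iM).
    by apply: nearW => x; exact: ddiff_lim H x.
  by apply: nearW => x k; exact: ddiff_quot.
have E k : \int[leb]_x (k.+1%:R * (A (x + k.+1%:R^-1 *: e_ i) - A x)) = 0.
  have iA' := intg_addrV (k.+1%:R^-1 *: e_ i) iA.
  rewrite RintZ; last exact: intgB.
  rewrite RintB// Rint_addrV ?subrr ?mulr0//; exact: ddiff_meas H.
move: c0; under eq_fun do rewrite E.
by move=> c0; apply: (cvgn_unique c0); exact: cvg_cst.
Qed.

End facts.

Lemma ddiffM i A A' M B B' N : ddiff i A A' M -> ddiff i B B' N ->
  ddiff i (fun x => A x * B x) (fun x => A' x * B x + A x * B' x)
    (fun x => 2 * (M x * N x)).
Proof.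
move=> HA HB; have M0 := ddiff_ge0 HA; have N0 := ddiff_ge0 HB.
split.
- by apply: measurable_funM; [exact: ddiff_meas HA|exact: ddiff_meas HB].
- move=> x t t01; rewrite normrM.
  apply: (@le_trans _ _ (M x * N x)).
    by apply: ler_pM => //; [exact: (ddiff_dom HA)|exact: (ddiff_dom HB)].
  by rewrite ler_peMl ?mulr_ge0// ler1n.
- move=> x t t01.
  (* One factor is evaluated at the far end of the segment: this is what the bound [ddiff_dom] along
     segments is for. *)
  have -> : A (x + t *: e_ i) * B (x + t *: e_ i) - A x * B x =
    (A (x + t *: e_ i) - A x) * B (x + t *: e_ i) + A x * (B (x + t *: e_ i) - B x).
    by ring.
  apply: (le_trans (ler_normD _ _)); rewrite !normrM.
  have -> : t * (2 * (M x * N x)) = (t * M x) * N x + M x * (t * N x) by ring.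
  apply: lerD; apply: ler_pM => //.
  + exact: (ddiff_lip HA).
  + exact: (ddiff_dom HB).
  + exact: (ddiff_le HA).
  + exact: (ddiff_lip HB).
- move=> x.
  have cB : (fun k => B (x + k.+1%:R^-1 *: e_ i)) @ \oo --> B x.
    apply: (@cvgn_squeeze _ _ (fun k => k.+1%:R^-1 * N x)).
      by move=> k; exact: (ddiff_lip HB x (natV_itv k)).
    by rewrite -[0](mul0r (N x)); apply: cvgM; [exact: cvg_harmonic|exact: cvg_cst].
  have -> : (fun k => k.+1%:R * (A (x + k.+1%:R^-1 *: e_ i) * B (x + k.+1%:R^-1 *: e_ i) - A x * B x)) =
    (fun k => k.+1%:R * (A (x + k.+1%:R^-1 *: e_ i) - A x) * B (x + k.+1%:R^-1 *: e_ i) +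
              A x * (k.+1%:R * (B (x + k.+1%:R^-1 *: e_ i) - B x))).
    by apply/funext => k; ring.
  apply: cvgD; first (apply: cvgM; [exact: (ddiff_lim HA x)|exact: cB]).
  apply: cvgM; [exact: cvg_cst|exact: (ddiff_lim HB x)].
Qed.

Lemma ddiff_ibp i A A' M B B' N : ddiff i A A' M -> ddiff i B B' N ->
  intg leb (fun x => M x * N x) ->
  \int[leb]_x (A' x * B x) = - \int[leb]_x (A x * B' x).
Proof.
move=> HA HB iMN.
have M0 := ddiff_ge0 HA; have N0 := ddiff_ge0 HB.
have i1 : intg leb (fun x => A' x * B x).
  apply: (intg_le _ _ iMN).
    by apply: measurable_funM; [exact: ddiff_meas' HA|exact: ddiff_meas HB].
  by move=> x; rewrite normrM ler_pM//; [exact: ddiff_le' HA x|exact: ddiff_le HB x].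
have i2 : intg leb (fun x => A x * B' x).
  apply: (intg_le _ _ iMN).
    by apply: measurable_funM; [exact: ddiff_meas HA|exact: ddiff_meas' HB].
  by move=> x; rewrite normrM ler_pM//; [exact: ddiff_le HA x|exact: ddiff_le' HB x].
have := ddiff_Rint0 (ddiffM HA HB) (intgZ 2 iMN).
by rewrite RintD// => /eqP; rewrite addr_eq0 => /eqP.
Qed.

Lemma is_derive_line psi i x (t : R) : derivable psi (x + t *: e_ i) (e_ i) ->
  is_derive t (1 : R) (fun t : R => psi (x + t *: e_ i)) ('D_(e_ i) psi (x + t *: e_ i)).
Proof.
move=> D; have : is_derive (x + t *: e_ i) (e_ i) psi ('D_(e_ i) psi (x + t *: e_ i)) by split.
move=> /is_deriveP L; apply/is_deriveP; move: L.
rewrite [X in X @ _](_ : _ = (fun h : R => h^-1 *: (psi (x + (h%:A + t) *: e_ i) - psi (x + t *: e_ i))))//.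
by apply/funext => h; rewrite [h%:A]mulr1 scalerDl addrCA.
Qed.

Lemma derive_even psi i x : (forall y, psi (- y) = psi y) ->
  (forall y, derivable psi y (e_ i)) -> 'D_(e_ i) psi (- x) = - 'D_(e_ i) psi x.
Proof.
move=> psiN dpsi.
have D1 := is_derive_line (t := 0) (dpsi (x + 0 *: e_ i)).
have D2 := is_derive_line (t := 0) (dpsi (- x + 0 *: e_ i)).
have : is_derive (0 : R) (1 : R) ((fun t : R => psi (x + t *: e_ i)) \o -%R)
    ('D_(e_ i) psi (x + 0 *: e_ i) * -1).
  by apply: is_derive1_comp; rewrite oppr0.
rewrite [X in is_derive _ _ X](_ : _ = (fun t : R => psi (- x + t *: e_ i))); last first.
  by apply/funext => t /=; rewrite -psiN opprD scaleNr opprK.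
case: D2 => _; rewrite scale0r !addr0 => <- [_ ->].
by rewrite mulrN1.
Qed.

(** The majorant has to see whole segments of length 1. From a point outside the cube of radius
    [r0 + 1] the segment avoids the support; from a point inside, it stays in the compact cube of
    radius [r0 + 2], where the function and its derivatives are bounded. *)
Lemma test_function_ddiff psi : test_function psi ->
  exists r : R, exists2 c : R, 0 <= c &
    (forall x, `|psi x| <= c * \1_(cube r) x) /\
    forall i, ddiff i psi ('D_(e_ i) psi) (fun x => c * \1_(cube r) x).
Proof.
move=> [Cpsi cpsi].
have [r0 r00 supp] := compact_cube cpsi.
have psi0 x : ~ cube r0 x -> psi x = 0.
  by move=> nx; apply/eqP/negPn/negP => px; apply/nx/supp/subset_closure.
have bnd (f : Rn -> R) : continuous f -> exists2 c : R, 0 <= c & forall x, ccube (r0 + 2) x -> `|f x| <= c.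
  move=> cf; have : compact (f @` ccube (r0 + 2)).
    by apply: continuous_compact; [exact: continuous_subspaceT|exact: compact_ccube].
  move=> /compact_bounded[c [_ cP]]; exists (`|c| + 1) => // x xr.
  by apply: (cP (`|c| + 1)); [rewrite (le_lt_trans (ler_norm _))// ltrDl|exists x].
have [c0 c00 c0P] := bnd psi (Cpsi 0%N).1.
have /choice[c cP] : forall i, exists c : R, 0 <= c /\ forall x, ccube (r0 + 2) x -> `|'D_(e_ i) psi x| <= c.
  by move=> i; have [c ? ?] := bnd _ ((Cpsi 1%N).2 i).2.1; exists c.
pose cc := c0 + \sum_i c i.
exists (r0 + 1), cc.
  by rewrite addr_ge0// sumr_ge0// => i _; exact: (cP i).1.
have c0cc : c0 <= cc by rewrite lerDl sumr_ge0// => j _; exact: (cP j).1.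
split.
  move=> x; rewrite indicE; have [xr|xr] := pselect (cube (r0 + 1) x).
    rewrite mem_set// mulr1 (le_trans _ c0cc)//; apply: c0P; apply/ccubeP => j.
    by move/cubeP : xr => /(_ j) xr; rewrite ltW// (lt_trans xr)// ltrD2l ltr1n.
  rewrite memNset// mulr0 psi0 ?normr0// => /cubeP xr0; apply: xr; apply/cubeP => j.
  by rewrite (lt_trans (xr0 j))// ltrDl.
move=> i.
have ccc : c i <= cc.
  by rewrite /cc (bigD1 i)//= addrA addrAC lerDr addr_ge0// sumr_ge0// => j _; exact: (cP j).1.
have out x (t : R) : 0 <= t <= 1 -> ~ cube (r0 + 1) x -> psi (x + t *: e_ i) = 0.
  move=> /andP[t0 t1] nx; apply: psi0 => /cubeP H; apply: nx; apply/cubeP => j.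
  have := H j; rewrite [x + _]addrC basis_shift; case: eqP => _ Hj.
    by move: Hj; rewrite !ltr_norml => /andP[? ?]; apply/andP; split; lra.
  by rewrite (lt_trans Hj)// ltrDl.
have inn x (t : R) : 0 <= t <= 1 -> cube (r0 + 1) x -> ccube (r0 + 2) (x + t *: e_ i).
  move=> /andP[t0 t1] /cubeP H; apply/ccubeP => j.
  have := H j; rewrite [x + _]addrC basis_shift; case: eqP => _.
    by rewrite ltr_norml ler_norml => /andP[? ?]; apply/andP; split; lra.
  by rewrite ltr_norml ler_norml => /andP[? ?]; apply/andP; split; lra.
have D x t := is_derive_line (((Cpsi 1%N).2 i).1 (x + t *: e_ i)).
split.
- exact: (continuous_measurable_rV (Cpsi 0%N).1).
- move=> x t t01; rewrite indicE; have [xr|xr] := pselect (cube (r0 + 1) x).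
    by rewrite mem_set// mulr1 (le_trans _ c0cc)//; apply: c0P; exact: inn.
  by rewrite memNset// mulr0 (out _ _ t01 xr) normr0.
- move=> x t t01; rewrite indicE; have [xr|xr] := pselect (cube (r0 + 1) x); last first.
    rewrite memNset// !mulr0 (out _ _ t01 xr).
    have := out x 0; rewrite lexx ler01 scale0r addr0 => ->//.
    by rewrite subr0 normr0.
  rewrite mem_set// mulr1; have /andP[t0 t1] := t01.
  have := @MVT_segment R (fun t : R => psi (x + t *: e_ i)) (fun t => 'D_(e_ i) psi (x + t *: e_ i)) 0 t t0.
  case.
  + apply: continuous_subspaceT => z; exact: (is_derive_continuous (D x)).
  + move=> z zt; rewrite scale0r addr0 subr0 => ->.
    move: zt; rewrite in_itv/= => /andP[z0 zt].
    rewrite normrM mulrC ger0_norm// ler_wpM2l// (le_trans _ ccc)//.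
    by apply: (cP i).2; apply: inn => //; rewrite z0 (le_trans zt).
- move=> x; have := D x 0 => /is_deriveP; rewrite scale0r addr0 => L.
  have cV : (fun k => k.+1%:R^-1 : R) @ \oo --> 0^'.
    move=> Q Q0; have : \forall k \near \oo, (k.+1%:R^-1 : R) != 0 -> Q (k.+1%:R^-1).
      exact: (@cvg_harmonic R _ Q0).
    by apply: filterS => k; apply; rewrite invr_eq0 pnatr_eq0.
  rewrite [X in X @ _ --> _](_ : _ = (fun h : R => h^-1 *: (psi (x + (h%:A + 0) *: e_ i) - psi x)) \o
    (fun k => k.+1%:R^-1)); first exact: cvg_comp cV L.
  by apply/funext => k /=; rewrite invrK [_%:A]mulr1 addr0.
Qed.

End difference_quotients.

(** * Mollification in L2 *)

Section convolution.
Context (R : realType) (n : nat).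
Local Notation Rn := 'rV[R]_n.
Local Notation leb := (lebesgue_rV R n).
Local Notation e_ := (@basis_vector R n).
Local Notation L2 := (L2 leb).
Local Notation N2 := (N2 leb).
Local Notation intg := (intg leb).
Implicit Types (f g k : Rn -> R) (x y z : Rn) (i : 'I_n).

Definition bkernel k := measurable_fun setT k /\
  exists r : R, exists2 c : R, 0 <= c & forall x, `|k x| <= c * \1_(cube r) x.

Lemma intg_cindic (c r : R) : intg (fun x => c * \1_(cube r) x).
Proof. by apply: intgZ; exact: intg_indic_cube. Qed.

Lemma bkernel_cindic (c r : R) : 0 <= c -> bkernel (fun x => c * \1_(cube r) x).
Proof.
move=> c0; split; first exact: (intg_measurable (intg_cindic c r)).
by exists r, c => // x; rewrite ger0_norm// mulr_ge0.
Qed.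

Lemma bkernel_norm k : bkernel k -> bkernel (fun x => `|k x|).
Proof.
move=> [mk [r [c c0 kc]]]; split; first exact: measurableT_comp.
by exists r, c => // x; rewrite normr_id.
Qed.

Lemma bkernel_intg k : bkernel k -> intg k.
Proof. by move=> [mk [r [c c0 kc]]]; apply: (intg_le mk kc); exact: intg_cindic. Qed.

Lemma bkernel_bounded k : bkernel k -> exists2 c : R, 0 <= c & forall x, `|k x| <= c.
Proof.
move=> [mk [r [c c0 kc]]]; exists c => // x; apply: (le_trans (kc x)).
by rewrite ler_piMr// indicE lern1 leq_b1.
Qed.

Lemma bkernel_L2 k : bkernel k -> L2 k.
Proof.
move=> bk; have [c c0 kc] := bkernel_bounded bk; have [mk _] := bk.
split=> //; apply: (@intg_le _ _ _ _ _ (fun x => c * `|k x|)).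
- exact: measurable_funX.
- by move=> x; rewrite normrX expr2 ler_wpM2r.
- by apply: intgZ; apply: intg_norm; exact: bkernel_intg.
Qed.

Lemma bkernel_subr k x : bkernel k -> measurable_fun setT (fun y => k (x - y)).
Proof. by move=> [mk _]; apply: measurableT_comp => //; exact: measurable_subrV. Qed.

Lemma L2_subr k x : bkernel k -> L2 (fun y => k (x - y)).
Proof.
move=> bk; split; first exact: bkernel_subr.
by apply: (intg_subrV x (f := fun z => k z ^+ 2)); case: (bkernel_L2 bk).
Qed.

Lemma N2_subr k x : bkernel k -> N2 (fun y => k (x - y)) = N2 k.
Proof.
move=> bk; apply: (Rint_subrV x (f := fun z => k z ^+ 2)).
by apply: measurable_funX; case: bk.
Qed.

Definition convol k f x := \int[leb]_y (k (x - y) * f y).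

Lemma conv_intg k f x : bkernel k -> L2 f -> intg (fun y => k (x - y) * f y).
Proof. by move=> bk Lf; apply: L2M => //; exact: L2_subr. Qed.

Lemma measurable_conv k f : bkernel k -> measurable_fun setT f ->
  measurable_fun setT (convol k f).
Proof.
move=> [mk _] mf.
have mF : measurable_fun setT (fun z : Rn * Rn => k (z.1 - z.2) * f z.2).
  apply: measurable_funM; first exact: measurable_sub2.
  exact: (measurableT_comp mf measurable_snd).
exact (measurable_Rint_param leb mF).
Qed.

Lemma conv_bound k f x : bkernel k -> L2 f ->
  `|convol k f x| <= Num.sqrt (N2 k) * Num.sqrt (N2 f).
Proof.
move=> bk Lf; apply: (le_trans (cauchy_schwarz_abs (L2_subr x bk) Lf)).
by rewrite N2_subr.
Qed.

Lemma convD k f g x : bkernel k -> L2 f -> L2 g ->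
  convol k (fun y => f y + g y) x = convol k f x + convol k g x.
Proof.
move=> bk Lf Lg; rewrite -RintD; [|exact: conv_intg|exact: conv_intg].
by apply: eq_Rintegral => y _; rewrite mulrDr.
Qed.

Lemma convB k f g x : bkernel k -> L2 f -> L2 g ->
  convol k (fun y => f y - g y) x = convol k f x - convol k g x.
Proof.
move=> bk Lf Lg; rewrite -RintB; [|exact: conv_intg|exact: conv_intg].
by apply: eq_Rintegral => y _; rewrite mulrBr.
Qed.

Lemma convZ k f (c : R) x : bkernel k -> L2 f ->
  convol k (fun y => c * f y) x = c * convol k f x.
Proof.
move=> bk Lf; rewrite -RintZ; last exact: conv_intg.
by apply: eq_Rintegral => y _; rewrite mulrCA.
Qed.

Lemma conv_sum k (I : Type) (s : seq I) (F : I -> Rn -> R) x : bkernel k ->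
  (forall j, L2 (F j)) ->
  convol k (fun y => \sum_(i <- s) F i y) x = \sum_(i <- s) convol k (F i) x.
Proof.
move=> bk LF; rewrite /convol -Rint_sum; last by move=> i; exact: conv_intg.
by apply: eq_Rintegral => y _; rewrite mulr_sumr.
Qed.

(** Cauchy-Schwarz after writing [|k f|] as [sqrt |k|] times [sqrt |k| |f|]. Integrated in [x], it
    bounds convolution on L^2 by the L^1 norm of the kernel, which is 1 for a mollifier. *)
Lemma conv_sqr_le k f x : bkernel k -> L2 f ->
  convol k f x ^+ 2 <= (\int[leb]_y `|k y|) * \int[leb]_y (`|k (x - y)| * f y ^+ 2).
Proof.
move=> bk Lf; have bk' := bkernel_norm bk; have [c c0 kc] := bkernel_bounded bk.
have mk : measurable_fun setT (fun y => Num.sqrt `|k (x - y)|).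
  apply: (measurableT_comp _ (bkernel_subr x bk')).
  by apply: continuous_measurable_fun; exact: sqrt_continuous.
have iK : intg (fun y => `|k (x - y)|).
  by apply: (intg_subrV x (f := fun z => `|k z|)); exact: bkernel_intg.
have i2 : intg (fun y => `|k (x - y)| * f y ^+ 2).
  apply: (@intg_le _ _ _ _ _ (fun y => c * f y ^+ 2)).
  - by apply: measurable_funM; [exact: (bkernel_subr x bk')|apply: measurable_funX; case: Lf].
  - by move=> y; rewrite normrM normr_id [`|_ ^+ 2|]ger0_norm ?sqr_ge0// ler_wpM2r ?sqr_ge0.
  - by apply: intgZ; case: Lf.
have L1 : L2 (fun y => Num.sqrt `|k (x - y)|).
  by split=> //; under eq_fun do rewrite sqr_sqrtr//.
have L2' : L2 (fun y => Num.sqrt `|k (x - y)| * `|f y|).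
  split; first by apply: measurable_funM => //; apply: measurableT_comp => //; case: Lf.
  by under eq_fun do rewrite exprMn sqr_sqrtr// real_normK ?num_real//.
have : `|convol k f x| <= \int[leb]_y (Num.sqrt `|k (x - y)| * (Num.sqrt `|k (x - y)| * `|f y|)).
  apply: Rint_abs_le; last 2 first.
  - exact: L2M.
  - by move=> y; rewrite mulrA -expr2 sqr_sqrtr// normrM.
  - by apply: intg_measurable; exact: conv_intg.
move=> H; rewrite -real_normK ?num_real//.
apply: (@le_trans _ _ ((\int[leb]_y (Num.sqrt `|k (x - y)| * (Num.sqrt `|k (x - y)| * `|f y|))) ^+ 2)).
  by rewrite lerXn2r ?nnegrE// (le_trans _ H).
apply: (le_trans (cauchy_schwarz L1 L2')).
rewrite /N2; under eq_Rintegral do rewrite sqr_sqrtr//.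
under [X in _ * X <= _]eq_Rintegral do rewrite exprMn sqr_sqrtr// real_normK ?num_real//.
rewrite (Rint_subrV x (f := fun z => `|k z|))//; by case: bk'.
Qed.

Section conv_sqr.
Context k f (bk : bkernel k) (if2 : intg f) (f0 : forall y, 0 <= f y).

(** The integration point of the convolution comes first: integrating in the other variable leaves
    an explicit multiple of [f], which is the integrability that Fubini's theorem asks for. *)
Let F (z : Rn * Rn) := `|k (z.2 - z.1)| * f z.1.

Let bk' := bkernel_norm bk.

Let mF : measurable_fun setT F.
Proof.
apply: measurable_funM.
  have [mk _] := bk'; apply: (measurableT_comp mk).
  apply: measurable_fun_matrix => // a b; under eq_fun do rewrite !mxE.
  by apply: measurable_funB; exact: (measurableT_comp (measurable_entry a b)).
exact: (measurableT_comp (intg_measurable if2) measurable_fst).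
Qed.

Let F0 (z : Rn * Rn) : 0 <= F z. Proof. by rewrite mulr_ge0. Qed.

Let Fx y : intg (fun x => F (y, x)).
Proof.
rewrite /F /=; under eq_fun do rewrite mulrC; apply: intgZ.
by apply: (intg_addrV (- y) (f := fun z => `|k z|)); exact: bkernel_intg.
Qed.

Let Fy x : intg (fun y => F (y, x)).
Proof.
have [c c0 kc] := bkernel_bounded bk.
apply: (@intg_le _ _ _ _ _ (fun y => c * f y)).
- exact: (measurableT_comp mF (pair2_measurable x)).
- by move=> y; rewrite ger0_norm ?F0// ler_wpM2r.
- exact: intgZ.
Qed.

Let Fin y : \int[leb]_x `|F (y, x)| = (\int[leb]_x `|k x|) * f y.
Proof.
under eq_Rintegral do rewrite ger0_norm// /F mulrC.
rewrite /= RintZ; last by apply: (intg_addrV (- y) (f := fun z => `|k z|)); exact: bkernel_intg.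
rewrite mulrC (Rint_addrV (- y) (f := fun z => `|k z|))//; by case: bk'.
Qed.

Let iFin : intg (fun y => \int[leb]_x `|F (y, x)|).
Proof. by under eq_fun do rewrite Fin; apply: intgZ. Qed.

Lemma intg_conv_ge0 : intg (fun x => \int[leb]_y (`|k (x - y)| * f y)).
Proof.
have := intg_swap mF Fx Fy iFin.
by under eq_fun do under eq_Rintegral do rewrite ger0_norm//.
Qed.

Lemma Rint_conv_ge0 : \int[leb]_x (\int[leb]_y (`|k (x - y)| * f y)) =
  (\int[leb]_x `|k x|) * \int[leb]_y f y.
Proof.
have := Rint_swap mF Fx Fy iFin => /esym ->.
rewrite -RintZ//; apply: eq_Rintegral => y _; rewrite -Fin.
by apply: eq_Rintegral => x _; rewrite ger0_norm.
Qed.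

End conv_sqr.

Lemma L2_conv k f : bkernel k -> L2 f -> L2 (convol k f).
Proof.
move=> bk Lf; have [mf if2] := Lf.
split; first exact: measurable_conv.
apply: (@intg_le _ _ _ _ _ (fun x => (\int[leb]_y `|k y|) * \int[leb]_y (`|k (x - y)| * f y ^+ 2))).
- by apply: measurable_funX; exact: measurable_conv.
- by move=> x; rewrite ger0_norm ?sqr_ge0//; exact: conv_sqr_le.
- by apply: intgZ; apply: intg_conv_ge0 => // y; exact: sqr_ge0.
Qed.

Lemma N2_conv k f : bkernel k -> L2 f ->
  N2 (convol k f) <= (\int[leb]_y `|k y|) ^+ 2 * N2 f.
Proof.
move=> bk Lf; have [mf if2] := Lf.
have f0 y : 0 <= f y ^+ 2 by exact: sqr_ge0.
rewrite expr2 -mulrA -(Rint_conv_ge0 bk if2 f0) -RintZ; last exact: intg_conv_ge0.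
apply: Rint_le; first by case: (L2_conv bk Lf).
- by apply: intgZ; exact: intg_conv_ge0.
- by move=> x; exact: conv_sqr_le.
Qed.

Lemma conv_adjoint k f g : bkernel k -> (forall x, k (- x) = k x) -> L2 f -> L2 g ->
  \int[leb]_x (convol k f x * g x) = \int[leb]_x (f x * convol k g x).
Proof.
move=> bk kN Lf Lg; have bk' := bkernel_norm bk.
pose F (z : Rn * Rn) := k (z.1 - z.2) * f z.2 * g z.1.
have mF : measurable_fun setT F.
  apply: measurable_funM; first apply: measurable_funM.
  - by apply: measurable_sub2; case: bk.
  - by apply: (measurableT_comp _ measurable_snd); case: Lf.
  - by apply: (measurableT_comp _ measurable_fst); case: Lg.
have F2 x : intg (fun y => F (x, y)).
  by rewrite /F /=; under eq_fun do rewrite mulrC; apply: intgZ; exact: conv_intg.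
have F1 y : intg (fun x => F (x, y)).
  rewrite /F /=; under eq_fun do rewrite mulrAC mulrC -opprB kN.
  by apply: intgZ; exact: conv_intg.
have FF : intg (fun x => \int[leb]_y `|F (x, y)|).
  rewrite (_ : (fun x => _) = (fun x => convol (fun x => `|k x|) (fun x => `|f x|) x * `|g x|)).
    by apply: L2M; [apply: L2_conv => //; exact: L2_norm|exact: L2_norm].
  apply/funext => x; rewrite /convol mulrC -RintZ; last exact: (conv_intg x bk' (L2_norm Lf)).
  by apply: eq_Rintegral => y _; rewrite /F/= !normrM mulrC.
transitivity (\int[leb]_x \int[leb]_y F (x, y)).
  apply: eq_Rintegral => x _; rewrite mulrC /convol -RintZ; last exact: conv_intg.
  by apply: eq_Rintegral => y _; rewrite /F/= mulrC.
rewrite (Rint_swap mF F2 F1 FF); apply: eq_Rintegral => y _.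
rewrite /convol -RintZ; last exact: conv_intg.
by apply: eq_Rintegral => x _; rewrite /F/= -kN opprB; ring.
Qed.

(** Every bound on the kernel becomes one on the convolution once integrated against [|f|], hence
    the majorant [convol m |f|]. *)
Lemma ddiff_conv i k k' m f : bkernel m -> ddiff i k k' m -> L2 f ->
  ddiff i (convol k f) (convol k' f) (convol m (fun x => `|f x|)).
Proof.
move=> bm H Lf; have Lf' := L2_norm Lf; have m0 := ddiff_ge0 H.
have bk : bkernel k.
  split; first exact: ddiff_meas H.
  have [_ [r [c c0 mc]]] := bm; exists r, c => // x.
  by rewrite (le_trans (ddiff_le H x))// (le_trans _ (mc x))// ler_norm.
have [mf _] := Lf.
have mkf x : measurable_fun setT (fun y => k (x - y) * f y).
  by apply: intg_measurable; exact: conv_intg.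
split.
- exact: measurable_conv.
- move=> x t t01; apply: Rint_abs_le => //; first exact: conv_intg.
  move=> y; rewrite normrM ler_wpM2r// addrAC.
  exact: (ddiff_dom H).
- move=> x t t01; have t0 : 0 <= t by case/andP: t01.
  rewrite /convol -RintB; [|exact: conv_intg|exact: conv_intg].
  rewrite -RintZ; last exact: conv_intg.
  apply: Rint_abs_le.
  + exact: measurable_funB.
  + by apply: intgZ; exact: conv_intg.
  + move=> y; rewrite -mulrBl normrM mulrA ler_wpM2r// addrAC.
    exact: (ddiff_lip H).
- move=> x.
  rewrite (_ : (fun l => _) = (fun l =>
    \int[leb]_y (l.+1%:R * (k (x + l.+1%:R^-1 *: e_ i - y) - k (x - y)) * f y))).
    apply: (@Rint_dominated _ _ _ _ _ _ (fun y => m (x - y) * `|f y|)).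
    + move=> l; apply: measurable_funM => //; apply: measurable_funM => //.
      by apply: measurable_funB; apply: bkernel_subr.
    + apply: measurable_funM => //; apply: measurableT_comp; last exact: measurable_subrV.
      exact: ddiff_meas' H.
    + apply: nearW => y; apply: cvgM; last exact: cvg_cst.
      have E : (fun l : nat => l.+1%:R * (k (x + l.+1%:R^-1 *: e_ i - y) - k (x - y))) =
          (fun l : nat => l.+1%:R * (k (x - y + l.+1%:R^-1 *: e_ i) - k (x - y))).
        by apply/funext => l; rewrite (addrAC x).
      rewrite E; have L := @ddiff_lim _ _ _ _ _ _ H (x - y); exact L.
    + exact: conv_intg.
    + apply: nearW => y l; rewrite normrM ler_wpM2r// addrAC.
      exact: (ddiff_quot H).
  apply/funext => l; rewrite /convol -RintB; [|exact: conv_intg|exact: conv_intg].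
  rewrite -RintZ; last by apply: intgB; exact: conv_intg.
  by apply: eq_Rintegral => y _; ring.
Qed.

End convolution.

Section mollifiers.
Context (R : realType) (n : nat).
Local Notation Rn := 'rV[R]_n.
Local Notation leb := (lebesgue_rV R n).
Local Notation e_ := (@basis_vector R n).
Local Notation L2 := (L2 leb).
Local Notation N2 := (N2 leb).
Local Notation intg := (intg leb).
Implicit Types (f g k psi : Rn -> R) (x y z : Rn) (i : 'I_n).

(** [moll_test] speaks of the reflected translates because they are the functions against which
    distributional identities are tested; evenness makes the convolution self-adjoint. *)
Record mollifier k (r : R) : Prop := Mollifier {
  moll_test : forall x, test_function (fun y => k (x - y)) ;
  moll_even : forall x, k (- x) = k x ;
  moll_ge0 : forall x, 0 <= k x ;
  moll_int1 : \int[leb]_x k x = 1 ;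
  moll_supp : forall x, k x != 0 -> cube r x }.

Definition tbump (m : nat) x := tensor (fun i : 'I_n => bump m) x.

Lemma tbump_ge0 m x : 0 <= tbump m x.
Proof. by apply: prodr_ge0 => i _; exact: bump_ge0. Qed.

Lemma test_tbump m (c : R) x : test_function (fun y => c * tbump m (x - y)).
Proof.
rewrite (_ : (fun y => _) =
    fun y => c * tensor (fun i (z : R) => bump m (z - x 0 i)) y); last first.
  apply/funext => y; congr (_ * _); apply: eq_bigr => i _.
  by rewrite -bumpN !mxE opprB.
apply: (@test_function_tensor _ _ _ (1 + \sum_i `|x 0 i|)).
  by move=> k i; exact: smoothn_bump.
move=> i z xz; apply: bump_eq0; apply: (@le_trans _ _ 1).
  by rewrite invf_le1 ?ltr0n// ler1n.
have : `|x 0 i| <= \sum_i `|x 0 i| by rewrite (bigD1 i)//= lerDl sumr_ge0.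
have := lerB_dist z (x 0 i); lra.
Qed.


Lemma bkernel_test psi : test_function psi -> bkernel psi.
Proof.
move=> tpsi; split; first exact: continuous_measurable_rV (tpsi.1 0%N).1.
by have [r [c c0 [psic _]]] := test_function_ddiff tpsi; exists r, c.
Qed.

Lemma tbump_supp m x : tbump m x != 0 -> cube m.+1%:R^-1 x.
Proof.
move=> bx; apply/cubeP => i; rewrite ltNge; apply/negP => xm.
by move/eqP : bx; apply; apply: (@tensor0 _ _ _ i); exact: bump_eq0.
Qed.

Lemma tbumpN m x : tbump m (- x) = tbump m x.
Proof. by apply: eq_bigr => i _; rewrite mxE bumpN. Qed.

Lemma test_tbump1 m : test_function (tbump m).
Proof.
have := test_tbump m 1 0; congr test_function; apply/funext => x.
by rewrite mul1r sub0r tbumpN.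
Qed.

(** A zero integral would make [tbump] vanish almost everywhere, whereas it is positive on a cube of
    positive volume. *)
Lemma Rint_tbump_gt0 m : 0 < \int[leb]_x tbump m x.
Proof.
have iT : intg (tbump m) by apply: bkernel_intg; apply: bkernel_test; exact: test_tbump1.
rewrite lt_neqAle Rintegral_ge0 ?andbT; last by move=> x _; exact: tbump_ge0.
apply/eqP => /esym I0.
have [N [mN N0 tN]] := Rint0_ae iT (tbump_ge0 m) I0.
have : (leb (cube m.+1%:R^-1) <= leb N)%E.
  apply: le_measure; rewrite ?inE//; first exact: measurable_obox.
  move=> x /cubeP xm; apply: tN => /= x0.
  suff : 0 < tbump m x by rewrite x0 ltxx.
  by apply: prodr_gt0 => i _; exact: bump_gt0.
rewrite N0 lebesgue_obox; last by move=> i; rewrite ge0_cp// invr_ge0.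
by rewrite lee_fin leNgt prodr_gt0// => i _; rewrite opprK addr_gt0// invr_gt0.
Qed.

Definition moll m x := (\int[leb]_x tbump m x)^-1 * tbump m x.

Lemma mollifier_moll m : mollifier (moll m) m.+1%:R^-1.
Proof.
have I0 := Rint_tbump_gt0 m.
split.
- by move=> x; exact: test_tbump.
- by move=> x; rewrite /moll tbumpN.
- by move=> x; rewrite mulr_ge0 ?tbump_ge0// invr_ge0 ltW.
- rewrite RintZ; first by rewrite mulVf// gt_eqF.
  by apply: bkernel_intg; apply: bkernel_test; exact: test_tbump1.
- move=> x; rewrite /moll mulf_eq0 negb_or => /andP[_]; exact: tbump_supp.
Qed.

Section mollifier_facts.
Context k r (H : mollifier k r).

Lemma moll_test0 : test_function k.
Proof.
have := moll_test H 0; congr test_function; apply/funext => x.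
by rewrite sub0r (moll_even H).
Qed.

Lemma moll_bkernel : bkernel k.
Proof. exact: bkernel_test moll_test0. Qed.

Lemma moll_norm1 : \int[leb]_x `|k x| = 1.
Proof.
rewrite -(moll_int1 H); apply: eq_Rintegral => x _.
by rewrite ger0_norm// (moll_ge0 H).
Qed.

Lemma N2_moll f : L2 f -> N2 (convol k f) <= N2 f.
Proof.
by move=> Lf; have := N2_conv moll_bkernel Lf; rewrite moll_norm1 expr1n mul1r.
Qed.

Lemma moll_adjoint f g : L2 f -> L2 g ->
  \int[leb]_x (convol k f x * g x) = \int[leb]_x (f x * convol k g x).
Proof. by apply: conv_adjoint; [exact: moll_bkernel|exact: moll_even H]. Qed.

Definition dkernel i : Rn -> R := 'D_(e_ i) k.

Lemma moll_ddiff : exists s : R, exists2 c : R, 0 <= c &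
  forall i, ddiff i k (dkernel i) (fun x => c * \1_(cube s) x).
Proof. by have [s [c c0 [_ ?]]] := test_function_ddiff moll_test0; exists s, c. Qed.

Lemma bkernel_dkernel i : bkernel (dkernel i).
Proof.
have [s [c c0 D]] := moll_ddiff; split; first exact: ddiff_meas' (D i).
by exists s, c => // x; exact: ddiff_le' (D i) x.
Qed.

Lemma dkernelN i x : dkernel i (- x) = - dkernel i x.
Proof.
apply: derive_even; first exact: moll_even H.
by have [C _] := moll_test0; exact: ((C 1%N).2 i).1.
Qed.

(** The majorant is both in L^2 and bounded: it can serve in products of three fields of which two
    are only in L^2. *)
Lemma conv_ddiff_moll f : L2 f -> exists2 M, L2 M /\ (exists c : R, forall x, `|M x| <= c) &
  forall i, ddiff i (convol k f) (convol (dkernel i) f) M.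
Proof.
move=> Lf; have [s [c c0 D]] := moll_ddiff.
exists (convol (fun x => c * \1_(cube s) x) (fun x => `|f x|)).
  have bm := bkernel_cindic n s c0; have Lf' := L2_norm Lf.
  by split; [exact: L2_conv|eexists => x; exact: conv_bound].
by move=> i; apply: ddiff_conv => //; exact: bkernel_cindic.
Qed.

Lemma ddiff_moll_translate i x : exists s : R, exists2 c : R, 0 <= c &
  ddiff i (fun y => k (x - y)) (fun y => - dkernel i (x - y)) (fun y => c * \1_(cube s) (y - x)).
Proof.
have [s [c c0 D]] := moll_ddiff; exists s, c => //.
have E y : k (x - y) = k (y - x) by rewrite -(moll_even H) opprB.
rewrite (_ : (fun y => k (x - y)) = (fun y => k (y - x))); last by apply/funext.
rewrite (_ : (fun y => - _) = (fun y => dkernel i (y - x))); last first.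
  by apply/funext => y; rewrite -dkernelN opprB.
split.
- by apply: measurableT_comp; [exact: ddiff_meas (D i)|exact: measurable_addrV].
- by move=> y t t01; rewrite addrAC; exact: (ddiff_dom (D i)).
- by move=> y t t01; rewrite addrAC; exact: (ddiff_lip (D i)).
- move=> y.
  rewrite (_ : (fun l : nat => _) = (fun l : nat =>
    l.+1%:R * (k (y - x + l.+1%:R^-1 *: e_ i) - k (y - x)))).
    by have L := @ddiff_lim _ _ _ _ _ _ (D i) (y - x); exact L.
  by apply/funext => l; rewrite (addrAC y).
Qed.

(** Integration by parts against the translated kernel. It lets a derivative pass through a second
    mollification. *)
Lemma conv_dkernel i f f' M x : ddiff i f f' M -> L2 M ->
  convol (dkernel i) f x = convol k f' x.
Proof.
move=> D LM; have [s [c c0 D']] := ddiff_moll_translate i x.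
have := ddiff_ibp D D'.
rewrite (_ : \int[leb]_x0 _ = convol k f' x); last by apply: eq_Rintegral => y _; rewrite mulrC.
move=> ->; last first.
  apply: L2M => //.
  exact: (L2_addrV (- x) (bkernel_L2 (bkernel_cindic n s c0))).
by rewrite -RintN; apply: eq_Rintegral => y _; rewrite mulrN opprK mulrC.
Qed.

End mollifier_facts.

End mollifiers.

(** * Convergence of mollifications in L^2 *)

Section approximate_identity.
Context (R : realType) (n : nat).
Local Notation Rn := 'rV[R]_n.
Local Notation leb := (lebesgue_rV R n).
Local Notation L2 := (L2 leb).
Local Notation N2 := (N2 leb).
Local Notation intg := (intg leb).
Local Notation moll := (@moll R n).
Implicit Types (f g : Rn -> R) (x y : Rn).

(** The class is stable under linear combinations, L^2 limits and dominated limits, so that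
    convergence spreads from boxes to measurable sets, simple functions and all of L^2. *)
Definition approximable f := L2 f /\ (fun m => N2 (fun x => convol (moll m) f x - f x)) @ \oo --> (0 : R).

Let bm m := moll_bkernel (mollifier_moll R n m).

Let LK m f : L2 f -> L2 (fun x => convol (moll m) f x - f x).
Proof. by move=> Lf; apply: L2B => //; exact: L2_conv. Qed.

Lemma approximableD f g : approximable f -> approximable g ->
  approximable (fun x => f x + g x).
Proof.
move=> [Lf cf] [Lg cg]; split; first exact: L2D.
apply: (@cvgn_squeeze _ _ (fun m => 2 * N2 (fun x => convol (moll m) f x - f x) +
   2 * N2 (fun x => convol (moll m) g x - g x))).
  move=> m; rewrite subr0 ger0_norm ?N2_ge0//.
  rewrite (_ : (fun x => _) = (fun x => (convol (moll m) f x - f x) + (convol (moll m) g x - g x))).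
    by apply: N2D_le; exact: LK.
  by apply/funext => x; rewrite convD//; ring.
rewrite -[0](_ : 2 * 0 + 2 * 0 = 0 :> R); last by rewrite !mulr0 addr0.
by apply: cvgD; apply: cvgM => //; exact: cvg_cst.
Qed.

Lemma approximableZ (c : R) f : approximable f -> approximable (fun x => c * f x).
Proof.
move=> [Lf cf]; split; first exact: L2Z.
rewrite (_ : (fun m => _) = (fun m => c ^+ 2 * N2 (fun x => convol (moll m) f x - f x))).
  by rewrite -[0](mulr0 (c ^+ 2)); apply: cvgM => //; exact: cvg_cst.
apply/funext => m; rewrite -N2Z//; last exact: LK.
by congr N2; apply/funext => x; rewrite convZ//; ring.
Qed.

Lemma approximable0 : approximable (fun=> 0).
Proof.
split; first exact: L20.
rewrite (_ : (fun m => _) = fun=> 0); first exact: cvg_cst.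
apply/funext => m; rewrite /N2 -[RHS](Rint0 leb); apply: eq_Rintegral => x _.
rewrite /convol subr0; under eq_Rintegral do rewrite mulr0.
by rewrite Rint0 expr0n.
Qed.

Lemma approximableB f g : approximable f -> approximable g ->
  approximable (fun x => f x - g x).
Proof.
move=> Pf Pg; have := approximableD Pf (approximableZ (-1) Pg).
by under eq_fun do rewrite mulN1r.
Qed.

Lemma approximable_sum (I : Type) (s : seq I) (F : I -> Rn -> R) :
  (forall j, approximable (F j)) -> approximable (fun x => \sum_(j <- s) F j x).
Proof.
move=> PF; elim: s => [|j s IHs].
  by under eq_fun do rewrite big_nil; exact: approximable0.
by under eq_fun do rewrite big_cons; exact: approximableD.
Qed.

(* The operators [convol (moll m)] are contractions of L^2. *)
Lemma approximable_closed f : L2 f ->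
  (forall e : R, 0 < e -> exists2 g, approximable g & N2 (fun x => f x - g x) <= e) ->
  approximable f.
Proof.
move=> Lf Pf; split => //; apply: cvgn_dist => e e0.
(* The error on [f - g] costs at most [8 e / 16] and the one on [g] at most [2 e / 16]. *)
have e16 : 0 < e / 16 by rewrite divr_gt0.
have [g [Lg cg] fg] := Pf _ e16.
have [m0 m0P] := cvgn_near e16 cg.
exists m0 => m /m0P; rewrite !subr0 !ger0_norm ?N2_ge0// => gm.
have Lh := L2B Lf Lg; set h := fun x => f x - g x in fg Lh.
have E : (fun x => convol (moll m) f x - f x) =
    (fun x => (convol (moll m) h x - h x) + (convol (moll m) g x - g x)).
  by apply/funext => x; rewrite /h convB//; ring.
rewrite E (le_trans (N2D_le (LK m Lh) (LK m Lg)))//.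
have := N2D_le (L2_conv (bm m) Lh) (L2N Lh).
have := N2_moll (mollifier_moll R n m) Lh.
have -> : N2 (fun x => - h x) = N2 h by apply: eq_Rintegral => x _; rewrite sqrrN.
by move: fg gm; rewrite -/h; lra.
Qed.

Lemma L2_indic (A : set Rn) : measurable A -> (leb A < +oo)%E -> L2 \1_A.
Proof.
move=> mA Afin; split; first exact: measurable_indic.
rewrite (_ : (fun x => _) = \1_A).
  by apply: ge0_intg => //; rewrite integral_indic ?setIT.
by apply/funext => x; rewrite indicE; case: (_ \in _); rewrite ?expr1n ?expr0n.
Qed.

(** Pointwise convergence under an L^2 majorant is convergence in L^2, since the squared differences
    are at most [4 g^2]. *)
Lemma approximable_dominated (F : nat -> Rn -> R) f g : measurable_fun setT f ->
  (forall l, approximable (F l)) -> L2 g -> (forall l x, `|F l x| <= g x) ->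
  (forall x, F ^~ x @ \oo --> f x) -> approximable f.
Proof.
move=> mf PF Lg Fg Ff.
have fg x : `|f x| <= g x by apply: (cvgn_le (cvg_norm (Ff x))) => l; exact: Fg.
have Lf : L2 f.
  by apply: (L2_le mf Lg) => x; rewrite (le_trans (fg x))// ler_norm.
apply: approximable_closed => // e e0.
have c0 : (fun l => N2 (fun x => f x - F l x)) @ \oo --> \int[leb]_x (0 : R).
  apply: (@Rint_dominated _ _ _ _ _ _ (fun x => 4 * g x ^+ 2)).
  - by move=> l; apply: measurable_funX; apply: measurable_funB => //; case: (PF l) => -[].
  - exact: measurable_cst.
  - apply: nearW => x; rewrite -[X in _ --> X](_ : (f x - f x) ^+ 2 = 0); last by rewrite subrr expr0n.
    by apply: cvgM; apply: cvgB => //; exact: cvg_cst.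
  - by apply: intgZ; case: Lg.
  - apply: nearW => x l; rewrite ger0_norm ?sqr_ge0//.
    have := Fg l x; have := fg x; rewrite !ler_norml => /andP[? ?] /andP[? ?]; nra.
have [l0 l0P] := cvgn_near e0 c0.
exists (F l0) => //; have := l0P l0 (leqnn _).
by rewrite Rint0 subr0 ger0_norm ?N2_ge0.
Qed.

Definition hyperplane (c : R) (i : 'I_n) : set Rn := [set x | x 0 i = c].

Lemma hyperplane_null (c : R) (i : 'I_n) : leb (hyperplane c i) = 0%E.
Proof.
have -> : hyperplane c i = [set v : Rn | forall j, (if j == i then [set c] else setT) (v 0 j)].
  apply/seteqP; split => v /=.
    by move=> vi j; case: eqP => // ->.
  by move=> /(_ i); rewrite eqxx.
rewrite [LHS](lebesgue_rV_box (B := fun j => if j == i then [set c] else setT)); last first.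
  by move=> j; case: ifP.
by rewrite (bigD1 i)//= eqxx lebesgue_measure_set1 mul0e.
Qed.

Lemma measurable_hyperplane (c : R) (i : 'I_n) : measurable (hyperplane c i).
Proof.
have mc : measurable [set c] by [].
by have := @measurable_entry R 1 n 0 i measurableT _ mc; rewrite setTI.
Qed.

Lemma conv_moll_const m f x (c : R) : (forall y, cube m.+1%:R^-1 (x - y) -> f y = c) ->
  convol (moll m) f x = c.
Proof.
move=> fc; have H := mollifier_moll R n m.
transitivity (\int[leb]_y (c * moll m (x - y))).
  apply: eq_Rintegral => y _; have [k0|k0] := eqVneq (moll m (x - y)) 0.
    by rewrite k0 mul0r mulr0.
  by rewrite mulrC fc//; exact: (moll_supp H).
rewrite RintZ; last exact: (intg_subrV x (bkernel_intg (bm m))).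
rewrite (Rint_subrV x (f := moll m)); last by case: (bm m).
by rewrite (moll_int1 H) mulr1.
Qed.

Lemma natV_lt (e : R) : 0 < e -> exists m0, forall m, (m0 <= m)%N -> m.+1%:R^-1 <= e.
Proof.
move=> e0; have [m0 m0P] := cvgn_near e0 (@cvg_harmonic R).
by exists m0 => m /m0P; rewrite subr0 ger0_norm// invr_ge0.
Qed.

(** Away from the hyperplanes of the faces the indicator is constant on a small cube around [x],
    which contains the relevant support as soon as [1/(m+1)] is below the distance [e]: the sequence
    is eventually constant. *)
Lemma cvg_conv_obox (a b : 'I_n -> R) x :
  (forall i, x 0 i != a i) -> (forall i, x 0 i != b i) ->
  (fun m => convol (moll m) \1_(obox a b) x) @ \oo --> (\1_(obox a b) x : R).
Proof.
move=> xa xb.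
have [e e0 eP] : exists2 e : R, 0 < e & forall i, e <= `|x 0 i - a i| /\ e <= `|x 0 i - b i|.
  exists (\big[Num.min/1]_i Num.min `|x 0 i - a i| `|x 0 i - b i|).
    apply: lt_bigmin => // i _; rewrite lt_min !normr_gt0 !subr_eq0 xa xb//.
  move=> i; have : \big[Num.min/1]_i Num.min `|x 0 i - a i| `|x 0 i - b i| <=
      Num.min `|x 0 i - a i| `|x 0 i - b i| by exact: bigmin_le_cond.
  by rewrite le_min => /andP[].
have [m0 m0P] := natV_lt e0.
apply: cvgn_dist => e' e'0; exists m0 => m mm0.
rewrite (@conv_moll_const m _ x (\1_(obox a b) x)) ?subrr ?normr0 ?ltW//.
move=> y /cubeP xy.
have H i : `|x 0 i - y 0 i| < e.
  by have := xy i; rewrite !mxE => /lt_le_trans; apply; exact: m0P.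
suff E : obox a b y <-> obox a b x.
  by rewrite !indicE; congr (_%:R); congr nat_of_bool; apply/idP/idP; rewrite !inE => /E.
split => ab i; move: (ab i) (H i) (eP i).1 (eP i).2; rewrite !in_itv/= => /andP[? ?];
  rewrite ltr_norml !ler_normr => /andP[? ?] /orP[?|?] /orP[?|?]; apply/andP; split; lra.
Qed.

Lemma approximable_obox (a b : 'I_n -> R) : approximable \1_(obox a b).
Proof.
have mB := measurable_obox a b.
have LB : L2 \1_(obox a b) by apply: L2_indic => //; exact: lebesgue_obox_lty.
split => //.
(* The box lies in the cube of radius [s], and mollification spreads it by at most 1. *)
pose s : R := \sum_i (`|a i| + `|b i|) + 1.
have mK m : measurable_fun setT (convol (moll m) \1_(obox a b)).
  by apply: measurable_conv => //; exact: measurable_indic.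
have K01 m x : 0 <= convol (moll m) \1_(obox a b) x <= 1.
  have H := mollifier_moll R n m; apply/andP; split.
    by apply: Rintegral_ge0 => y _; rewrite mulr_ge0// (moll_ge0 H).
  rewrite -(moll_int1 H) -(Rint_subrV x (f := moll m)); last by case: (bm m).
  apply: Rint_le; first exact: conv_intg.
    exact: (intg_subrV x (bkernel_intg (bm m))).
  by move=> y; rewrite ler_piMr ?(moll_ge0 H)// indicE lern1 leq_b1.
have out m x : ~ cube (s + 1) x -> convol (moll m) \1_(obox a b) x = 0.
  move=> nx; apply: conv_moll_const => y /cubeP xy.
  rewrite indicE memNset// => ab; apply: nx; apply/cubeP => i.
  have := ab i; have := xy i; rewrite !mxE in_itv/= => /lt_le_trans.
  move=> /(_ 1); rewrite invf_le1 ?ltr0n// ler1n => /(_ isT).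
  rewrite ltr_norml => /andP[? ?] /andP[? ?].
  have : `|a i| + `|b i| <= \sum_i (`|a i| + `|b i|).
    by rewrite (bigD1 i)//= lerDl sumr_ge0// => j _; rewrite addr_ge0.
  have := ler_norm (b i); have := ler_norm (- a i); rewrite normrN.
  have := normr_ge0 (b i); have := normr_ge0 (a i).
  by rewrite /s ltr_norml => *; apply/andP; split; lra.
have outB x : ~ cube (s + 1) x -> \1_(obox a b) x = 0 :> R.
  move=> nx; rewrite indicE memNset// => ab; apply: nx; apply/cubeP => i.
  have := ab i; rewrite in_itv/= => /andP[? ?].
  have : `|a i| + `|b i| <= \sum_i (`|a i| + `|b i|).
    by rewrite (bigD1 i)//= lerDl sumr_ge0// => j _; rewrite addr_ge0.
  have := ler_norm (b i); have := ler_norm (- a i); rewrite normrN.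
  have := normr_ge0 (b i); have := normr_ge0 (a i).
  by rewrite /s ltr_norml => *; apply/andP; split; lra.
rewrite -[X in _ --> X](Rint0 leb).
apply: (@Rint_dominated _ _ _ _ _ _ (fun x => \1_(cube (s + 1)) x)).
- move=> m; apply: measurable_funX; apply: measurable_funB => //; exact: measurable_indic.
- exact: measurable_cst.
- have Hn (c : 'I_n -> R) : \forall x \ae leb, forall i : 'I_n, (x : Rn) 0 i != c i.
    apply: filter_forall => i; exists (hyperplane (c i) i); split.
    + exact: measurable_hyperplane.
    + exact: hyperplane_null.
    + by move=> x /= /negP; rewrite negbK => /eqP.
  apply: filterS2 (Hn a) (Hn b) => x xa xb.
  rewrite -[X in _ --> X](_ : (\1_(obox a b) x - \1_(obox a b) x) ^+ 2 = 0 :> R); last first.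
    by rewrite subrr expr0n.
  by apply: cvgM; apply: cvgB; try exact: cvg_cst; exact: cvg_conv_obox.
- exact: intg_indic_cube.
- apply: nearW => x m; rewrite ger0_norm ?sqr_ge0//.
  have [xs|xs] := pselect (cube (s + 1) x); last first.
    by rewrite out// outB// subrr expr0n.
  rewrite [leRHS]indicE mem_set//.
  have := K01 m x; rewrite indicE; case: (_ \in _) => /=; move=> /andP[? ?]; nra.
Qed.

End approximate_identity.

Section approximate_identity_L2.
Import HBNNSimple.
Context (R : realType) (n : nat).
Local Notation Rn := 'rV[R]_n.
Local Notation leb := (lebesgue_rV R n).
Local Notation L2 := (L2 leb).
Local Notation N2 := (N2 leb).
Implicit Types (f g : Rn -> R) (x y : Rn) (A B : set Rn).

Let Q (N : nat) : set Rn := cube N%:R.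

(** Cutting with cubes keeps all indicators in L^2, without which the class would not be stable
    under complement. *)
Let D : set (set Rn) := [set A | measurable A /\ forall N, approximable \1_(A `&` Q N)].

Let mQ N : measurable (Q N). Proof. exact: measurable_obox. Qed.

Let LQ N : L2 \1_(Q N).
Proof. by apply: L2_indic; [exact: mQ|exact: lebesgue_obox_lty]. Qed.

Let indicDU A B N : A `&` B = set0 ->
  \1_((A `|` B) `&` Q N) = (fun x => \1_(A `&` Q N) x + \1_(B `&` Q N) x) :> (Rn -> R).
Proof.
move=> AB; apply/funext => x; rewrite !indicE -natrD; congr (_%:R).
have ABx : ~ (A x /\ B x) by move=> ABx; have : set0 x by rewrite -AB.
rewrite !in_setI in_setU; case: (boolP (x \in A)); case: (boolP (x \in B)); case: (boolP (x \in Q N)) => //.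
by move=> _ /set_mem Bx /set_mem Ax; exfalso; exact: ABx.
Qed.

Let dynkinD : dynkin D.
Proof.
split.
- split => // N; rewrite setTI; exact: approximable_obox.
- move=> A [mA PA]; split; first exact: measurableC.
  move=> N; have := approximableB (approximable_obox (fun=> - N%:R) (fun=> N%:R)) (PA N).
  congr approximable; apply/funext => x; rewrite !indicE !in_setI in_setC.
  rewrite -/(cube _) -/(Q N).
  by case: (x \in A); case: (x \in Q N); rewrite /= ?subrr ?subr0.
- move=> F tF DF; split; first by apply: bigcupT_measurable => k; case: (DF k).
  move=> N; pose G l := \big[setU/set0]_(k < l) F k.
  have mG l : measurable (G l) by apply: bigsetU_measurable => k _; case: (DF k).
  have PG l : approximable \1_(G l `&` Q N).
    elim: l => [|l IHl].
      rewrite /G big_ord0 set0I; have := approximable0 R n; congr approximable.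
      by apply/funext => x; rewrite indicE in_set0.
    rewrite /G big_ord_recr/= indicDU; first by apply: approximableD => //; exact: (DF l).2.
    rewrite setIC big_distrr/= big1// => k _.
    by move/trivIsetP : tF => /(_ l k I I); apply; rewrite eq_sym neq_ltn ltn_ord.
  apply: (@approximable_dominated _ _ (fun l => \1_(G l `&` Q N)) _ \1_(Q N)) => //.
  + apply: measurable_indic; apply: measurableI => //.
    by apply: bigcupT_measurable => k; case: (DF k).
  + move=> l x; rewrite ger0_norm// !indicE ler_nat in_setI.
    by case: (_ \in G l).
  + move=> x; apply: cvgn_dist => e e0.
    have [[k _ Fkx]|nF] := pselect ((\bigcup_k F k) x).
      exists k.+1 => l kl; rewrite !indicE !in_setI (mem_set (A := G l)); last first.
        by rewrite /G -bigcup_mkord; exists k.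
      by rewrite (mem_set (A := \bigcup_k F k)) ?subrr ?normr0 ?ltW//; exists k.
    exists 0%N => l _; rewrite !indicE !in_setI (memNset (A := G l)); last first.
      by rewrite /G -bigcup_mkord => -[k _ Fk]; apply: nF; exists k.
    by rewrite (memNset (A := \bigcup_k F k))// subrr normr0 ltW.
Qed.

Lemma approximable_indic A : measurable A -> (leb A < +oo)%E -> approximable \1_A.
Proof.
move=> mA Afin.
have DA B : measurable B -> D B.
  rewrite measurable_rV_oboxes -(setI_closed_g_dynkin_g_sigma_algebra (@setI_closed_oboxes R n)).
  apply: smallest_sub; first exact: dynkinD.
  move=> _ [a [b ->]]; split; first exact: measurable_obox.
  move=> N.
  have [||a' [b' ->]] := @setI_closed_oboxes R n (obox a b) (Q N).
  - by exists a, b.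
  - by exists (fun=> - N%:R), (fun=> N%:R).
  - exact: approximable_obox.
apply: (@approximable_dominated _ _ (fun N => \1_(A `&` Q N)) _ \1_A) => //.
- by move=> N; exact: (DA A mA).2.
- exact: L2_indic.
- move=> N x; rewrite ger0_norm// !indicE ler_nat in_setI.
  by case: (x \in A) => //=; exact: leq_b1.
- move=> x; apply: cvgn_dist => e e0.
  have : (\bigcup_N Q N) x by rewrite /Q bigcup_obox.
  move=> [N _ QNx]; exists N => M NM; rewrite !indicE in_setI (mem_set (A := Q M)); last first.
    move/cubeP : QNx => QNx; apply/cubeP => i; apply: (lt_le_trans (QNx i)).
    by rewrite ler_nat.
  by rewrite andbT subrr normr0 ltW.
Qed.

Let approximable_ge0 f : L2 f -> (forall x, 0 <= f x) -> approximable f.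
Proof.
move=> Lf f0; have [mf if2] := Lf.
have mE : measurable_fun setT (EFin \o f) by exact/measurable_EFinP.
have E0 x : setT x -> (0 <= (EFin \o f) x)%E by move=> _; rewrite lee_fin.
pose g l := nnsfun_approx measurableT mE l.
have gf l x : g l x <= f x.
  by have := le_approx l E0 (I : setT x); rewrite /g nnsfun_approxE lee_fin.
apply: (@approximable_dominated _ _ (fun l => g l : Rn -> R) _ f) => //.
- move=> l; rewrite (_ : (g l : Rn -> R) = (fun x => g l x))//.
  under eq_fun do rewrite fimfunEord.
  apply: approximable_sum => j; set c := nth _ _ _.
  (* The level set of 0 may have infinite measure, but its coefficient is 0; the other level sets
     have finite measure by Chebyshev's inequality. *)
  have [->|c0] := eqVneq c 0.
    by under eq_fun do rewrite mul0r; exact: approximable0.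
  apply: approximableZ; apply: approximable_indic => //.
  have mA : measurable (g l @^-1` [set c]) by [].
  have : (\int[leb]_x (c ^+ 2 * \1_(g l @^-1` [set c]) x)%:E < +oo)%E.
    apply: le_lt_trans (integrable_lty measurableT if2).
    apply: ge0_le_integral => //.
    + by move=> x _; rewrite lee_fin mulr_ge0 ?sqr_ge0.
    + by apply/measurable_EFinP; apply: measurable_funM.
    + by apply/measurable_EFinP; exact: measurable_funX.
    + move=> x _; rewrite /= lee_fin indicE; case: (boolP (_ \in _)) => [/set_mem/= xc|_].
        by rewrite mulr1 lerXn2r ?nnegrE// -xc.
      by rewrite mulr0 sqr_ge0.
  under eq_integral do rewrite EFinM.
  rewrite ge0_integralZl//; last 2 first.
  + by apply/measurable_EFinP; exact: (measurable_indic mA).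
  + by rewrite lee_fin sqr_ge0.
  rewrite integral_indic// setIT.
  move=> H; rewrite ltey; apply/eqP => lA; move: H.
  rewrite [X in (_ * X)%E](_ : _ = +oo%E); last exact: lA.
  by rewrite mulry gtr0_sg ?mul1e// exprn_even_gt0.
- move=> l x; rewrite ger0_norm//.
- move=> x; have := cvg_nnsfun_approx measurableT mE E0 (I : setT x).
  by move=> /fine_cvg.
Qed.

Theorem approximable_L2 f : L2 f -> approximable f.
Proof.
move=> Lf; have [mf if2] := Lf.
have P1 : approximable (fun x => `|f x| + f x).
  apply: approximable_ge0; first by apply: L2D => //; exact: L2_norm.
  by move=> x; have := ler_norm (- f x); rewrite normrN; lra.
have P2 := approximable_ge0 (L2_norm Lf) (fun x => normr_ge0 (f x)).
have := approximableB P1 P2; congr approximable.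
by apply/funext => x; rewrite addrAC subrr add0r.
Qed.

Lemma cvg_moll f : L2 f ->
  (fun m => N2 (fun x => convol (moll m) f x - f x)) @ \oo --> (0 : R).
Proof. by move=> /approximable_L2[]. Qed.

End approximate_identity_L2.

(** * Mollified divergence-free fields and the transport identity *)

Section solenoidal_fields.
Context (R : realType) (n : nat).
Local Notation Rn := 'rV[R]_n.
Local Notation leb := (lebesgue_rV R n).
Local Notation e_ := (@basis_vector R n).
Local Notation L2 := (L2 leb).
Local Notation N2 := (N2 leb).
Local Notation intg := (intg leb).
Implicit Types (f g k h psi : Rn -> R) (x y z : Rn) (i j : 'I_n).
Implicit Types (U V v : 'I_n -> Rn -> R) (S : 'I_n -> 'I_n -> Rn -> R).

(** Fields are families of scalar components from here on, so that scalar convolutions and integrals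
    apply entry by entry. *)
Definition solenoidal U := forall psi, test_function psi ->
  \sum_i \int[leb]_x (U i x * 'D_(e_ i) psi x) = 0.

Definition sym_grad U S := forall i j psi, test_function psi ->
  \int[leb]_x (S i j x * psi x) =
  - (\int[leb]_x (U i x * 'D_(e_ j) psi x) + \int[leb]_x (U j x * 'D_(e_ i) psi x)) / 2.

Lemma derive_translate f (w : Rn) x y :
  'D_w (fun z => f (z - x)) y = 'D_w f (y - x).
Proof.
rewrite /derive; set F := (X in lim (X @ _)); set G := (X in _ = lim (X @ _)).
by have -> : F = G by apply/funext => h; rewrite /F /G /= addrA.
Qed.

Section one_kernel.
Context k r (H : mollifier k r).
Local Notation dk := (dkernel k).

Lemma derive_moll_sub i x y : 'D_(e_ i) (fun z => k (x - z)) y = - dk i (x - y).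
Proof.
rewrite (_ : (fun z => k (x - z)) = (fun z => k (z - x))); last first.
  by apply/funext => z; rewrite -opprB (moll_even H).
by rewrite derive_translate -[LHS]/(dk i _) -(dkernelN H) opprB.
Qed.

Lemma div_conv U x : solenoidal U -> \sum_i convol (dk i) (U i) x = 0.
Proof.
move=> /(_ _ (moll_test H x)) sU.
apply/eqP; rewrite -oppr_eq0 -sumrN; apply/eqP; rewrite -[RHS]sU.
apply: eq_bigr => i _; rewrite -RintN; apply: eq_Rintegral => y _.
by rewrite derive_moll_sub mulrN mulrC.
Qed.

Lemma sym_grad_conv U S i j x : sym_grad U S ->
  convol k (S i j) x = (convol (dk j) (U i) x + convol (dk i) (U j) x) / 2.
Proof.
move=> /(_ i j _ (moll_test H x)) E.
have C l l' : \int[leb]_y (U l y * 'D_(e_ l') (fun z => k (x - z)) y) = - convol (dk l') (U l) x.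
  rewrite -RintN; apply: eq_Rintegral => y _.
  by rewrite derive_moll_sub mulrN mulrC.
transitivity (\int[leb]_y (S i j y * k (x - y))).
  by apply: eq_Rintegral => y _; rewrite mulrC.
transitivity (- (- convol (dk j) (U i) x + - convol (dk i) (U j) x) / 2).
  by rewrite E; congr (- (_ + _) / 2); exact: C.
by rewrite -opprD opprK.
Qed.

Let bk : bkernel k. Proof. exact: moll_bkernel H. Qed.

Let bdk i : bkernel (dk i). Proof. exact: bkernel_dkernel H i. Qed.

Lemma conv_dkernel_conv i f x : L2 f ->
  convol (dk i) (convol k f) x = convol k (convol (dk i) f) x.
Proof.
move=> Lf; have [M [LM _] D] := conv_ddiff_moll H Lf.
exact: (conv_dkernel H x (D i) LM).
Qed.

(** Two mollifications, because the kernel is self-adjoint: the pairing of [u] with [mol2 v] is the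
    scalar product of [K u] and [K v], symmetric and nonnegative for [u = v]. *)
Definition mol2 v i : Rn -> R := convol k (convol k (v i)).

Definition dmol2 v i j : Rn -> R := convol (dk j) (convol k (v i)).

Section fields.
Context v (Lv : forall i, L2 (v i)) (sv : solenoidal v).

Lemma div_conv2 x : \sum_i dmol2 v i i x = 0.
Proof.
under eq_bigr do rewrite /dmol2 conv_dkernel_conv//.
rewrite -conv_sum; last by move=> i; apply: L2_conv => //; exact: bdk.
  rewrite /convol; under eq_Rintegral do rewrite div_conv// mulr0.
  exact: Rint0.
exact: bk.
Qed.

(** [S] only gives access to the symmetrised gradient of the mollified field, and the flux terms are
    arranged to use nothing else. *)
Lemma sym_dmol2 S i j x : (forall i j, L2 (S i j)) -> sym_grad v S ->
  dmol2 v i j x + dmol2 v j i x = convol k (convol k (S i j)) x + convol k (convol k (S j i)) x.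
Proof.
move=> LS vS; rewrite /dmol2 (conv_dkernel_conv j x (Lv i)) (conv_dkernel_conv i x (Lv j)).
have Lc a b : L2 (convol (dk a) (v b)) by apply: L2_conv => //; exact: bdk.
have -> : convol k (S i j) = (fun x => (convol (dk j) (v i) x + convol (dk i) (v j) x) * 2^-1).
  by apply/funext => z; rewrite (sym_grad_conv _ _ _ vS).
have -> : convol k (S j i) = (fun x => (convol (dk i) (v j) x + convol (dk j) (v i) x) * 2^-1).
  by apply/funext => z; rewrite (sym_grad_conv _ _ _ vS).
have LL a b c e : L2 (fun x => convol (dk a) (v b) x + convol (dk c) (v e) x).
  exact: L2D.
rewrite -convD//; last 2 first.
- by under eq_fun do rewrite mulrC; apply: L2Z.
- by under eq_fun do rewrite mulrC; apply: L2Z.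
rewrite -convD//; congr (convol _ _ _); apply/funext => z; lra.
Qed.

End fields.

Lemma mol2_ddiff v : (forall i, L2 (v i)) ->
  forall i, exists2 M, L2 M /\ (exists c : R, forall x, `|M x| <= c) &
  forall j, ddiff j (mol2 v i) (dmol2 v i j) M.
Proof.
move=> Lv i; have [M LM D] := conv_ddiff_moll H (L2_conv bk (Lv i)).
by exists M.
Qed.

End one_kernel.

(** [F G - f g] is split as [F (G - g) + (F - f) g]; the uniform bound [b] on [N2 (F l)] controls
    the first part. *)
Lemma lim_prod3 (F G : nat -> Rn -> R) f g h (c b : R) :
  L2 f -> L2 g -> (forall l, L2 (F l)) -> (forall l, L2 (G l)) ->
  measurable_fun setT h -> (forall x, `|h x| <= c) -> (forall l, N2 (F l) <= b) ->
  (fun l => N2 (fun x => F l x - f x)) @ \oo --> (0 : R) ->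
  (fun l => N2 (fun x => G l x - g x)) @ \oo --> (0 : R) ->
  (fun l => \int[leb]_x (F l x * G l x * h x)) @ \oo --> \int[leb]_x (f x * g x * h x).
Proof.
move=> Lf Lg LF LG mh hc Fb cF cG.
have c0 : 0 <= c by apply: le_trans (hc 0).
have b0 : 0 <= b by apply: le_trans (Fb 0%N); exact: N2_ge0.
apply: (@cvgn_squeeze _ _ (fun l => Num.sqrt (N2 (fun x => G l x - g x)) * (Num.sqrt b * c) +
   Num.sqrt (N2 (fun x => F l x - f x)) * (Num.sqrt (N2 g) * c))); last first.
  have -> : 0 = Num.sqrt 0 * (Num.sqrt b * c) + Num.sqrt 0 * (Num.sqrt (N2 g) * c) :> R.
    by rewrite sqrtr0 !mul0r addr0.
  apply: cvgD; apply: cvgM; try exact: cvg_cst.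
    by apply: (cvg_comp _ _ cG); exact: sqrt_continuous.
  by apply: (cvg_comp _ _ cF); exact: sqrt_continuous.
move=> l; have LGh := L2_bounded (L2B (LG l) Lg) mh hc; have LFh := L2_bounded (L2B (LF l) Lf) mh hc.
have Lgh := L2_bounded Lg mh hc.
have LFl := LF l; have LGl := LG l.
have i1 : intg (fun x => F l x * G l x * h x).
  by under eq_fun do rewrite -mulrA; apply: L2M => //; exact: (L2_bounded _ mh hc).
have i2 : intg (fun x => f x * g x * h x).
  by under eq_fun do rewrite -mulrA; apply: L2M.
rewrite -RintB//.
rewrite (_ : \int[leb]_x _ = \int[leb]_x (F l x * ((G l x - g x) * h x)) +
  \int[leb]_x ((F l x - f x) * (g x * h x))); last first.
  rewrite -RintD; [|exact: L2M|by apply: L2M => //; exact: L2B].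
  by apply: eq_Rintegral => x _; ring.
apply: (le_trans (ler_normD _ _)); apply: lerD.
  apply: (le_trans (cauchy_schwarz_abs LFl LGh)).
  rewrite mulrC (mulrC (Num.sqrt b)) mulrA; apply: ler_pM; rewrite ?sqrtr_ge0//.
    by apply: sqrt_N2_bounded => //; exact: L2B.
  by rewrite ler_sqrt.
apply: (le_trans (cauchy_schwarz_abs (L2B LFl Lf) Lgh)).
apply: ler_wpM2l; first exact: sqrtr_ge0.
exact: sqrt_N2_bounded.
Qed.

End solenoidal_fields.

(** * The transport identity *)

Section transport_identity.
Context (R : realType) (n : nat).
Local Notation Rn := 'rV[R]_n.
Local Notation leb := (lebesgue_rV R n).
Local Notation L2 := (L2 leb).
Local Notation N2 := (N2 leb).
Local Notation intg := (intg leb).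
Implicit Types (f g h : Rn -> R) (x y z : Rn) (i j : 'I_n).

Lemma cvgn_sum (I : Type) (s : seq I) (u : I -> nat -> R) (l : I -> R) :
  (forall a, u a @ \oo --> l a) ->
  (fun k => \sum_(i <- s) u i k) @ \oo --> \sum_(i <- s) l i.
Proof.
move=> ul; elim: s => [|a s IHs].
  by rewrite big_nil; under eq_fun do rewrite big_nil; exact: cvg_cst.
rewrite big_cons; under eq_fun do rewrite big_cons.
by apply: cvgD => //; exact: ul.
Qed.

Lemma intg3 f g h (c : R) : L2 f -> L2 g -> measurable_fun setT h ->
  (forall x, `|h x| <= c) -> intg (fun x => f x * g x * h x).
Proof.
move=> Lf Lg mh hc; under eq_fun do rewrite -mulrA.
by apply: L2M => //; exact: L2_bounded Lg mh hc.
Qed.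

Section smooth_identity.
Context (A : 'I_n -> Rn -> R) (DA : 'I_n -> 'I_n -> Rn -> R) (M : 'I_n -> Rn -> R).
Context (phi : 'I_n -> Rn -> R) (Dphi : 'I_n -> 'I_n -> Rn -> R) (P : 'I_n -> Rn -> R).
Context (c : 'I_n -> R).
Hypothesis dA : forall i j, ddiff j (A i) (DA i j) (M i).
Hypothesis LM : forall i, L2 (M i).
Hypothesis dphi : forall i j, ddiff j (phi i) (Dphi i j) (P i).
Hypothesis mP : forall i, measurable_fun setT (P i).
Hypothesis Pc : forall i x, `|P i x| <= c i.
Hypothesis divA : forall x, \sum_j DA j j x = 0.
Hypothesis divphi : forall x, \sum_i Dphi i i x = 0.

Let LA i : L2 (A i).
Proof.
apply: (L2_le (ddiff_meas (dA i i)) (LM i)) => x.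
by rewrite (le_trans (ddiff_le (dA i i) x))// ler_norm.
Qed.

Let LDA i j : L2 (DA i j).
Proof.
apply: (L2_le (ddiff_meas' (dA i j)) (LM i)) => x.
by rewrite (le_trans (ddiff_le' (dA i j) x))// ler_norm.
Qed.

Let mphi i : measurable_fun setT (phi i). Proof. exact: ddiff_meas (dphi i i). Qed.

Let mDphi i j : measurable_fun setT (Dphi i j).
Proof. exact: ddiff_meas' (dphi i j). Qed.

Let phic i x : `|phi i x| <= c i.
Proof. by rewrite (le_trans (ddiff_le (dphi i i) x))// (le_trans (ler_norm _)). Qed.

Let Dphic i j x : `|Dphi i j x| <= c i.
Proof. by rewrite (le_trans (ddiff_le' (dphi i j) x))// (le_trans (ler_norm _)). Qed.

Let ibp i j l : \int[leb]_x ((DA i l x * A j x + A i x * DA j l x) * phi i x) =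
  - \int[leb]_x (A i x * A j x * Dphi i l x).
Proof.
apply: (ddiff_ibp (ddiffM (dA i l) (dA j l)) (dphi i l)).
under eq_fun do rewrite -mulrA; apply: intgZ.
by apply: intg3 => //; exact: Pc.
Qed.

Let ibp2 i j l : \int[leb]_x ((DA j l x * A j x + A j x * DA j l x) * phi i x) =
  - \int[leb]_x (A j x * A j x * Dphi i l x).
Proof.
apply: (ddiff_ibp (ddiffM (dA j l) (dA j l)) (dphi i l)).
under eq_fun do rewrite -mulrA; apply: intgZ.
by apply: intg3 => //; exact: Pc.
Qed.

Let term1 i j : \int[leb]_x (A i x * A j x * Dphi i j x) =
  - (\int[leb]_x (DA i j x * A j x * phi i x)) - (\int[leb]_x (A i x * DA j j x * phi i x)).
Proof.
apply/eqP; rewrite -eqr_opp opprD !opprK; apply/eqP; rewrite -ibp -RintD.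
- by apply: eq_Rintegral => x _; rewrite mulrDl.
- by apply: intg3 => //; exact: phic.
- by apply: intg3 => //; exact: phic.
Qed.

Let term2 i : \sum_j \int[leb]_x (A i x * DA j j x * phi i x) = 0.
Proof.
rewrite -Rint_sum; last by move=> j; apply: intg3 => //; exact: phic.
rewrite -[RHS](Rint0 leb); apply: eq_Rintegral => x _.
by rewrite -mulr_suml -mulr_sumr divA mulr0 mul0r.
Qed.

Let term3 j : \sum_i \int[leb]_x (DA j i x * A j x * phi i x) = 0.
Proof.
have E i : \int[leb]_x (DA j i x * A j x * phi i x) =
    - 2^-1 * \int[leb]_x (A j x * A j x * Dphi i i x).
  rewrite mulNr -mulrN -ibp2.
  rewrite -RintZ; first by apply: eq_Rintegral => x _; field.
  under eq_fun do rewrite mulrDl.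
  by apply: intgD; apply: intg3 => //; exact: phic.
under eq_bigr do rewrite E.
rewrite -mulr_sumr -Rint_sum; last by move=> i; apply: intg3 => //; exact: Dphic.
rewrite (_ : \int[leb]_x _ = 0) ?mulr0// -[RHS](Rint0 leb).
by apply: eq_Rintegral => x _; rewrite -mulr_sumr divphi mulr0.
Qed.

(** Since [A] is divergence-free, the product rule leaves [(A . grad) A]. The transposed term is the
    gradient of [|A|^2 / 2], which integrates to 0 against the divergence-free [phi]; it is added so
    that the symmetric gradient appears. *)
Lemma smooth_identity :
  \sum_i \sum_j \int[leb]_x (A i x * A j x * Dphi i j x) =
  - \sum_i \sum_j \int[leb]_x ((DA i j x + DA j i x) * A j x * phi i x).
Proof.
have E i j : \int[leb]_x ((DA i j x + DA j i x) * A j x * phi i x) =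
    \int[leb]_x (DA i j x * A j x * phi i x) + \int[leb]_x (DA j i x * A j x * phi i x).
  rewrite -RintD; first by apply: eq_Rintegral => x _; rewrite !mulrDl.
  - by apply: intg3 => //; exact: phic.
  - by apply: intg3 => //; exact: phic.
have -> : \sum_i \sum_j \int[leb]_x ((DA i j x + DA j i x) * A j x * phi i x) =
    \sum_i \sum_j \int[leb]_x (DA i j x * A j x * phi i x).
  under eq_bigr do under eq_bigr do rewrite E.
  under eq_bigr do rewrite big_split/=.
  rewrite big_split/= [X in _ + X]exchange_big/=.
  by rewrite [X in _ + X]big1 ?addr0// => j _; exact: term3.
rewrite -sumrN; apply: eq_bigr => i _.
under eq_bigr do rewrite term1.
by rewrite big_split/= !sumrN term2 oppr0 addr0.
Qed.

End smooth_identity.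

Lemma sum_halves (a b : R) : a + b = (a + b) / 2 + (b + a) / 2.
Proof. by field. Qed.

(* [div (U (x) U) = 2 S U - grad (|U|^2 / 2)] if [S] is the symmetric gradient of [U]. *)
Lemma transport_identity k r U S v : mollifier k r ->
  (forall i, L2 (U i)) -> solenoidal U -> (forall i j, L2 (S i j)) -> sym_grad U S ->
  (forall i, L2 (v i)) -> solenoidal v ->
  \sum_i \sum_j \int[leb]_x (U i x * U j x * dmol2 k v i j x) =
  - \sum_i \sum_j \int[leb]_x ((S i j x + S j i x) * U j x * mol2 k v i x).
Proof.
move=> H LU sU LS US Lv sv.
have /choice[P PP] : forall i, exists P, (L2 P /\ exists c : R, forall x, `|P x| <= c) /\
    forall j, ddiff j (mol2 k v i) (dmol2 k v i j) P.
  by move=> i; have [P ? ?] := mol2_ddiff H Lv i; exists P.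
have /choice[c Pc] : forall i, exists c : R, forall x, `|P i x| <= c.
  by move=> i; have [[_ ?] _] := PP i.
have dphi i j : ddiff j (mol2 k v i) (dmol2 k v i j) (P i).
  by have [_] := PP i; exact.
have mP i : measurable_fun setT (P i) by have [[[]]] := PP i.
pose K l := moll_bkernel (mollifier_moll R n l).
(* [U] is regularised at a second scale [l], independent of [k]. The field [mol2 k v] stays fixed
   meanwhile, bounded with bounded derivatives. *)
pose A l i := convol (moll l) (U i).
pose DA l i j := convol (dkernel (moll l) j) (U i).
have idl l : \sum_i \sum_j \int[leb]_x (A l i x * A l j x * dmol2 k v i j x) =
  - \sum_i \sum_j \int[leb]_x
    ((convol (moll l) (S i j) x + convol (moll l) (S j i) x) * A l j x * mol2 k v i x).
  have /choice[M MM] : forall i, exists M, L2 M /\ forall j, ddiff j (A l i) (DA l i j) M.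
    move=> i; have [M [LM _] D] := conv_ddiff_moll (mollifier_moll R n l) (LU i).
    by exists M.
  have divA x : \sum_j DA l j j x = 0 by exact (div_conv (mollifier_moll R n l) x sU).
  have divphi x : \sum_i dmol2 k v i i x = 0 by exact (div_conv2 H Lv sv x).
  have := @smooth_identity (A l) (DA l) M (mol2 k v) (dmol2 k v) P c
    (fun i => (MM i).2) (fun i => (MM i).1) dphi mP Pc divA divphi.
  move=> ->; congr (- _); apply: eq_bigr => i _; apply: eq_bigr => j _; apply: eq_Rintegral => x _.
  congr (_ * _ * _).
  rewrite (sym_grad_conv (mollifier_moll R n l) i j x US) (sym_grad_conv (mollifier_moll R n l) j i x US).
  exact: sum_halves.
have mphi i : measurable_fun setT (mol2 k v i) by exact: ddiff_meas (dphi i i).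
have mDphi i j : measurable_fun setT (dmol2 k v i j) by exact: ddiff_meas' (dphi i j).
have phic i x : `|mol2 k v i x| <= c i.
  by rewrite (le_trans (ddiff_le (dphi i i) x))// (le_trans (ler_norm _)).
have Dphic i j x : `|dmol2 k v i j x| <= c i.
  by rewrite (le_trans (ddiff_le' (dphi i j) x))// (le_trans (ler_norm _)).
have LA l i : L2 (A l i) by apply: L2_conv => //; exact: K.
have cA i : (fun l => N2 (fun x => A l i x - U i x)) @ \oo --> (0 : R) by exact: cvg_moll.
have NA l i : N2 (A l i) <= N2 (U i) by exact: N2_moll (mollifier_moll R n l) _ (LU i).
have LKS l i j : L2 (convol (moll l) (S i j)) by apply: L2_conv => //; exact: K.
have cl : (fun l => \sum_i \sum_j \int[leb]_x (A l i x * A l j x * dmol2 k v i j x)) @ \oo -->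
    \sum_i \sum_j \int[leb]_x (U i x * U j x * dmol2 k v i j x).
  apply: cvgn_sum => i; apply: cvgn_sum => j.
  by apply: (lim_prod3 (c := c i) (b := N2 (U i))).
have cr : (fun l => - \sum_i \sum_j \int[leb]_x
    ((convol (moll l) (S i j) x + convol (moll l) (S j i) x) * A l j x * mol2 k v i x)) @ \oo -->
    - \sum_i \sum_j \int[leb]_x ((S i j x + S j i x) * U j x * mol2 k v i x).
  apply: cvgN; apply: cvgn_sum => i; apply: cvgn_sum => j.
  apply: (lim_prod3 (c := c i) (b := 2 * N2 (S i j) + 2 * N2 (S j i))) => //.
  - exact: L2D.
  - by move=> l; exact: L2D.
  - move=> l; apply: (le_trans (N2D_le (LKS l i j) (LKS l j i))).
    by apply: lerD; rewrite ler_pM2l//; apply: N2_moll (mollifier_moll R n l) _ (LS _ _).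
  - have [_ cS] := approximableD (approximable_L2 (LS i j)) (approximable_L2 (LS j i)).
    rewrite (_ : (fun l => _) = (fun l => N2 (fun x =>
      convol (moll l) (fun x => S i j x + S j i x) x - (S i j x + S j i x)))) //.
    apply/funext => l; congr N2; apply/funext => x.
    by rewrite (convD x (K l) (LS i j) (LS j i)).
apply: (cvgn_unique cl).
by under eq_fun do rewrite idl.
Qed.

End transport_identity.

(** * Pairings with an exponentially integrable strain *)

Section young.
Context (R : realType).

(** If [y <= delta (1 + x^sigma)] the first term suffices. Otherwise [x^sigma < y / delta], so [x^2]
    is at most the power [2 / sigma] of [y / delta], a number at least 1, and [N] is an integer
    above [2 / sigma]. *)
Lemma young_powR (sigma : R) : 0 < sigma -> exists2 N : nat, (0 < N)%N &
  forall delta x y : R, 0 < delta -> 0 <= x -> 0 <= y ->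
  x ^+ 2 * y <= delta * (x ^+ 2 + x `^ (2 + sigma)) + (y / delta) ^+ N * y.
Proof.
move=> s0; exists (Num.truncn (2 / sigma)).+1 => // delta x y d0 x0 y0.
set N := (Num.truncn _).+1.
have Q0 : 0 <= (y / delta) ^+ N * y by rewrite mulr_ge0// exprn_ge0// divr_ge0// ltW.
have P0 : 0 <= delta * (x ^+ 2 + x `^ (2 + sigma)).
  by rewrite mulr_ge0 ?(ltW d0)// addr_ge0 ?sqr_ge0 ?powR_ge0.
have [->|xn0] := eqVneq x 0.
  by rewrite expr0n mul0r addr_ge0// mulr_ge0 ?(ltW d0)// addr_ge0 ?powR_ge0.
have xgt0 : 0 < x by rewrite lt_neqAle eq_sym xn0.
have E : x `^ (2 + sigma) = x ^+ 2 * x `^ sigma.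
  by rewrite powRD ?(gt_eqF xgt0) ?implybT// powR_mulrn.
have [yx|xy] := leP y (delta * (1 + x `^ sigma)).
  rewrite -[leLHS]addr0; apply: lerD => //.
  rewrite E; have -> : delta * (x ^+ 2 + x ^+ 2 * x `^ sigma) =
    x ^+ 2 * (delta * (1 + x `^ sigma)) by ring.
  by rewrite ler_wpM2l ?sqr_ge0.
rewrite -[leLHS]add0r; apply: lerD => //.
rewrite ler_wpM2r//.
have yd : 1 + x `^ sigma < y / delta by rewrite ltr_pdivlMr// mulrC.
have ps := powR_ge0 x sigma.
have yd1 : 1 <= y / delta by rewrite ltW// (le_lt_trans _ yd)// lerDl.
have -> : x ^+ 2 = (x `^ sigma) `^ (2 / sigma).
  by rewrite -powRrM mulrCA mulfV ?gt_eqF// mulr1 powR_mulrn.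
apply: (@le_trans _ _ ((y / delta) `^ (2 / sigma))).
  apply: ge0_ler_powR; rewrite ?nnegrE//.
  - by rewrite divr_ge0// ltW.
  - exact: le_trans yd1.
  - by apply: ltW; apply: le_lt_trans yd; rewrite lerDr.
rewrite -powR_mulrn ?(le_trans _ yd1)//.
by apply: ler_powR => //; rewrite ltW// truncnS_gt.
Qed.

Lemma abs_split_le (e t1 t2 t3 t4 : R) : 0 < e -> `|t1 - t2| <= e / 4 ->
  `|t4| <= e / 4 -> `|t3| <= e / 4 -> `|t1 + t3 - (t2 + t4)| <= e.
Proof.
move=> e0; rewrite !ler_norml => /andP[? ?] /andP[? ?] /andP[? ?].
by apply/andP; split; lra.
Qed.

End young.

(** * Limits of pairings under mollification *)

Section mollified_pairing.
Context (R : realType) (n : nat).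
Local Notation Rn := 'rV[R]_n.
Local Notation leb := (lebesgue_rV R n).
Local Notation L2 := (L2 leb).
Local Notation N2 := (N2 leb).
Local Notation intg := (intg leb).
Implicit Types (f g h a s : Rn -> R) (x y z : Rn).

Section one_kernel.
Context (k : Rn -> R) r (H : mollifier k r).

Let bk : bkernel k. Proof. exact: moll_bkernel H. Qed.

Lemma conv_intg1 f x : intg f -> intg (fun y => k (x - y) * f y).
Proof.
move=> iF; have [c c0 kc] := bkernel_bounded bk.
apply: (@intg_le _ _ _ _ _ (fun y => c * `|f y|)).
- by apply: measurable_funM; [exact: bkernel_subr|exact: intg_measurable iF].
- by move=> y; rewrite normrM ler_wpM2r.
- by apply: intgZ; exact: intg_norm.
Qed.

Lemma conv_abs_le f g x : measurable_fun setT f -> intg g ->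
  (forall y, `|f y| <= g y) -> `|convol k f x| <= convol k g x.
Proof.
move=> mf ig fg; apply: Rint_abs_le; last 2 first.
- exact: conv_intg1.
- by move=> y; rewrite normrM (ger0_norm (moll_ge0 H _)) ler_wpM2l ?(moll_ge0 H).
- by apply: measurable_funM => //; exact: bkernel_subr.
Qed.

Lemma conv_affine_le (a0 c0 : R) f g z : intg f -> intg g ->
  (forall y, a0 * f y <= c0 + g y) -> a0 * convol k f z <= c0 + convol k g z.
Proof.
move=> iF ig fg.
have ik : intg (fun y => k (z - y)) by exact: (intg_subrV z (bkernel_intg bk)).
have -> : c0 = \int[leb]_y (c0 * k (z - y)).
  rewrite RintZ// (Rint_subrV z (f := k)); last by case: bk.
  by rewrite (moll_int1 H) mulr1.
rewrite -RintZ; last exact: conv_intg1.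
rewrite -RintD; [|exact: intgZ|exact: conv_intg1].
apply: Rint_le.
- by apply: intgZ; exact: conv_intg1.
- by apply: intgD; [exact: intgZ|exact: conv_intg1].
- move=> y; rewrite mulrCA (mulrC c0) -mulrDr ler_wpM2l ?(moll_ge0 H)//.
Qed.

Lemma intg_conv f : intg f -> (forall x, 0 <= f x) -> intg (convol k f).
Proof.
move=> iF f0; have := intg_conv_ge0 bk iF f0.
by under eq_fun do under eq_Rintegral do rewrite (ger0_norm (moll_ge0 H _)).
Qed.

Lemma Rint_conv f : intg f -> (forall x, 0 <= f x) ->
  \int[leb]_x convol k f x = \int[leb]_x f x.
Proof.
move=> iF f0; have := Rint_conv_ge0 bk iF f0.
under eq_Rintegral do under eq_Rintegral do rewrite (ger0_norm (moll_ge0 H _)).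
by move=> ->; rewrite (moll_norm1 H) mul1r.
Qed.

Lemma conv_ge0 f x : (forall x, 0 <= f x) -> 0 <= convol k f x.
Proof. by move=> f0; apply: Rintegral_ge0 => y _; rewrite mulr_ge0 ?(moll_ge0 H). Qed.

(** The hypothesis relates [a] and [s] at two independent points, as convolution mixes values at
    different points. For fixed [x] it is affine in functions of [y], so a kernel of integral 1
    preserves it, twice, and leaves the integral of [Q] unchanged. *)
Lemma conv2_young (A Q : Rn -> R) f g a s : measurable_fun setT f -> measurable_fun setT g ->
  (forall x, `|f x| <= a x) -> (forall x, `|g x| <= s x) ->
  intg A -> intg Q -> intg s -> (forall x, 0 <= Q x) -> (forall x y, a x * s y <= A x + Q y) ->
  intg (fun x => f x * convol k (convol k g) x) /\
  `|\int[leb]_x (f x * convol k (convol k g) x)| <= \int[leb]_x A x + \int[leb]_x Q x.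
Proof.
move=> mf mg fa gs iA iQ is_ Q0 aAQ.
have s0 x : 0 <= s x by apply: le_trans (gs x).
have a0 x : 0 <= a x by apply: le_trans (fa x).
have iKs := intg_conv is_ s0; have iKQ := intg_conv iQ Q0.
have iKKQ := intg_conv iKQ (fun x => conv_ge0 x Q0).
have pt x : `|f x * convol k (convol k g) x| <= A x + convol k (convol k Q) x.
  rewrite normrM; apply: (@le_trans _ _ (a x * convol k (convol k s) x)).
    apply: ler_pM => //; apply: conv_abs_le => //; first exact: measurable_conv.
    by move=> y; exact: conv_abs_le.
  apply: conv_affine_le => // z; apply: conv_affine_le => // y; exact: aAQ.
have mF : measurable_fun setT (fun x => f x * convol k (convol k g) x).
  by apply: measurable_funM => //; apply: measurable_conv => //; exact: measurable_conv.
have iAQ := intgD iA iKKQ.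
split; first exact: (intg_le mF pt iAQ).
rewrite -(Rint_conv iQ Q0) -(Rint_conv iKQ (fun x => conv_ge0 x Q0)) -RintD//.
exact: Rint_abs_le.
Qed.

End one_kernel.

(** [K K f - f = K (K f - f) + (K f - f)], and [K] is a contraction; hence the factor 4. *)
Lemma cvg_moll2 f : L2 f ->
  (fun m => N2 (fun x => convol (moll m) (convol (moll m) f) x - f x)) @ \oo --> (0 : R).
Proof.
move=> Lf; have H m := mollifier_moll R n m; have bk m := moll_bkernel (H m).
apply: (@cvgn_squeeze _ _ (fun m => 4 * N2 (fun x => convol (moll m) f x - f x))); last first.
  by rewrite -[0](mulr0 4); apply: cvgM; [exact: cvg_cst|exact: cvg_moll].
move=> m; rewrite subr0 ger0_norm ?N2_ge0//.
have LK := L2_conv (bk m) Lf; have LD := L2B LK Lf.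
rewrite (_ : (fun x => _) = (fun x => convol (moll m) (fun x => convol (moll m) f x - f x) x +
   (convol (moll m) f x - f x))); last first.
  by apply/funext => x; rewrite (convB x (bk m) LK Lf) addrA subrK.
apply: (le_trans (N2D_le (L2_conv (bk m) LD) LD)).
have := N2_moll (H m) LD; set t := N2 _; set t' := N2 _; lra.
Qed.

Section pairing_limit.
Context (Pf : R -> R) (N : nat) (N0 : (0 < N)%N).
Hypothesis young : forall delta x y : R, 0 < delta -> 0 <= x -> 0 <= y ->
  x ^+ 2 * y <= delta * Pf x + (y / delta) ^+ N * y.
Context a s (ma : measurable_fun setT a) (a0 : forall x, 0 <= a x).
Hypothesis a2 : L2 a.
Hypothesis iPa : intg (fun x => Pf (a x)).
Hypothesis Pfa : forall x, 0 <= Pf (a x).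
Hypothesis s0 : forall x, 0 <= s x.
Hypothesis is_ : forall k, intg (fun x => s x ^+ k.+1).

Let Q (delta : R) x := delta^-1 ^+ N * s x ^+ N.+1.

Let youngQ (delta : R) x y : 0 < delta -> a x ^+ 2 * s y <= delta * Pf (a x) + Q delta y.
Proof.
move=> d0; apply: (le_trans (young d0 (a0 x) (s0 y))).
by rewrite lerD2l /Q exprMn exprSr mulrA (mulrC (_ ^+ N)).
Qed.

Let iQ delta : intg (Q delta). Proof. exact: intgZ. Qed.

Let Q0 (delta : R) : 0 < delta -> forall x, 0 <= Q delta x.
Proof. by move=> d0 x; rewrite mulr_ge0// exprn_ge0// invr_ge0 ltW. Qed.

Let is1 : intg s.
Proof. by have := is_ 0; under eq_fun do rewrite expr1. Qed.

Context f g (mf : measurable_fun setT f) (mg : measurable_fun setT g).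
Hypothesis fa : forall x, `|f x| <= a x ^+ 2.
Hypothesis gs : forall x, `|g x| <= s x.

Lemma pairing_L2 : L2 g.
Proof.
split => //; apply: (intg_le _ _ (is_ 1)); first exact: measurable_funX.
by move=> x; rewrite normrX lerXn2r ?nnegrE.
Qed.

Lemma pairing_intg : intg (fun x => f x * g x).
Proof.
apply: (@intg_le _ _ _ _ _ (fun x => 1 * Pf (a x) + Q 1 x)).
- exact: measurable_funM.
- move=> x; rewrite normrM; apply: (le_trans _ (youngQ x x ltr01)).
  by apply: ler_pM => //; exact: sqr_ge0.
- by apply: intgD => //; exact: intgZ.
Qed.

Lemma pairing_moll_intg m : intg (fun x => f x * convol (moll m) (convol (moll m) g) x).
Proof.
have [] := conv2_young (mollifier_moll R n m) mf mg fa gs (intgZ 1 iPa) (iQ 1) is1 (Q0 ltr01)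
  (fun x y => youngQ x y ltr01).
by [].
Qed.

Lemma pairing_moll_le m : `|\int[leb]_x (f x * convol (moll m) (convol (moll m) g) x)| <=
  \int[leb]_x Pf (a x) + \int[leb]_x (s x ^+ N.+1).
Proof.
have [_] := conv2_young (mollifier_moll R n m) mf mg fa gs (intgZ 1 iPa) (iQ 1) is1 (Q0 ltr01)
  (fun x y => youngQ x y ltr01).
by rewrite RintZ// RintZ// invr1 expr1n !mul1r.
Qed.

(** The indicator of the tail [a > B], which carries little of the integral of [Pf (a x)] when [B]
    is large. *)
Let trunc (B : nat) x : R := if a x <= B%:R then 0 else 1.

Let mtrunc B : measurable_fun setT (trunc B).
Proof.
apply: measurable_fun_ifT => //.
exact: measurable_fun_ler.
Qed.

Let trunc01 B x : 0 <= trunc B x <= 1.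
Proof. by rewrite /trunc; case: ifP; rewrite ?lexx ?ler01. Qed.

Let cvg_trunc : (fun B => \int[leb]_x (trunc B x * Pf (a x))) @ \oo --> (0 : R).
Proof.
rewrite -[X in _ --> X](Rint0 leb).
have mPa := intg_measurable iPa.
apply: (@Rint_dominated _ _ _ _ _ _ (fun x => Pf (a x))) => //.
- by move=> B; apply: measurable_funM.
- apply: nearW => x; apply: cvgn_dist => e e0; exists (Num.truncn (a x)).+1 => B aB.
  rewrite /trunc ifT ?mul0r ?subrr ?normr0 ?ltW//.
  by rewrite (lt_le_trans (truncnS_gt _))// ler_nat.
- apply: nearW => x B; have /andP[t0 t1] := trunc01 B x.
  by rewrite ger0_norm ?mulr_ge0// ler_piMl.
Qed.

(** [f] is only bounded by [a^2], which need not be in L^2, so L^2 convergence of the mollified [g]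
    is not enough. Where [a <= B] the function is in L^2 and Cauchy-Schwarz applies; on the tail
    Young's inequality gives a bound uniform in [m]. *)
Lemma cvg_pairing :
  (fun m => \int[leb]_x (f x * convol (moll m) (convol (moll m) g) x)) @ \oo -->
  \int[leb]_x (f x * g x).
Proof.
have Lg := pairing_L2.
apply: cvgn_dist => e e0; have e8 : 0 < e / 8 by rewrite divr_gt0.
pose I := \int[leb]_x (s x ^+ N.+1).
have I0 : 0 <= I by apply: Rintegral_ge0 => x _; rewrite exprn_ge0.
(* Large enough that [delta^-1 * I <= e / 8]; as [N] is positive and [delta >= 1], the power
   [delta^- N] is no larger than [delta^-1]. *)
pose delta := 1 + I / (e / 8).
have d1 : 1 <= delta by rewrite lerDl divr_ge0// ltW.
have d0 : 0 < delta by exact: lt_le_trans d1.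
have Qe : \int[leb]_x Q delta x <= e / 8.
  rewrite RintZ//; apply: (@le_trans _ _ (delta^-1 * I)).
    apply: ler_wpM2r => //; rewrite -[leRHS]expr1; apply: ler_wiXn2l => //.
      by rewrite invr_ge0 ltW.
    by rewrite invf_le1.
  rewrite mulrC ler_pdivrMr// -ler_pdivrMl// mulrC.
  by rewrite lerDr.
have ed : 0 < e / 8 / delta by rewrite divr_gt0.
(* [B] is chosen after [delta], to absorb the factor [delta] in front of the tail. *)
have [B BP] := cvgn_near ed cvg_trunc.
have {}BP : delta * \int[leb]_x (trunc B x * Pf (a x)) <= e / 8.
  have := BP B (leqnn _); rewrite subr0 => /(le_trans (ler_norm _)).
  by rewrite ler_pdivlMr// mulrC.
pose f1 x := (1 - trunc B x) * f x; pose f2 x := trunc B x * f x.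
have mf1 : measurable_fun setT f1 by apply: measurable_funM => //; exact: measurable_funB.
have mf2 : measurable_fun setT f2 by exact: measurable_funM.
have Lf1 : L2 f1.
  apply: (@L2_le _ _ _ _ _ (fun x => B%:R * a x)) => //; first exact: L2Z.
  move=> x; rewrite /f1 /trunc; case: ifP => aB; last by rewrite subrr mul0r normr0.
  rewrite subr0 mul1r (le_trans (fa x))// ger0_norm ?mulr_ge0//.
  by rewrite expr2 ler_wpM2r.
have f2a x : `|f2 x| <= trunc B x * a x ^+ 2.
  have /andP[t0 t1] := trunc01 B x.
  by rewrite normrM ger0_norm// ler_wpM2l.
have y2 x y : trunc B x * a x ^+ 2 * s y <= delta * (trunc B x * Pf (a x)) + Q delta y.
  rewrite /trunc; case: ifP => _; last by rewrite !mul1r; exact: youngQ.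
  by rewrite !mul0r mulr0 add0r Q0.
have iT : intg (fun x => delta * (trunc B x * Pf (a x))).
  apply: intgZ; apply: (intg_le _ _ iPa); first by apply: measurable_funM => //; exact: intg_measurable iPa.
  move=> x; have /andP[t0 t1] := trunc01 B x.
  by rewrite ger0_norm ?mulr_ge0// ler_piMl.
have f2g : `|\int[leb]_x (f2 x * g x)| <= e / 4.
  apply: (@le_trans _ _ (\int[leb]_x (delta * (trunc B x * Pf (a x)) + Q delta x))).
    apply: Rint_abs_le; [exact: measurable_funM|exact: intgD|].
    move=> x; rewrite normrM; apply: (le_trans _ (y2 x x)).
    by apply: ler_pM.
  rewrite RintD// RintZ; first by lra.
  apply: (intg_le _ _ iPa); first by apply: measurable_funM => //; exact: intg_measurable iPa.
  move=> x; have /andP[t0 t1] := trunc01 B x.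
  by rewrite ger0_norm ?mulr_ge0// ler_piMl.
have f2Kg m : `|\int[leb]_x (f2 x * convol (moll m) (convol (moll m) g) x)| <= e / 4.
  have [_] := conv2_young (mollifier_moll R n m) mf2 mg f2a gs iT (iQ delta) is1 (Q0 d0) y2.
  move=> /le_trans; apply; rewrite RintZ; first by lra.
  apply: (intg_le _ _ iPa); first by apply: measurable_funM => //; exact: intg_measurable iPa.
  move=> x; have /andP[t0 t1] := trunc01 B x.
  by rewrite ger0_norm ?mulr_ge0// ler_piMl.
have if2K m : intg (fun x => f2 x * convol (moll m) (convol (moll m) g) x).
  by have [] := conv2_young (mollifier_moll R n m) mf2 mg f2a gs iT (iQ delta) is1 (Q0 d0) y2.
have if2g : intg (fun x => f2 x * g x).
  apply: (intg_le _ _ (intg_norm pairing_intg)); first exact: measurable_funM.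
  move=> x; rewrite !normrM ler_wpM2r//; have /andP[t0 t1] := trunc01 B x.
  by rewrite ger0_norm// ler_piMl.
have bk m := moll_bkernel (mollifier_moll R n m).
have LK m : L2 (convol (moll m) (convol (moll m) g)) by do 2 apply: L2_conv => //.
have c1 : (fun m => Num.sqrt (N2 f1) *
    Num.sqrt (N2 (fun x => convol (moll m) (convol (moll m) g) x - g x))) @ \oo --> (0 : R).
  rewrite -[0](mulr0 (Num.sqrt (N2 f1))) -[X in _ * X](sqrtr0 R).
  apply: cvgM; first exact: cvg_cst.
  by apply: (cvg_comp _ _ (cvg_moll2 Lg)); exact: sqrt_continuous.
have e4 : 0 < e / 4 by rewrite divr_gt0.
have [m0 m0P] := cvgn_near e4 c1.
exists m0 => m /m0P; rewrite subr0 => /(le_trans (ler_norm _)) c1m.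
have E h : intg (fun x => f1 x * h x) -> intg (fun x => f2 x * h x) ->
    \int[leb]_x (f x * h x) = \int[leb]_x (f1 x * h x) + \int[leb]_x (f2 x * h x).
  move=> i1 i2; rewrite -RintD//; apply: eq_Rintegral => x _.
  by rewrite /f1 /f2 -!mulrDl subrK mul1r.
rewrite (E g (L2M Lf1 Lg) if2g) (E _ (L2M Lf1 (LK m)) (if2K m)).
have f1K : `|\int[leb]_x (f1 x * convol (moll m) (convol (moll m) g) x) -
    \int[leb]_x (f1 x * g x)| <= e / 4.
  rewrite -RintB; [|exact: L2M|exact: L2M].
  apply: le_trans c1m; rewrite (_ : \int[leb]_x _ =
    \int[leb]_x (f1 x * (convol (moll m) (convol (moll m) g) x - g x))).
    by apply: cauchy_schwarz_abs => //; exact: L2B.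
  by apply: eq_Rintegral => x _; rewrite mulrBr.
move: f1K f2g (f2Kg m).
move: (\int[leb]_x (f1 x * _)) (\int[leb]_x (f1 x * g x)) (\int[leb]_x (f2 x * _)) (\int[leb]_x (f2 x * g x)).
by move=> t1 t2 t3 t4 ? ? ?; exact: abs_split_le.
Qed.

End pairing_limit.

End mollified_pairing.

Section slice_arithmetic.
Context (R : realType).

Lemma prod_le_sqr (a b : R) : `|a * b| <= a ^+ 2 + b ^+ 2.
Proof.
rewrite normrM -[a ^+ 2]real_normK ?num_real// -[b ^+ 2]real_normK ?num_real//.
by have := sqr_ge0 (`|a| - `|b|); have := normr_ge0 a; have := normr_ge0 b; nra.
Qed.

Lemma four_le (a b c : R) : a <= c -> b <= c -> 2 * a + 2 * b <= 4 * c.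
Proof. by lra. Qed.

Lemma sum_swap n (F : 'I_n -> 'I_n -> R) : \sum_i \sum_j F i j = \sum_i \sum_j F j i.
Proof. exact: exchange_big. Qed.

Lemma sum_sym_eq n (F G : 'I_n -> 'I_n -> R) :
  (forall i j, F i j + F j i = G i j + G j i) ->
  \sum_i \sum_j F i j = \sum_i \sum_j G i j.
Proof.
move=> FG; have E (H : 'I_n -> 'I_n -> R) : (\sum_i \sum_j H i j) *+ 2 =
    \sum_i \sum_j (H i j + H j i).
  rewrite mulr2n {2}sum_swap -big_split/=; apply: eq_bigr => i _.
  by rewrite -big_split.
have : (\sum_i \sum_j F i j) *+ 2 = (\sum_i \sum_j G i j) *+ 2.
  by rewrite !E; apply: eq_bigr => i _; apply: eq_bigr => j _.
by move/eqP; rewrite eqrMn2r => /eqP.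
Qed.

(** A symmetric [p] sees only the symmetric parts of [D] and [E]: the double sums agree although the
    individual terms may differ. *)
Lemma Rint_sym_eq n (p D E : 'I_n -> 'I_n -> 'rV[R]_n -> R) :
  (forall i j x, p i j x = p j i x) ->
  (forall i j, intg (lebesgue_rV R n) (fun x => p i j x * D i j x)) ->
  (forall i j, intg (lebesgue_rV R n) (fun x => p i j x * E i j x)) ->
  (forall i j x, D i j x + D j i x = E i j x + E j i x) ->
  \sum_i \sum_j \int[lebesgue_rV R n]_x (p i j x * D i j x) =
  \sum_i \sum_j \int[lebesgue_rV R n]_x (p i j x * E i j x).
Proof.
move=> ps iD iE DE; apply: sum_sym_eq => i j.
rewrite -(RintD (iD i j) (iD j i)) -(RintD (iE i j) (iE j i)).
by apply: eq_Rintegral => x _; rewrite (ps j i) -!mulrDr DE.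
Qed.

Lemma prod_sub3 (a b c d e : R) :
  (a - b) * (c - d) * e = (a * c * e + b * d * e) - (b * c * e + a * d * e).
Proof. by ring. Qed.

Lemma prod_add3 (a b c d e : R) : (a + b) * c * d = c * d * b + d * c * a.
Proof. by ring. Qed.

Lemma quad_expand n (p q r r' o o' : 'I_n -> 'I_n -> 'rV[R]_n -> R) :
  let leb := lebesgue_rV R n in
  (forall i j, intg leb (p i j)) -> (forall i j, intg leb (q i j)) ->
  (forall i j, intg leb (r i j)) -> (forall i j, intg leb (r' i j)) ->
  (forall i j x, o i j x = (p i j x + q i j x) - (r i j x + r' i j x)) ->
  (forall i j x, o' i j x = r j i x + r' i j x) ->
  \sum_i \sum_j \int[leb]_x o i j x =
  (\sum_i \sum_j \int[leb]_x p i j x) + (\sum_i \sum_j \int[leb]_x q i j x) -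
  \sum_i \sum_j \int[leb]_x o' i j x.
Proof.
move=> leb ip iq ir ir' oE o'E.
have -> : \sum_i \sum_j \int[leb]_x o' i j x =
    (\sum_i \sum_j \int[leb]_x r i j x) + \sum_i \sum_j \int[leb]_x r' i j x.
  rewrite [X in _ = X + _]sum_swap -big_split/=; apply: eq_bigr => i _.
  rewrite -big_split/=; apply: eq_bigr => j _; rewrite -RintD//.
  exact: eq_Rintegral.
rewrite -!big_split -sumrB/=; apply: eq_bigr => i _.
rewrite -!big_split -sumrB/=; apply: eq_bigr => j _.
rewrite -RintD// -RintD// -RintB; [|exact: intgD|exact: intgD].
exact: eq_Rintegral.
Qed.

Lemma opp_double0 (c : R) : c = - c + - c -> - c = 0.
Proof. by lra. Qed.

End slice_arithmetic.

(** * Estimates at a fixed time *)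

Section slice.
Context (R : realType) (n : nat).
Local Notation Rn := 'rV[R]_n.
Local Notation leb := (lebesgue_rV R n).
Local Notation L2 := (L2 leb).
Local Notation N2 := (N2 leb).
Local Notation intg := (intg leb).
Implicit Types (f g : Rn -> R) (x y z : Rn) (i j : 'I_n).
Implicit Types (u v w : 'I_n -> Rn -> R).

Context (Pf : R -> R) (N : nat) (N0 : (0 < N)%N).
Hypothesis young : forall delta x y : R, 0 < delta -> 0 <= x -> 0 <= y ->
  x ^+ 2 * y <= delta * Pf x + (y / delta) ^+ N * y.
Context (a s : Rn -> R) (m : R) (U : 'I_n -> Rn -> R) (S : 'I_n -> 'I_n -> Rn -> R).
Hypothesis m0 : 0 < m.
Hypothesis ma : measurable_fun setT a.
Hypothesis a0 : forall x, 0 <= a x.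
Hypothesis a2 : L2 a.
Hypothesis iPa : intg (fun x => Pf (a x)).
Hypothesis Pfa : forall x, 0 <= Pf (a x).
Hypothesis s0 : forall x, 0 <= s x.
Hypothesis is_ : forall k, intg (fun x => s x ^+ k.+1).
Hypothesis mS : forall i j, measurable_fun setT (S i j).
Hypothesis Ss : forall i j x, `|S i j x| <= m * s x.
Hypothesis US : sym_grad U S.

Definition field_le v := solenoidal v /\
  forall i, measurable_fun setT (v i) /\ forall x, `|v i x| <= a x.

Hypothesis HU : field_le U.

Lemma field_le_L2 v : field_le v -> forall i, L2 (v i).
Proof.
move=> [_ H] i; have [mv va] := H i; apply: (L2_le mv a2) => x.
by rewrite (le_trans (va x))// ler_norm.
Qed.

Let ims k : intg (fun x => (m * s x) ^+ k.+1).
Proof. by under eq_fun do rewrite exprMn; exact: intgZ. Qed.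

Let ms0 x : 0 <= m * s x. Proof. by rewrite mulr_ge0// ltW. Qed.

(** With the strain normalised, the powers coming from Young's inequality fall on [s] and the bounds
    stay linear in [m]. *)
Let Sm i j x := m^-1 * S i j x.

Let mSm i j : measurable_fun setT (Sm i j).
Proof. exact: measurable_funM. Qed.

Let Sms i j x : `|Sm i j x| <= s x.
Proof. by rewrite normrM gtr0_norm ?invr_gt0// ler_pdivrMl. Qed.

Let LS i j : L2 (S i j).
Proof. exact: (pairing_L2 ms0 ims (mS i j) (Ss i j)). Qed.

Let LSm i j : L2 (Sm i j). Proof. exact: L2Z. Qed.

Let SE i j : S i j = (fun x => m * Sm i j x).
Proof. by apply/funext => x; rewrite mulrA divff ?gt_eqF// mul1r. Qed.

Let K l := moll_bkernel (mollifier_moll R n l).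

Let LK l f : L2 f -> L2 (convol (moll l) f).
Proof. by move=> Lf; apply: L2_conv. Qed.

Definition quadS v := \sum_i \sum_j \int[leb]_x (v i x * v j x * S i j x).

(** [formA] is the flux of [v] against the mollified [U], and [formB] the flux of [U] against the
    mollified [v]: for [v = u], the two contributions to the evolution of the mollified product of
    [u] and [U]. *)
Definition formA l v := \sum_i \sum_j \int[leb]_x (v i x * v j x * dmol2 (moll l) U i j x).

Definition formB l v := \sum_i \sum_j \int[leb]_x (U i x * U j x * dmol2 (moll l) v i j x).

Definition crossS v := \sum_i \sum_j \int[leb]_x ((S i j x + S j i x) * U j x * v i x).

Lemma dmol2_bounded l v i j : (forall i, L2 (v i)) -> measurable_fun setT (dmol2 (moll l) v i j) /\
  exists c : R, forall x, `|dmol2 (moll l) v i j x| <= c.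
Proof.
move=> Lv; have bd := bkernel_dkernel (mollifier_moll R n l) j.
split; first by apply: measurable_conv => //; case: (LK l (Lv i)).
by eexists => x; apply: conv_bound => //; exact: LK.
Qed.

Let prod_le v i j x : field_le v -> `|v i x * v j x| <= a x ^+ 2.
Proof. by move=> [_ H]; rewrite normrM expr2 ler_pM//; apply: (H _).2. Qed.

Let mprod v i j : field_le v -> measurable_fun setT (fun x => v i x * v j x).
Proof. by move=> [_ H]; apply: measurable_funM; apply: (H _).1. Qed.

Section one_field.
Context v (Hv : field_le v).

Let Lv := field_le_L2 Hv.
Let LU := field_le_L2 HU.
Let sv : solenoidal v. Proof. by case: Hv. Qed.
Let sU : solenoidal U. Proof. by case: HU. Qed.

Lemma quad_moll_intg l i j :
  intg (fun x => v i x * v j x * convol (moll l) (convol (moll l) (S i j)) x).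
Proof.
exact: (pairing_moll_intg young a0 iPa ms0 ims (mprod i j Hv) (mS i j)
  (fun x => prod_le i j x Hv) (Ss i j)).
Qed.

Lemma formAE l : formA l v =
  \sum_i \sum_j \int[leb]_x (v i x * v j x * convol (moll l) (convol (moll l) (S i j)) x).
Proof.
apply: Rint_sym_eq.
- by move=> i j x; rewrite mulrC.
- by move=> i j; have [mD [c cD]] := dmol2_bounded l i j LU; exact: intg3 (Lv i) (Lv j) mD cD.
- by move=> i j; exact: quad_moll_intg.
- by move=> i j x; exact (sym_dmol2 (mollifier_moll R n l) LU i j x LS US).
Qed.

Lemma cvg_formA : (fun l => formA l v) @ \oo --> quadS v.
Proof.
under eq_fun do rewrite formAE.
apply: cvgn_sum => i; apply: cvgn_sum => j.
exact: (cvg_pairing N0 young ma a0 a2 iPa Pfa ms0 ims (mprod i j Hv) (mS i j)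
  (fun x => prod_le i j x Hv) (Ss i j)).
Qed.

(** The bound is uniform in [l], so a multiple of [m] can dominate in time when the mollification is
    removed. *)
Lemma formA_le l : `|formA l v| <=
  m * ((\int[leb]_x Pf (a x) + \int[leb]_x (s x ^+ N.+1)) *+ n *+ n).
Proof.
rewrite formAE.
have H i j : `|\int[leb]_x (v i x * v j x * convol (moll l) (convol (moll l) (S i j)) x)| <=
   m * (\int[leb]_x Pf (a x) + \int[leb]_x (s x ^+ N.+1)).
  rewrite (_ : \int[leb]_x _ = m *
    \int[leb]_x (v i x * v j x * convol (moll l) (convol (moll l) (Sm i j)) x)).
    rewrite normrM gtr0_norm// ler_pM2l//.
    exact: (pairing_moll_le young a0 iPa s0 is_ (mprod i j Hv) (mSm i j)
      (fun x => prod_le i j x Hv) (Sms i j)).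
  rewrite -RintZ; last first.
    exact: (pairing_moll_intg young a0 iPa s0 is_ (mprod i j Hv) (mSm i j)
      (fun x => prod_le i j x Hv) (Sms i j)).
  apply: eq_Rintegral => x _; rewrite mulrCA; congr (_ * _).
  have -> : convol (moll l) (S i j) = (fun x => m * convol (moll l) (Sm i j) x).
    by apply/funext => z; rewrite SE (convZ _ _ (K l) (LSm i j)).
  by rewrite (convZ _ _ (K l) (LK l (LSm i j))).
apply: (le_trans (ler_norm_sum _ _ _)).
rewrite !mulrnAr -[X in _ <= _ *+ X](card_ord n) -sumr_const.
apply: ler_sum => i _; apply: (le_trans (ler_norm_sum _ _ _)).
rewrite -[X in _ <= _ *+ X](card_ord n) -sumr_const.
by apply: ler_sum => j _; exact: H.
Qed.

(** Young's inequality with [delta = 1] and [y = s^2], whence the exponent [2 N + 2]. As strain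
    times [U] is in L^2, the limit of [formB] needs no truncation. *)
Lemma SU_L2 i j l : L2 (fun x => Sm i j x * U l x) /\
  N2 (fun x => Sm i j x * U l x) <= \int[leb]_x Pf (a x) + \int[leb]_x (s x ^+ N.*2.+2).
Proof.
have [mU Ua] := HU.2 l.
have mF : measurable_fun setT (fun x => Sm i j x * U l x) by exact: measurable_funM.
have iG : intg (fun x => Pf (a x) + s x ^+ N.*2.+2) by exact: intgD.
have pt x : (Sm i j x * U l x) ^+ 2 <= Pf (a x) + s x ^+ N.*2.+2.
  rewrite exprMn mulrC.
  have := young ltr01 (a0 x) (sqr_ge0 (s x)); rewrite divr1 mul1r -exprM -exprD.
  rewrite (_ : (2 * N + 2)%N = N.*2.+2); last by rewrite addn2 mul2n.
  apply: le_trans; apply: ler_pM; rewrite ?sqr_ge0//.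
    by rewrite -real_normK ?num_real// lerXn2r ?nnegrE.
  by rewrite -real_normK ?num_real// lerXn2r ?nnegrE.
have L : L2 (fun x => Sm i j x * U l x).
  split => //; apply: (intg_le _ _ iG); first exact: measurable_funX.
  by move=> x; rewrite ger0_norm ?sqr_ge0.
split=> //; rewrite -RintD//; apply: Rint_le => //; by case: L.
Qed.

Let SUU i j x := (Sm i j x + Sm j i x) * U j x.

Let LSUU i j : L2 (SUU i j).
Proof.
rewrite /SUU; under eq_fun do rewrite mulrDl.
by apply: L2D; [exact: (SU_L2 i j j).1|exact: (SU_L2 j i j).1].
Qed.

Let SUUE i j x : (S i j x + S j i x) * U j x = m * SUU i j x.
Proof. by rewrite (SE i j) (SE j i) /SUU -mulrDr mulrA. Qed.

(** The derivatives of the mollified [v] need not converge; the transport identity exchanges them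
    for the strain of [U]. *)
Lemma formBE l : formB l v = - (m * \sum_i \sum_j \int[leb]_x (SUU i j x * mol2 (moll l) v i x)).
Proof.
rewrite /formB (transport_identity (mollifier_moll R n l) LU sU LS US Lv sv).
congr (- _); rewrite mulr_sumr; apply: eq_bigr => i _; rewrite mulr_sumr; apply: eq_bigr => j _.
rewrite -RintZ; last by apply: L2M => //; do 2 apply: LK => //.
by apply: eq_Rintegral => x _; rewrite SUUE -mulrA.
Qed.

Lemma crossSE : crossS v = m * \sum_i \sum_j \int[leb]_x (SUU i j x * v i x).
Proof.
rewrite mulr_sumr; apply: eq_bigr => i _; rewrite mulr_sumr; apply: eq_bigr => j _.
rewrite -RintZ; last exact: L2M.
by apply: eq_Rintegral => x _; rewrite SUUE -mulrA.
Qed.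

Lemma cvg_formB : (fun l => formB l v) @ \oo --> - crossS v.
Proof.
under eq_fun do rewrite formBE.
rewrite crossSE; apply: cvgN; apply: cvgM; first exact: cvg_cst.
apply: cvgn_sum => i; apply: cvgn_sum => j.
apply: (@cvgn_squeeze _ _ (fun l => Num.sqrt (N2 (SUU i j)) *
  Num.sqrt (N2 (fun x => convol (moll l) (convol (moll l) (v i)) x - v i x)))); last first.
  rewrite -[X in _ --> X](mulr0 (Num.sqrt (N2 (SUU i j)))) -[X in _ * X](sqrtr0 R).
  apply: cvgM; first exact: cvg_cst.
  by apply: (cvg_comp _ _ (cvg_moll2 (Lv i))); exact: sqrt_continuous.
move=> l; have LKK : L2 (mol2 (moll l) v i) by do 2 apply: LK => //.
rewrite -RintB; [|exact: L2M|exact: L2M].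
rewrite (_ : \int[leb]_x _ = \int[leb]_x (SUU i j x * (mol2 (moll l) v i x - v i x))).
  by apply: cauchy_schwarz_abs => //; exact: L2B.
by apply: eq_Rintegral => x _; rewrite mulrBr.
Qed.

Lemma formB_le l : `|formB l v| <=
  m * ((4 * (\int[leb]_x Pf (a x) + \int[leb]_x (s x ^+ N.*2.+2)) + N2 a) *+ n *+ n).
Proof.
rewrite formBE normrN normrM gtr0_norm// ler_pM2l//.
have H i j : `|\int[leb]_x (SUU i j x * mol2 (moll l) v i x)| <=
   4 * (\int[leb]_x Pf (a x) + \int[leb]_x (s x ^+ N.*2.+2)) + N2 a.
  have LKK : L2 (mol2 (moll l) v i) by do 2 apply: LK => //.
  apply: (@le_trans _ _ (\int[leb]_x (SUU i j x ^+ 2 + mol2 (moll l) v i x ^+ 2))).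
    apply: Rint_abs_le.
    - by apply: measurable_funM; [case: (LSUU i j)|case: LKK].
    - by apply: intgD; [case: (LSUU i j)|case: LKK].
    - move=> x; exact: prod_le_sqr.
  rewrite RintD; [|by case: (LSUU i j)|by case: LKK].
  apply: lerD.
    apply: (@le_trans _ _ (2 * N2 (fun x => Sm i j x * U j x) + 2 * N2 (fun x => Sm j i x * U j x))).
      rewrite [X in X <= _](_ : _ = N2 (fun x => Sm i j x * U j x + Sm j i x * U j x)); last first.
        by apply: eq_Rintegral => x _; rewrite /SUU mulrDl.
      by apply: N2D_le; [exact: (SU_L2 i j j).1|exact: (SU_L2 j i j).1].
    apply: four_le; [exact: (SU_L2 i j j).2|exact: (SU_L2 j i j).2].
  apply: (@le_trans _ _ (N2 (v i))).
    apply: (le_trans (N2_moll (mollifier_moll R n l) (LK l (Lv i)))).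
    exact: N2_moll (mollifier_moll R n l) _ (Lv i).
  apply: N2_le => //; first by case: (Lv i).
  by move=> x; rewrite (le_trans ((Hv.2 i).2 x))// ler_norm.
apply: (le_trans (ler_norm_sum _ _ _)).
rewrite -[X in _ <= _ *+ X](card_ord n) -sumr_const.
apply: ler_sum => i _; apply: (le_trans (ler_norm_sum _ _ _)).
rewrite -[X in _ <= _ *+ X](card_ord n) -sumr_const.
by apply: ler_sum => j _; exact: H.
Qed.

End one_field.

Lemma quadS_intg v i j : field_le v -> intg (fun x => v i x * v j x * S i j x).
Proof.
move=> Hv; exact: (pairing_intg young a0 iPa ms0 ims (mprod i j Hv) (mS i j)
  (fun x => prod_le i j x Hv) (Ss i j)).
Qed.

(** For [v = U] the two forms are the same sequence, with limits [quadS U] and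
    [- crossS U = - 2 quadS U]. *)
Lemma quadSU0 : quadS U = 0.
Proof.
have c1 := cvg_formA HU; have c2 := cvg_formB HU.
have E : quadS U = - crossS U.
  exact: (cvgn_unique c1 c2).
have : crossS U = quadS U + quadS U.
  rewrite /crossS /quadS [X in _ = _ + X]exchange_big/= -big_split/=; apply: eq_bigr => i _.
  rewrite -big_split/=; apply: eq_bigr => j _; rewrite -RintD.
  - by apply: eq_Rintegral => x _; rewrite mulrAC -mulrA mulrC mulrDr mulrC (mulrC (U j x)).
  - exact: quadS_intg.
  - exact: quadS_intg.
by rewrite E; move: (crossS U) => c; exact: opp_double0.
Qed.

(** The mixed terms of the expansion are exactly [crossS v], and [quadS U = 0] can be added for
    free. *)
Lemma quadS_sub v : field_le v ->
  (forall i j, intg (fun x => (v i x - U i x) * (v j x - U j x) * S i j x)) /\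
  quadS (fun i x => v i x - U i x) = quadS v - crossS v.
Proof.
move=> Hv.
have Hcr i j : intg (fun x => U i x * v j x * S i j x).
  have mp : measurable_fun setT (fun x => U i x * v j x).
    by apply: measurable_funM; [exact: (HU.2 i).1|exact: (Hv.2 j).1].
  apply: (pairing_intg young a0 iPa ms0 ims mp (mS i j) _ (Ss i j)) => x.
  by rewrite normrM expr2 ler_pM//; [exact: (HU.2 i).2|exact: (Hv.2 j).2].
have Hcr' i j : intg (fun x => v i x * U j x * S i j x).
  have mp : measurable_fun setT (fun x => v i x * U j x).
    by apply: measurable_funM; [exact: (Hv.2 i).1|exact: (HU.2 j).1].
  apply: (pairing_intg young a0 iPa ms0 ims mp (mS i j) _ (Ss i j)) => x.
  by rewrite normrM expr2 ler_pM//; [exact: (Hv.2 i).2|exact: (HU.2 j).2].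
have E i j x : (v i x - U i x) * (v j x - U j x) * S i j x =
    (v i x * v j x * S i j x + U i x * U j x * S i j x) -
    (U i x * v j x * S i j x + v i x * U j x * S i j x) by exact: prod_sub3.
split=> [i j|].
  under eq_fun do rewrite E.
  by apply: intgB; apply: intgD => //; exact: quadS_intg.
rewrite -[RHS]addr0 -quadSU0 addrAC; apply: quad_expand.
- by move=> i j; exact: quadS_intg.
- by move=> i j; exact: quadS_intg.
- exact: Hcr.
- exact: Hcr'.
- exact: E.
- by move=> i j x; exact: prod_add3.
Qed.

End slice.

(** * Evolution in time *)

Section time_calculus.
Context (R : realType).
Local Notation lam := (@lebesgue_measure R).
Implicit Types (s t r : R) (H : R -> R) (G : set R).

(** Cut [[0, t]] into [N + 1] intervals of length [h] and pick a point of [G] in each: consecutive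
    points are at most [2 h] apart. The total increment is of order [(N + 1) h^(3/2)], which tends
    to 0. *)
Lemma holder_const H G (T C : R) : G 0 -> 0 <= C ->
  (forall a b : R, 0 <= a -> a < b -> b <= T -> exists2 t, G t & a < t < b) ->
  (forall s t, G s -> G t -> 0 <= s <= t -> t <= T ->
     `|H t - H s| <= C * (t - s) * Num.sqrt (t - s)) ->
  forall t, G t -> 0 < t -> t <= T -> H t = H 0.
Proof.
move=> G0 C0 dG HC t Gt t0 tT.
have key (N : nat) : `|H t - H 0| <= 2 * C * t * Num.sqrt (2 * t / N.+1%:R).
  pose h := t / N.+1%:R; pose b := C * (2 * h) * Num.sqrt (2 * h).
  have N1 : 0 < N.+1%:R :> R by rewrite ltr0n.
  have h0 : 0 < h by rewrite divr_gt0.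
  have b0 : 0 <= b by rewrite !mulr_ge0 ?sqrtr_ge0// ltW.
  have hN : h * N.+1%:R = t by rewrite /h divfK// gt_eqF.
  have mono s s' : 0 <= s' - s -> s' - s <= 2 * h ->
      C * (s' - s) * Num.sqrt (s' - s) <= b.
    move=> ss0 ss; rewrite /b ler_pM ?sqrtr_ge0 ?mulr_ge0//; first by rewrite ler_wpM2l.
    by rewrite ler_sqrt// mulr_ge0// ltW.
  have [r [Gr rN Hr]] : exists r, [/\ G r, h * N%:R <= r <= h * N.+1%:R & `|H r - H 0| <= N%:R * b].
    suff : forall k, (k <= N)%N -> exists r,
        [/\ G r, h * k%:R <= r <= h * k.+1%:R & `|H r - H 0| <= k%:R * b].
      exact.
    elim=> [_|k IH kN].
      exists 0; split => //; first by rewrite mulr0 lexx mulr1 ltW.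
      by rewrite subrr normr0 mul0r.
    have [r [Gr /andP[kr rk] Hr]] := IH (ltnW kN).
    have [|||r' Gr' /andP[kr' rk']] := dG (h * k.+1%:R) (h * k.+2%:R).
    - by rewrite mulr_ge0// ltW.
    - by rewrite ltr_pM2l// ltr_nat.
    - by rewrite (le_trans _ tT)// -hN ler_pM2l// ler_nat ltnS.
    exists r'; split => //; first by rewrite !ltW.
    rewrite (_ : H r' - H 0 = (H r' - H r) + (H r - H 0)); last by rewrite addrA subrK.
    rewrite (le_trans (ler_normD _ _))// -[k.+1]add1n natrD mulrDl mul1r lerD//.
    have r0 : 0 <= r by rewrite (le_trans _ kr)// mulr_ge0// ltW.
    apply: (le_trans (HC r r' Gr Gr' _ _)).
    - by rewrite r0/= (le_trans rk)// ltW.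
    - by rewrite (le_trans (ltW rk'))// (le_trans _ tT)// -hN ler_pM2l// ler_nat ltnS.
    - apply: mono; first by rewrite subr_ge0 (le_trans rk)// ltW.
      move: kr rk'; rewrite -(addn2 k) natrD mulrDr.
      by move: (h * k%:R) => z ? ?; lra.
  rewrite (_ : H t - H 0 = (H t - H r) + (H r - H 0)); last by rewrite addrA subrK.
  have/andP [kr rk] := rN.
  have r0 : 0 <= r by rewrite (le_trans _ kr)// mulr_ge0// ltW.
  apply: (@le_trans _ _ (N.+1%:R * b)).
    rewrite (le_trans (ler_normD _ _))// -[N.+1]add1n natrD mulrDl mul1r lerD//.
    apply: (le_trans (HC r t Gr Gt _ tT)); first by rewrite r0/= -hN.
    apply: mono; first by rewrite subr_ge0 -hN.
    move: kr hN; rewrite -(addn1 N) natrD mulrDr mulr1.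
    by move: (h * N%:R) => z ? ?; lra.
  rewrite /b le_eqVlt; apply/orP; left; apply/eqP.
  have -> : 2 * t / N.+1%:R = 2 * h by rewrite /h mulrA.
  by rewrite mulrA; congr (_ * _); rewrite -hN; ring.
have c : (fun N : nat => 2 * C * t * Num.sqrt (2 * t / N.+1%:R)) @ \oo --> (0 : R).
  rewrite -[X in _ --> X](mulr0 (2 * C * t)) -(sqrtr0 R).
  apply: cvgM; first exact: cvg_cst.
  have c : (fun N : nat => 2 * t / N.+1%:R) @ \oo --> (0 : R); last first.
    by apply: (cvg_comp _ _ c); exact: sqrt_continuous.
  rewrite -[X in _ --> X](mulr0 (2 * t)); apply: cvgM; first exact: cvg_cst.
  exact: cvg_harmonic.
apply: (@cvgn_unique _ (fun=> H t)); first exact: cvg_cst.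
exact: (cvgn_squeeze key c).
Qed.

(** Integrals over [[0, t]] are written on the whole line with this factor, so that an increment in
    [t] is the integral against a difference of factors. *)
Definition upto t r : R := \1_(`[0, t]) r.

Lemma measurable_upto t : measurable_fun setT (upto t).
Proof. exact: measurable_indic. Qed.

Lemma upto01 t r : 0 <= upto t r <= 1.
Proof. by rewrite /upto indicE; case: (_ \in _); rewrite ?lexx ?ler01. Qed.

Lemma intg_upto t : intg lam (upto t).
Proof.
apply: ge0_intg; first exact: measurable_upto.
  by move=> r; case/andP: (upto01 t r).
rewrite integral_indic//= setIT lebesgue_measure_itv/=.
by case: ifP => _; rewrite ?ltry// -EFinD ltry.
Qed.

Lemma Rint_upto t : 0 <= t -> \int[lam]_r upto t r = t.
Proof.
move=> t0; rewrite /Rintegral integral_indic//= setIT lebesgue_measure_itv/= lte_fin.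
by move: t0; rewrite le_eqVlt => /predU1P[<-|->]; rewrite ?ltxx//= subr0.
Qed.

Lemma intgM_upto t (f : R -> R) (c : R) : measurable_fun setT f -> (forall r, `|f r| <= c) ->
  intg lam (fun r => f r * upto t r).
Proof.
move=> mf fc; have := @intg_le _ _ R lam (fun r => f r * upto t r) (fun r => c * upto t r). apply.
- by apply: measurable_funM => //; exact: measurable_upto.
- by move=> r; have /andP[? _] := upto01 t r; rewrite normrM (ger0_norm (x := upto t r))// ler_wpM2r.
- by apply: intgZ; exact: intg_upto.
Qed.

Lemma le_upto s t r : s <= t -> upto s r <= upto t r.
Proof.
move=> st; rewrite /upto !indicE; case: (boolP (r \in `[0, s]%classic)) => [|_]; last by case: (_ \in _).
rewrite !inE/= !in_itv/= => /andP[r0 rs].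
by rewrite mem_set//= in_itv/= r0 (le_trans rs st).
Qed.

Lemma upto_sub s t r : s <= t -> upto t r - upto s r != 0 -> s <= r <= t.
Proof.
move=> st; rewrite /upto !indicE.
have [|] := boolP (r \in `[0, s]%classic); have [|] := boolP (r \in `[0, t]%classic).
- by rewrite subrr eqxx.
- rewrite !notin_setE !inE/= !in_itv/= => /negP rt /andP[r0 rs].
  by case/negP: rt; rewrite r0 (le_trans rs st).
- rewrite !notin_setE !inE/= !in_itv/= => /andP[r0 rt] /negP.
  by rewrite r0/= -ltNge => /ltW ->; rewrite rt.
- by rewrite subrr eqxx.
Qed.

Lemma Rint_upto_itv (f : R -> R) (t : R) :
  \int[lam]_r (f r * upto t r) = \int[lam]_(r in `[0, t]) f r.
Proof.
rewrite [RHS]Rintegral_mkcond; apply: eq_Rintegral => r _.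
by rewrite /patch /upto indicE; case: (r \in _); rewrite ?mulr1 ?mulr0.
Qed.

Lemma Rint_upto0 (f : R -> R) : \int[lam]_r (f r * upto 0 r) = 0.
Proof. by rewrite Rint_upto_itv set_itv1 Rintegral_set1. Qed.

Section product_rule.
Context (F A B : R -> R -> R) (G : set R) (T C c : R).
Hypotheses (G0 : G 0) (C0 : 0 <= C).
Hypothesis dG : forall a b : R, 0 <= a -> a < b -> b <= T -> exists2 t, G t & a < t < b.
Hypothesis FA : forall s t, G s -> G t -> F s t - F 0 t = \int[lam]_r (A r t * upto s r).
Hypothesis FB : forall s t, G s -> G t -> F t s - F t 0 = \int[lam]_r (B r t * upto s r).
Hypothesis mA : forall t, measurable_fun setT (A^~ t).
Hypothesis mB : forall t, measurable_fun setT (B^~ t).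
Hypothesis mAd : measurable_fun setT (fun r => A r r).
Hypothesis mBd : measurable_fun setT (fun r => B r r).
Hypothesis Ac : forall r t, `|A r t| <= c.
Hypothesis Bc : forall r t, `|B r t| <= c.
Hypothesis A_holder : forall r t, G t -> `|A r t - A r r| <= C * Num.sqrt `|t - r|.
Hypothesis B_holder : forall r t, G t -> `|B r t - B r r| <= C * Num.sqrt `|t - r|.

(* The increments of [F t t - \int_0^t (A r r + B r r)] over an interval of length [h]
   are [O(h^(3/2))] on a dense set, so this function is constant there. *)
Lemma product_rule t : G t -> 0 <= t <= T ->
  F t t = F 0 0 + \int[lam]_r ((A r r + B r r) * upto t r).
Proof.
move=> Gt /andP[t0 tT].
pose D r := A r r + B r r.
have mD : measurable_fun setT D by exact: measurable_funD.
have Dc r : `|D r| <= c + c by rewrite (le_trans (ler_normD _ _))// lerD.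
pose H t := F t t - \int[lam]_r (D r * upto t r).
have H0 : H 0 = F 0 0 by rewrite /H Rint_upto0 subr0.
suff : H t = H 0 by rewrite H0 /H => <-; rewrite subrK.
move: t0; rewrite le_eqVlt => /predU1P[<-//|t0].
apply: (holder_const G0 (C := 2 * C) _ dG _ Gt t0 tT); first exact: mulr_ge0.
move=> s {t0 tT Gt}t Gs Gt /andP[s0 st] tT.
pose X r := upto t r - upto s r.
have iX : intg lam X by apply: intgB; exact: intg_upto.
have RX : \int[lam]_r X r = t - s.
  by rewrite RintB ?Rint_upto//; [exact: le_trans st|exact: intg_upto|exact: intg_upto].
have X0 r : 0 <= X r by rewrite subr_ge0 le_upto.
have iAt (f : R -> R) : (forall r, `|f r| <= c) -> measurable_fun setT f ->
    \int[lam]_r (f r * upto t r) - \int[lam]_r (f r * upto s r) = \int[lam]_r (f r * X r).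
  move=> fc mf; rewrite -RintB; [|exact: intgM_upto fc|exact: intgM_upto fc].
  by apply: eq_Rintegral => r _; rewrite -mulrBr.
have iX' (f : R -> R) (c' : R) : (forall r, `|f r| <= c') -> measurable_fun setT f ->
    intg lam (fun r => f r * X r).
  move=> fc mf; under eq_fun do rewrite mulrBr.
  by apply: intgB; exact: intgM_upto fc.
(* The diagonal increment is split into two increments of one argument each; the other argument is
   frozen at a point of [G], where the equation applies. *)
have E1 : F t t - F s t = \int[lam]_r (A r t * X r).
  by rewrite -iAt// -(FA Gt Gt) -(FA Gs Gt) opprB addrA subrK.
have E2 : F s t - F s s = \int[lam]_r (B r s * X r).
  by rewrite -iAt// -(FB Gt Gs) -(FB Gs Gs) opprB addrA subrK.
have E3 : \int[lam]_r (D r * upto t r) - \int[lam]_r (D r * upto s r) = \int[lam]_r (D r * X r).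
  rewrite -RintB; [|exact: intgM_upto Dc|exact: intgM_upto Dc].
  by apply: eq_Rintegral => r _; rewrite -mulrBr.
have -> : H t - H s = \int[lam]_r (((A r t - A r r) + (B r s - B r r)) * X r).
  transitivity (\int[lam]_r (A r t * X r) + \int[lam]_r (B r s * X r) - \int[lam]_r (D r * X r)).
    rewrite -E1 -E2 -E3 /H.
    move: (\int[lam]_r _) (\int[lam]_r _) (F t t) (F s t) (F s s) => x1 x2 x3 x4 x5.
    by rewrite !opprB [x4 - x5]addrC; ring.
  rewrite -RintD; [|exact: iX' (Ac^~ t) _|exact: iX' (Bc^~ s) _].
  rewrite -RintB; [|apply: intgD; [exact: iX' (Ac^~ t) _|exact: iX' (Bc^~ s) _]|exact: iX' Dc _].
  by apply: eq_Rintegral => r _; rewrite /D; ring.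
apply: (@le_trans _ _ (\int[lam]_r (2 * C * Num.sqrt (t - s) * X r))).
  apply: Rint_abs_le.
  - apply: measurable_funM; last exact: intg_measurable iX.
    apply: measurable_funD; first exact (measurable_funB (mA t) mAd).
    exact (measurable_funB (mB s) mBd).
  - exact: intgZ.
  move=> r; rewrite normrM (ger0_norm (X0 r)).
  have [->|/upto_sub] := eqVneq (X r) 0; first by rewrite !mulr0.
  move=> /(_ st)/andP[sr rt]; rewrite ler_wpM2r//.
  rewrite (le_trans (ler_normD _ _))// -mulrA mulr_natl mulr2n.
  apply: lerD.
    apply: (le_trans (A_holder _ Gt)); rewrite ler_wpM2l// ler_sqrt ?subr_ge0//.
    by rewrite ger0_norm ?subr_ge0//; lra.
  apply: (le_trans (B_holder _ Gs)); rewrite ler_wpM2l// ler_sqrt ?subr_ge0//.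
  by rewrite distrC ger0_norm ?subr_ge0//; lra.
rewrite RintZ// RX; lra.
Qed.

End product_rule.

End time_calculus.

Section joint_measurability.
Context (R : realType) (n : nat).
Local Notation Rn := 'rV[R]_n.
Local Notation leb := (lebesgue_rV R n).
Local Notation RX := (measurableTypeR R * Rn)%type.
Implicit Types (f g : R -> Rn -> R) (x y : Rn).

Definition jmeas f := measurable_fun setT (fun z : RX => f z.1 z.2).

Lemma jmeasM f g : jmeas f -> jmeas g -> jmeas (fun r x => f r x * g r x).
Proof. by move=> mf mg; exact: measurable_funM. Qed.

Lemma jmeasB f g : jmeas f -> jmeas g -> jmeas (fun r x => f r x - g r x).
Proof. by move=> mf mg; exact: measurable_funB. Qed.

Lemma jmeas_space (f : Rn -> R) : measurable_fun setT f -> jmeas (fun=> f).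
Proof. by move=> mf; exact: (measurableT_comp mf measurable_snd). Qed.

Lemma jmeas_slice f r : jmeas f -> measurable_fun setT (f r).
Proof. by move=> mf; exact: (measurable_section r mf). Qed.

Lemma jmeas_Rint f : jmeas f -> measurable_fun setT (fun r : measurableTypeR R => \int[leb]_x f r x).
Proof. by move=> mf; exact: (measurable_Rint_param leb mf). Qed.

Lemma jmeas_conv k f : measurable_fun setT k -> jmeas f -> jmeas (fun r => convol k (f r)).
Proof.
move=> mk mf; pose F (z : RX * Rn) := k (z.1.2 - z.2) * f z.1.1 z.2.
apply: (measurable_Rint_param leb (F := F)); apply: measurable_funM.
  have m12 : measurable_fun setT (fun z : RX * Rn => (z.1.2, z.2)).
    by apply: measurable_fun_pair => //; exact: (measurableT_comp measurable_snd measurable_fst).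
  exact: (measurableT_comp (measurable_sub2 mk) m12).
have m12 : measurable_fun setT (fun z : RX * Rn => (z.1.1, z.2)).
  by apply: measurable_fun_pair => //; exact: (measurableT_comp measurable_fst measurable_fst).
exact: (measurableT_comp mf m12).
Qed.

Lemma jmeas_dmol2 k r (H : mollifier k r) (f : R -> 'I_n -> Rn -> R) i j :
  jmeas (fun s => f s i) -> jmeas (fun s => dmol2 k (f s) i j).
Proof.
move=> mf; apply: jmeas_conv; first by case: (bkernel_dkernel H j).
by apply: jmeas_conv => //; case: (moll_bkernel H).
Qed.

End joint_measurability.

Section solenoidal_sub.
Context (R : realType) (n : nat).
Local Notation Rn := 'rV[R]_n.
Local Notation leb := (lebesgue_rV R n).

Lemma L2_derive_test (psi : Rn -> R) i : test_function psi -> L2 leb ('D_(basis_vector R i) psi).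
Proof.
move=> tpsi; have [r [c c0 [_ D]]] := test_function_ddiff tpsi.
apply: (L2_le (ddiff_meas' (D i)) (bkernel_L2 (bkernel_cindic n r c0))) => x.
by apply: (le_trans (ddiff_le' (D i) x)); exact: ler_norm.
Qed.

Lemma solenoidalB (u v : 'I_n -> Rn -> R) : (forall i, L2 leb (u i)) -> (forall i, L2 leb (v i)) ->
  solenoidal u -> solenoidal v -> solenoidal (fun i x => u i x - v i x).
Proof.
move=> Lu Lv su sv psi tpsi.
transitivity (\sum_i \int[leb]_x (u i x * 'D_(basis_vector R i) psi x) -
  \sum_i \int[leb]_x (v i x * 'D_(basis_vector R i) psi x)); last by rewrite su// sv// subrr.
rewrite -sumrB; apply: eq_bigr => i _; have LD := L2_derive_test i tpsi.
rewrite -RintB; [|exact: L2M|exact: L2M].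
by apply: eq_Rintegral => x _; rewrite mulrBl.
Qed.

End solenoidal_sub.

(** * Mollified fluxes and the energy identity *)

Section trilinear.
Context (R : realType) (n : nat).
Local Notation Rn := 'rV[R]_n.
Local Notation leb := (lebesgue_rV R n).
Local Notation L2 := (L2 leb).
Local Notation N2 := (N2 leb).
Local Notation intg := (intg leb).
Context (k : Rn -> R) (r0 : R) (H : mollifier k r0).
Implicit Types (u v w : 'I_n -> Rn -> R).

Definition tri u v := \sum_i \sum_j \int[leb]_x (u i x * u j x * dmol2 k v i j x).

Definition pair2 u v := \sum_i \int[leb]_x (u i x * mol2 k v i x).

Let bk : bkernel k. Proof. exact: moll_bkernel H. Qed.
Let bdk j : bkernel (dkernel k j). Proof. exact: bkernel_dkernel H j. Qed.

Let LK f : L2 f -> L2 (convol k f). Proof. by move=> Lf; apply: L2_conv. Qed.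

Definition dkernel_bound := \sum_j Num.sqrt (N2 (dkernel k j)).

Lemma dkernel_bound_ge0 : 0 <= dkernel_bound.
Proof. by apply: sumr_ge0 => j _; exact: sqrtr_ge0. Qed.

(** The bound is in terms of [K v] rather than [v], because the time increments of a flow are shown
    to be small only after mollification. *)
Lemma dmol2_le v i j x (b : R) : L2 (v i) -> Num.sqrt (N2 (convol k (v i))) <= b ->
  `|dmol2 k v i j x| <= dkernel_bound * b.
Proof.
move=> Lv vb; apply: (le_trans (conv_bound x (bdk j) (LK Lv))).
apply: ler_pM => //; rewrite ?sqrtr_ge0// /dkernel_bound (bigD1 j)//= lerDl.
by apply: sumr_ge0 => l _; exact: sqrtr_ge0.
Qed.

Lemma measurable_dmol2 v i j : L2 (v i) -> measurable_fun setT (dmol2 k v i j).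
Proof. by move=> Lv; apply: measurable_conv => //; case: (LK Lv). Qed.

Lemma tri_intg u v i j : (forall i, L2 (u i)) -> L2 (v i) ->
  intg (fun x => u i x * u j x * dmol2 k v i j x).
Proof.
move=> Lu Lv; apply: (intg3 (Lu i) (Lu j) (measurable_dmol2 j Lv)) => x.
exact: dmol2_le.
Qed.

Lemma measurable_tri (u v : R -> 'I_n -> Rn -> R) :
  (forall i, jmeas (fun r => u r i)) -> (forall i, jmeas (fun r => v r i)) ->
  measurable_fun setT (fun r : measurableTypeR R => tri (u r) (v r)).
Proof.
move=> mu mv; apply: measurable_sum => i; apply: measurable_sum => j.
apply: (jmeas_Rint (f := fun r x => u r i x * u r j x * dmol2 k (v r) i j x)).
apply: jmeasM; first by apply: jmeasM.
exact (jmeas_dmol2 H j (mv i)).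
Qed.

Lemma tri_le u v (E b : R) : (forall i, L2 (u i)) -> (forall i, N2 (u i) <= E) ->
  (forall i, L2 (v i)) -> (forall i, Num.sqrt (N2 (convol k (v i))) <= b) ->
  `|tri u v| <= dkernel_bound * ((E + E) *+ n *+ n) * b.
Proof.
move=> Lu uE Lv vb.
have H2 i j : `|\int[leb]_x (u i x * u j x * dmol2 k v i j x)| <= dkernel_bound * b * (E + E).
  apply: (@le_trans _ _ (\int[leb]_x (dkernel_bound * b * (u i x ^+ 2 + u j x ^+ 2)))).
    apply: Rint_abs_le.
    - exact: intg_measurable (tri_intg j Lu (Lv i)).
    - by apply: intgZ; apply: intgD; [case: (Lu i)|case: (Lu j)].
    - move=> x; rewrite normrM mulrC; apply: ler_pM => //; first exact: dmol2_le.
      exact: prod_le_sqr.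
  rewrite RintZ; last by apply: intgD; [case: (Lu i)|case: (Lu j)].
  rewrite RintD; [|by case: (Lu i)|by case: (Lu j)].
  apply: ler_wpM2l; last by apply: lerD; exact: uE.
  by rewrite mulr_ge0 ?dkernel_bound_ge0// (le_trans _ (vb i))// sqrtr_ge0.
apply: (le_trans (ler_norm_sum _ _ _)).
have -> : dkernel_bound * ((E + E) *+ n *+ n) * b = (dkernel_bound * b * (E + E)) *+ n *+ n.
  by rewrite mulrAC -!mulrnAr.
rewrite -[X in _ <= _ *+ X](card_ord n) -sumr_const.
apply: ler_sum => i _; apply: (le_trans (ler_norm_sum _ _ _)).
rewrite -[X in _ <= _ *+ X](card_ord n) -sumr_const.
by apply: ler_sum => j _; exact: H2.
Qed.

Lemma triB u v w : (forall i, L2 (u i)) -> (forall i, L2 (v i)) -> (forall i, L2 (w i)) ->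
  tri u (fun i x => v i x - w i x) = tri u v - tri u w.
Proof.
move=> Lu Lv Lw; rewrite /tri -sumrB; apply: eq_bigr => i _; rewrite -sumrB.
apply: eq_bigr => j _; rewrite -RintB; [|exact: tri_intg|exact: tri_intg].
apply: eq_Rintegral => x _; rewrite -mulrBr; congr (_ * _).
have E : convol k (fun x => v i x - w i x) = (fun x => convol k (v i) x - convol k (w i) x).
  by apply/funext => y; exact: convB.
by rewrite /dmol2 E; exact (convB x (bdk j) (LK (Lv i)) (LK (Lw i))).
Qed.

Lemma pair2_sym u v : (forall i, L2 (u i)) -> (forall i, L2 (v i)) -> pair2 u v = pair2 v u.
Proof.
move=> Lu Lv; apply: eq_bigr => i _.
rewrite -(moll_adjoint H (Lu i) (LK (Lv i))) -(moll_adjoint H (Lv i) (LK (Lu i))).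
by apply: eq_Rintegral => x _; rewrite mulrC.
Qed.

Lemma pair2Bl u v w : (forall i, L2 (u i)) -> (forall i, L2 (v i)) -> (forall i, L2 (w i)) ->
  pair2 (fun i x => u i x - v i x) w = pair2 u w - pair2 v w.
Proof.
move=> Lu Lv Lw; rewrite -sumrB; apply: eq_bigr => i _.
have LKw : L2 (mol2 k w i) by do 2 apply: LK.
rewrite -RintB; [|exact: L2M|exact: L2M].
by apply: eq_Rintegral => x _; rewrite mulrBl.
Qed.

(** Self-adjointness turns [pair2 k v v] into the sum of the squared norms of the components of
    [K v]. *)
Lemma N2_conv_le_pair2 v i : (forall i, L2 (v i)) -> N2 (convol k (v i)) <= pair2 v v.
Proof.
move=> Lv; have E j : \int[leb]_x (v j x * mol2 k v j x) = N2 (convol k (v j)).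
  by rewrite -(moll_adjoint H (Lv j) (LK (Lv j))).
rewrite /pair2 (bigD1 i)//= E lerDl; apply: sumr_ge0 => j _.
by rewrite E N2_ge0.
Qed.

Lemma sqrt_N2_conv_le v i (E : R) : L2 (v i) -> N2 (v i) <= E ->
  Num.sqrt (N2 (convol k (v i))) <= Num.sqrt E.
Proof.
by move=> Lv vE; rewrite ler_wsqrtr// (le_trans _ vE)//; exact: N2_moll H _ Lv.
Qed.

End trilinear.

Section energy_identity.
Context (R : realType) (n : nat).
Local Notation Rn := 'rV[R]_n.
Local Notation leb := (lebesgue_rV R n).
Local Notation lam := (@lebesgue_measure R).
Local Notation L2 := (L2 leb).
Local Notation N2 := (N2 leb).
Context (k : Rn -> R) (r0 : R) (H : mollifier k r0) (E : R) (G : set R) (T : R).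
Implicit Types (u U : R -> 'I_n -> Rn -> R).

(** Bounds hold at every time and the field is 0 off [G], which spares almost-everywhere
    qualifications in time. The equation is tested with twice mollified fields that do not depend on
    time, and only at end times in [G]. *)
Record euler_flow u : Prop := EulerFlow {
  flow_jmeas : forall i, jmeas (fun r => u r i) ;
  flow_L2 : forall r i, L2 (u r i) ;
  flow_N2 : forall r i, N2 (u r i) <= E ;
  flow_sol : forall r, solenoidal (u r) ;
  flow_out : forall r i x, ~ G r -> u r i x = 0 ;
  flow_eq : forall v, (forall i, L2 (v i)) -> solenoidal v -> forall s, G s ->
    pair2 k (u s) v - pair2 k (u 0) v = \int[lam]_r (tri k (u r) v * upto s r) }.

Let bE := Num.sqrt E.

Let ctri := dkernel_bound k * ((E + E) *+ n *+ n).

Lemma ctri_ge0 u : euler_flow u -> 0 <= ctri.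
Proof.
move=> Hu; rewrite mulr_ge0 ?dkernel_bound_ge0//.
(* The sign of [E] is read off a component, and in dimension 0 there is none. *)
have [n0|n0] := posnP n; first by rewrite n0 mulr0n.
have E0 := le_trans (N2_ge0 _ _) (flow_N2 Hu 0 (Ordinal n0)).
by do 2 apply: mulrn_wge0; exact: addr_ge0.
Qed.

Section two_flows.
Context u U (Hu : euler_flow u) (HU : euler_flow U).

Lemma tri_flow_le r s : `|tri k (u r) (U s)| <= ctri * bE.
Proof.
apply: (tri_le H (flow_L2 Hu r) (flow_N2 Hu r) (flow_L2 HU s)) => i.
apply: (sqrt_N2_conv_le H); [exact: (flow_L2 HU)|exact: (flow_N2 HU)].
Qed.

End two_flows.

Lemma upto_dist t s : 0 <= t -> 0 <= s -> intg lam (fun r => `|upto t r - upto s r|) /\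
  \int[lam]_r `|upto t r - upto s r| = `|t - s|.
Proof.
have key (a b : R) : 0 <= a -> a <= b -> intg lam (fun r => `|upto b r - upto a r|) /\
    \int[lam]_r `|upto b r - upto a r| = `|b - a|.
  move=> a0 ab; have ib := @intgB _ _ _ lam _ _ (intg_upto b) (intg_upto a).
  split; first exact: (@intg_norm _ _ _ lam _ ib).
  rewrite (ger0_norm (x := b - a)) ?subr_ge0//.
  rewrite -[in RHS](Rint_upto a0) -[in RHS](Rint_upto (le_trans a0 ab)).
  rewrite -[RHS](@RintB _ _ _ lam _ _ (intg_upto b) (intg_upto a)).
  by apply: eq_Rintegral => r _; rewrite ger0_norm// subr_ge0 le_upto.
move=> t0 s0; have [ts|/ltW st] := leP t s; last exact: key.
have [k1 k2] := key t s t0 ts; split.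
  by under eq_fun do rewrite distrC.
by rewrite distrC -k2; apply: eq_Rintegral => r _; rewrite distrC.
Qed.

Hypothesis G0 : G 0.
Hypothesis GT : forall t, G t -> 0 <= t <= T.

Let c2 := ctri * bE + ctri * bE.

Section one_flow.
Context u (Hu : euler_flow u).

Let Lu r i : L2 (u r i). Proof. exact: flow_L2 Hu r i. Qed.

(* The equation tested with [k * k * (u t - u s)] itself. *)
Lemma flow_holder t s i : G t -> G s ->
  Num.sqrt (N2 (convol k (fun x => u t i x - u s i x))) <= Num.sqrt c2 * Num.sqrt `|t - s|.
Proof.
move=> Gt Gs; pose z i x := u t i x - u s i x.
have Lz j : L2 (z j) by exact: L2B.
have sz : solenoidal z by apply: solenoidalB => //; exact: (flow_sol Hu).
have zc r : `|tri k (u r) z| <= c2.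
  rewrite /z (triB H (Lu r) (Lu t) (Lu s)) (le_trans (ler_normB _ _))//.
  by apply: lerD; exact: tri_flow_le.
have c20 : 0 <= c2 by exact: le_trans (zc 0).
have mz : measurable_fun setT (fun r => tri k (u r) z).
  apply: (measurable_tri H (v := fun=> z) (flow_jmeas Hu)) => j.
  by apply: jmeas_space; case: (Lz j).
rewrite -sqrtrM// ler_wsqrtr//.
apply: (le_trans (N2_conv_le_pair2 H i Lz)).
have /andP[t0 _] := GT Gt; have /andP[s0 _] := GT Gs.
have [iT rT] := upto_dist t0 s0.
have -> : pair2 k z z = \int[lam]_r (tri k (u r) z * (upto t r - upto s r)).
  rewrite {1}/z (pair2Bl H (Lu t) (Lu s) Lz).
  have := flow_eq Hu Lz sz Gt; have := flow_eq Hu Lz sz Gs.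
  set I1 := (X in _ = X -> _); set I2 := (X in _ -> _ = X -> _) => E1 E2.
  transitivity (I2 - I1).
    by rewrite -E1 -E2 opprB addrA subrK.
  rewrite /I1 /I2 -(@RintB _ _ _ lam); last 2 first.
  - exact: intgM_upto zc.
  - exact: intgM_upto zc.
  by apply: eq_Rintegral => r _; rewrite mulrBr.
rewrite -rT -(@RintZ _ _ _ lam)//.
apply: (le_trans (ler_norm _)); apply: (@Rint_abs_le _ _ _ lam).
- apply: measurable_funM => //.
  by apply: measurable_funB; exact: measurable_upto.
- exact: (@intgZ _ _ _ lam).
- by move=> r; rewrite normrM ler_wpM2r.
Qed.

End one_flow.

Hypothesis dG : forall a b : R, 0 <= a -> a < b -> b <= T -> exists2 t, G t & a < t < b.

Lemma moll_energy u U t : euler_flow u -> euler_flow U -> G t ->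
  pair2 k (u t) (U t) = pair2 k (u 0) (U 0) +
  \int[lam]_r ((tri k (u r) (U r) + tri k (U r) (u r)) * upto t r).
Proof.
move=> Hu HU Gt.
have Lu r i := flow_L2 Hu r i; have LU r i := flow_L2 HU r i.
have holder V W (HV : euler_flow V) (HW : euler_flow W) r s : G s ->
    `|tri k (V r) (W s) - tri k (V r) (W r)| <= ctri * Num.sqrt c2 * Num.sqrt `|s - r|.
  (* The product rule asks for the bound at every [r], while the flow is Holder on [G] only; off [G]
     both fluxes vanish. *)
  move=> Gs; have [Gr|Gr] := pselect (G r); last first.
    have V0 w : tri k (V r) w = 0.
      apply: big1 => i _; apply: big1 => j _; rewrite -[RHS](Rint0 leb).
      by apply: eq_Rintegral => x _; rewrite (flow_out HV i x Gr) !mul0r.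
    rewrite !V0 subrr normr0; apply: mulr_ge0; last exact: sqrtr_ge0.
    by apply: mulr_ge0; [exact: ctri_ge0 HV|exact: sqrtr_ge0].
  rewrite -(triB H (flow_L2 HV r) (flow_L2 HW s) (flow_L2 HW r)) -mulrA.
  apply: (tri_le H (flow_L2 HV r) (flow_N2 HV r)) => i; last exact: flow_holder.
  by apply: L2B; exact: (flow_L2 HW).
(* Varying the first time uses the equation of [u] tested with [U] frozen; varying the second uses
   that of [U], after exchanging the roles by [pair2_sym]. *)
apply: (@product_rule _ (fun s t => pair2 k (u s) (U t)) (fun r t => tri k (u r) (U t))
  (fun r t => tri k (U r) (u t)) G T (ctri * Num.sqrt c2) (ctri * bE)) => //.
- by apply: mulr_ge0; [exact: ctri_ge0 Hu|exact: sqrtr_ge0].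
- by move=> s r Gs Gr; apply: (flow_eq Hu) => //; exact: (flow_sol HU).
- move=> s r Gs Gr; rewrite (pair2_sym H (Lu r) (LU s)) (pair2_sym H (Lu r) (LU 0)).
  by apply: (flow_eq HU) => //; exact: (flow_sol Hu).
- move=> r; apply: (measurable_tri H (v := fun=> U r) (flow_jmeas Hu)) => j.
  by apply: jmeas_space; case: (LU r j).
- move=> r; apply: (measurable_tri H (v := fun=> u r) (flow_jmeas HU)) => j.
  by apply: jmeas_space; case: (Lu r j).
- exact: (measurable_tri H (flow_jmeas Hu) (flow_jmeas HU)).
- exact: (measurable_tri H (flow_jmeas HU) (flow_jmeas Hu)).
- by move=> r s; exact: tri_flow_le.
- by move=> r s; exact: tri_flow_le.
- by move=> r s Gs; exact: holder.
- by move=> r s Gs; exact: holder.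
- exact: GT.
Qed.

End energy_identity.

(** * Osgood's criterion *)

Section ae_comparison.
Context d (X : measurableType d) (R : realType) (mu : {measure set X -> \bar R}).

Lemma Rint_le_ae (f g : X -> R) : intg mu f -> intg mu g ->
  (\forall x \ae mu, f x <= g x) -> \int[mu]_x f x <= \int[mu]_x g x.
Proof.
move=> iF ig fg; rewrite -subr_ge0 -RintB//.
have iB := intgB ig iF; have mB := intg_measurable iB.
rewrite (@ae_eq_Rint _ _ _ mu _ (fun x => `|g x - f x|))//.
- exact: Rintegral_ge0.
- exact: measurableT_comp.
- by apply: filterS fg => x fgx; rewrite ger0_norm// subr_ge0.
Qed.

Lemma ae_imp (P Q : X -> Prop) : (forall x, P x -> Q x) ->
  (\forall x \ae mu, P x) -> \forall x \ae mu, Q x.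
Proof. by move=> PQ; apply: filterS. Qed.

End ae_comparison.

Section osgood.
Context (R : realType).
Local Notation lam := (@lebesgue_measure R).

Lemma intg_mul_upto (f : R -> R) (t : R) : intg lam f -> intg lam (fun r => f r * upto t r).
Proof.
move=> iF; have := @intg_le _ _ _ lam (fun r => f r * upto t r) (fun r => `|f r|); apply.
- by apply: measurable_funM; [exact: (@intg_measurable _ _ _ lam _ iF)|exact: measurable_upto].
- move=> r; have /andP[u0 u1] := upto01 t r.
  by rewrite normrM (ger0_norm (x := upto t r))// ler_piMr.
- exact: (@intg_norm _ _ _ lam _ iF).
Qed.

Lemma Rint_upto_ge0 (f : R -> R) (t : R) : (forall r, 0 <= f r) -> 0 <= \int[lam]_r (f r * upto t r).
Proof. by move=> f0; apply: Rintegral_ge0 => r _; rewrite mulr_ge0//; case/andP: (upto01 t r). Qed.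

Lemma Rint_upto_mono (f : R -> R) (s t : R) : intg lam f -> (forall r, 0 <= f r) -> s <= t ->
  \int[lam]_r (f r * upto s r) <= \int[lam]_r (f r * upto t r).
Proof.
move=> iF f0 st; apply: (@Rint_le _ _ _ lam); [exact: intg_mul_upto|exact: intg_mul_upto|].
by move=> r; rewrite ler_wpM2l// le_upto.
Qed.

Lemma Rint_upto_cont (f : R -> R) (T : R) : 0 <= T -> intg lam f ->
  {within `[0, T], continuous (fun t => \int[lam]_r (f r * upto t r))}.
Proof.
move=> T0 iF; rewrite (_ : (fun t : R => _) = fun t => \int[lam]_(r in `[0, t]) f r).
by apply: parameterized_integral_continuous => //; apply: integrableS iF.
by apply/funext => t; exact: Rint_upto_itv.
Qed.

Lemma expR_natN_le (k : nat) : expR (- k.+1%:R) <= (2^-1 : R) ^+ k.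
Proof.
rewrite expRN exprVn lef_pV2 ?posrE ?expR_gt0 ?exprn_gt0//.
apply: (@le_trans _ _ (2 ^+ k.+1)); first by rewrite ler_eXn2l ?ltr1n.
rewrite -[k.+1%:R]mulr1 expRM_natl lerXn2r ?nnegrE ?expR_ge0//.
by have := expR_ge1Dx (1 : R).
Qed.

(** The differences telescope, so the partial sums of the harmonic series would be bounded by
    [K * M 0]. *)
Lemma dyadic_harmonic (K : R) (M : nat -> R) : (forall k, 0 <= M k) ->
  (forall k, k.+1%:R^-1 <= K * (M k - M k.+1)) -> 0 <= K -> False.
Proof.
move=> M0 HM K0; apply: (@dvg_harmonic R).
apply: nondecreasing_is_cvgn.
  by apply: nondecreasing_series => k _ _; rewrite /harmonic invr_ge0.
exists (K * M 0%N) => _ [k _ <-].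
have H : series (@harmonic R) k <= K * (M 0%N - M k).
  elim: k => [|k IH]; first by rewrite /series/= big_geq// subrr mulr0.
  rewrite seriesSr /harmonic (le_trans (lerD IH (HM k)))//.
  by rewrite -mulrDr addrA subrK.
by apply: (le_trans H); rewrite ler_wpM2l// gerBl.
Qed.

(** Used with [k1 = k + 1], [k2 = 2^-k] and [DM] the mass of [m] on a dyadic level. Both terms on
    the right carry the factor [k2], which cancels; only the harmonic factor is left. *)
Lemma level_step (eta lambda C k2 k1 DM : R) :
  0 < eta -> 0 <= C -> 0 < lambda -> 0 < k1 -> 1 <= k1 -> 0 < k2 -> 0 <= DM ->
  k2 / 2 * eta <= (lambda * k1 * (k2 * eta) + C * k2) * DM ->
  k1^-1 <= 2 * (lambda * eta + C) / eta * DM.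
Proof.
move=> e0 C0 l0 k10 k11 k20 D0 H.
rewrite -(ler_pM2l k10) mulfV ?gt_eqF// -(ler_pM2l e0) mulr1.
have -> : eta * (k1 * (2 * (lambda * eta + C) / eta * DM)) = 2 * k1 * (lambda * eta + C) * DM.
  by field; rewrite gt_eqF.
have {}H : eta <= 2 * (lambda * k1 * eta + C) * DM.
  rewrite -(ler_pM2l k20); nra.
apply: (le_trans H); rewrite ler_wpM2r//.
have : C <= k1 * C by rewrite ler_peMl.
by move=> ?; nra.
Qed.

(* Osgood's criterion for the modulus [min_L (L x + C exp(-c L))], which is of order
   [x log(1/x)]: on each dyadic level [2^-(k+1) <= I / I(T) <= 2^-k], taking [L] proportional
   to [k+1] forces the integral of [m] to be at least of order [1/(k+1)]. *)
Lemma osgood (g m : R -> R) (T C c : R) : 0 <= T -> 0 <= C -> 0 < c ->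
  intg lam g -> (forall r, 0 <= g r) -> intg lam m -> (forall r, 0 <= m r) ->
  (\forall r \ae lam, 0 <= r <= T -> forall L : R, 1 <= L ->
    g r <= m r * (L * \int[lam]_s (g s * upto r s) + C * expR (- (c * L)))) ->
  \int[lam]_s (g s * upto T s) = 0.
Proof.
move=> T0 C0 c0 ig g0 im m0 Hg.
pose I t := \int[lam]_s (g s * upto t s); pose M t := \int[lam]_s (m s * upto t s).
have I0 t : 0 <= I t by exact: Rint_upto_ge0.
have Im s t : s <= t -> I s <= I t by exact: Rint_upto_mono.
have Mm s t : s <= t -> M s <= M t by exact: Rint_upto_mono.
have I00 : I 0 = 0 by exact: Rint_upto0.
apply/eqP; rewrite -/(I T) eq_le I0 andbT leNgt; apply/negP => eta0.
set eta := I T in eta0.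
(* The levels are attained because [I] is continuous with [I 0 = 0]. *)
have lev k : exists t, 0 <= t <= T /\ I t = 2^-1 ^+ k * eta.
  have [||t tT It] := @IVT R I 0 T (2^-1 ^+ k * eta) T0.
  - exact: Rint_upto_cont.
  - rewrite I00 -/eta (min_idPl (ltW eta0)) (max_idPr (ltW eta0)).
    rewrite mulr_ge0 ?exprn_ge0 ?(ltW eta0)//= ler_piMl ?(ltW eta0)// exprn_ile1//.
    by rewrite invf_le1 ?ler1n.
  by exists t; rewrite in_itv/= in tT.
have [t tP] := choice lev.
have tS k : t k.+1 <= t k.
  rewrite leNgt; apply/negP => /ltW /Im; rewrite (tP k).2 (tP k.+1).2.
  rewrite ler_pM2r// exprS leNgt gtr_pMl ?exprn_gt0 ?invr_gt0//.
  by rewrite invf_lt1 ?ltr1n.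
(* This makes [L = lambda (k + 1)] at least 1 and [c L] at least [k + 1], so that
   [exp (- c L) <= 2^-k]. *)
pose lambda := Num.max 1 c^-1.
have l1 : 1 <= lambda by rewrite le_max lexx.
have lc : 1 <= c * lambda by rewrite -(divff (lt0r_neq0 c0)) ler_pM2l// le_max lexx orbT.
have step k : I (t k) - I (t k.+1) <=
    (lambda * k.+1%:R * I (t k) + C * 2^-1 ^+ k) * (M (t k) - M (t k.+1)).
  set A := lambda * _ * _ + _.
  have A0 : 0 <= A by rewrite addr_ge0 ?mulr_ge0 ?exprn_ge0// (le_trans ler01).
  have sub (f : R -> R) : intg lam f ->
      \int[lam]_s (f s * upto (t k) s) - \int[lam]_s (f s * upto (t k.+1) s) =
      \int[lam]_s (f s * (upto (t k) s - upto (t k.+1) s)).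
    move=> iF; rewrite -(@RintB _ _ _ lam); [|exact: intg_mul_upto|exact: intg_mul_upto].
    by apply: eq_Rintegral => s _; rewrite mulrBr.
  have isub (f : R -> R) : intg lam f -> intg lam (fun s => f s * (upto (t k) s - upto (t k.+1) s)).
    move=> iF; under eq_fun do rewrite mulrBr.
    by apply: (@intgB _ _ _ lam); exact: intg_mul_upto.
  rewrite /I /M sub// sub// -(@RintZ _ _ _ lam); last exact: isub.
  have ae : \forall r \ae lam, g r * (upto (t k) r - upto (t k.+1) r) <=
      A * (m r * (upto (t k) r - upto (t k.+1) r)).
    apply: (@ae_imp _ _ _ lam _ _ _ Hg) => r Hr.
    have u0 : 0 <= upto (t k) r - upto (t k.+1) r by rewrite subr_ge0 le_upto.
    have [->|/upto_sub] := eqVneq (upto (t k) r - upto (t k.+1) r) 0; first by rewrite !mulr0.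
    move=> /(_ (tS k))/andP[kr rk]; have [/andP[tk0 tkT] _] := tP k; have [/andP[tk0' _] _] := tP k.+1.
    rewrite mulrA ler_wpM2r// mulrC.
    have r0T : 0 <= r <= T by rewrite (le_trans tk0' kr) (le_trans rk).
    have L1 : 1 <= lambda * k.+1%:R.
      by apply: mulr_ege1 => //; rewrite ler1n.
    apply: (le_trans (Hr r0T _ L1)); rewrite ler_wpM2l// lerD//.
      by rewrite ler_wpM2l ?(le_trans ler01 L1)//; exact: Im.
    rewrite ler_wpM2l// (@le_trans _ _ (expR (- k.+1%:R)))//.
      by rewrite ler_expR lerN2 mulrA ler_peMl.
    exact: expR_natN_le.
  apply: (@Rint_le_ae _ _ _ lam _ _ _ _ ae); first exact: isub.
  by apply: (@intgZ _ _ _ lam); exact: isub.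
pose K := 2 * (lambda * eta + C) / eta.
have l0 : 0 < lambda by rewrite (lt_le_trans ltr01).
apply: (@dyadic_harmonic K (fun k => M (t k))).
- by move=> k; exact: Rint_upto_ge0.
- move=> k; apply: (@level_step eta lambda C (2^-1 ^+ k) k.+1%:R _) => //.
  + by rewrite ler1n.
  + by rewrite subr_ge0; exact: Mm.
  + have := step k; rewrite (tP k).2 (tP k.+1).2 exprS.
    by congr (_ <= _); field.
- by rewrite divr_ge0 ?mulr_ge0 ?addr_ge0 ?mulr_ge0// ltW.
Qed.

End osgood.

(** * Uniqueness *)

Section pointwise_bound.
Context (R : realType) (Pf : R -> R) (N : nat) (N0 : (0 < N)%N).
Hypothesis young : forall delta x y : R, 0 < delta -> 0 <= x -> 0 <= y ->
  x ^+ 2 * y <= delta * Pf x + (y / delta) ^+ N * y.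

Definition osgood_rate : R := (4 * N%:R)^-1.

(** The factorial and the power of 2 come from [s^(N+1) <= (N+1)! 2^(N+1) exp (s / 2)], the leading
    2 from [exp s <= 2 (exp s - 1)] for [s >= 1]. *)
Definition osgood_const : R := 2 * ((N.+1)`!%:R * 2 ^+ N.+1).

Lemma expR_pow_le (s : R) (j : nat) : 0 <= s -> s ^+ j.+1 <= (j.+1)`!%:R * (expR s - 1).
Proof.
move=> s0; have := expR_ge1Dxn j s0; rewrite -lerBrDl => H.
by rewrite -ler_pdivrMl ?ltr0n ?fact_gt0// mulrC.
Qed.

(* If [s > L], then [young] with [delta = exp (- L / (4 N))] leaves a multiple of
   [s^(N+1) exp (L / 4) <= C exp (s / 2 + L / 4) <= C exp (s - L / 4)]. *)
Lemma pointwise_osgood (L y a s : R) : 1 <= L -> 0 <= y -> y <= a ^+ 2 -> 0 <= a -> 0 <= s ->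
  0 <= Pf a ->
  y * s <= L * y + expR (- (osgood_rate * L)) * (Pf a + osgood_const * (expR s - 1)).
Proof.
move=> L1 y0 ya a0 s0 Pa; have L0 : 0 <= L by rewrite (le_trans ler01).
have es : 0 <= expR s - 1 by rewrite subr_ge0 -expR0 ler_expR.
have K0 : 0 <= osgood_const by rewrite !mulr_ge0 ?exprn_ge0.
have [sL|Ls] := leP s L.
  apply: (@le_trans _ _ (L * y)); first by rewrite mulrC ler_wpM2r.
  by rewrite lerDl mulr_ge0 ?expR_ge0// addr_ge0 ?mulr_ge0.
apply: (@le_trans _ _ (a ^+ 2 * s)); first by rewrite ler_wpM2r.
set d := expR _; have d0 : 0 < d by exact: expR_gt0.
apply: (le_trans (young d0 a0 s0)).
rewrite -[leLHS]add0r lerD ?mulr_ge0// mulrDr lerD2l.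
have N0' : N%:R != 0 :> R by rewrite pnatr_eq0 -lt0n.
have dN : d ^- N = expR (L / 4).
  rewrite /d -expRM_natl -expRN; congr expR; rewrite /osgood_rate; field.
  by rewrite N0'.
have -> : (s / d) ^+ N * s = s ^+ N.+1 * expR (L / 4).
  by rewrite expr_div_n dN exprSr mulrAC.
have h1 : s ^+ N.+1 <= (N.+1)`!%:R * 2 ^+ N.+1 * expR (s / 2).
  have s20 : 0 <= s / 2 by rewrite divr_ge0.
  have := expR_pow_le N s20; rewrite expr_div_n ler_pdivrMr ?exprn_gt0// mulrAC => /le_trans.
  by apply; rewrite ler_wpM2l ?mulr_ge0 ?exprn_ge0// gerBl.
apply: (@le_trans _ _ ((N.+1)`!%:R * 2 ^+ N.+1 * (expR (s / 2) * expR (L / 4)))).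
  by rewrite mulrA ler_wpM2r ?expR_ge0.
have h2 : expR (s / 2) * expR (L / 4) <= expR s * d.
  rewrite -!expRD ler_expR.
  have : osgood_rate * L <= 4^-1 * L.
    rewrite ler_wpM2r// /osgood_rate invfM ler_piMr ?invr_ge0// invf_le1 ?ltr0n// ler1n.
    exact: N0.
  by move=> h; lra.
have h3 : expR s <= 2 * (expR s - 1).
  have := expR_ge1Dx s; have : 1 <= s by rewrite (le_trans L1)// ltW.
  by move=> ? ?; lra.
have Q0 : 0 <= (N.+1)`!%:R * 2 ^+ N.+1 :> R by rewrite mulr_ge0 ?exprn_ge0.
apply: (@le_trans _ _ ((N.+1)`!%:R * 2 ^+ N.+1 * (2 * (expR s - 1) * d))).
  by apply: (ler_wpM2l Q0); apply: (le_trans h2); rewrite ler_wpM2r// ltW.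
by rewrite le_eqVlt; apply/orP; left; apply/eqP; rewrite /osgood_const; ring.
Qed.

End pointwise_bound.

Section slice_bounds.
Context (R : realType) (n : nat).
Local Notation Rn := 'rV[R]_n.
Local Notation leb := (lebesgue_rV R n).
Local Notation L2 := (L2 leb).
Local Notation N2 := (N2 leb).
Local Notation intg := (intg leb).
Context (Pf : R -> R) (N : nat) (N0 : (0 < N)%N) (CP : R).
Hypothesis young : forall delta x y : R, 0 < delta -> 0 <= x -> 0 <= y ->
  x ^+ 2 * y <= delta * Pf x + (y / delta) ^+ N * y.
Hypothesis Pf2 : forall x, 0 <= x -> x ^+ 2 <= Pf x.

(** One majorant [a] serves for both fields and for their difference. Its integral bound [CP] is
    meant to be uniform in time, whereas the size [m] of the strain changes with the slice. *)
Record good_slice (u U : 'I_n -> Rn -> R) (S : 'I_n -> 'I_n -> Rn -> R)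
  (nS a : Rn -> R) (m : R) : Prop := GoodSlice {
  slice_m : 0 < m ;
  slice_ma : measurable_fun setT a ;
  slice_a0 : forall x, 0 <= a x ;
  slice_Pa : intg (fun x => Pf (a x)) ;
  slice_CP : \int[leb]_x Pf (a x) <= CP ;
  slice_mnS : measurable_fun setT nS ;
  slice_nS0 : forall x, 0 <= nS x ;
  slice_mS : forall i j, measurable_fun setT (S i j) ;
  slice_SnS : forall i j x, `|S i j x| <= nS x ;
  slice_frob : forall (b : 'I_n -> R) x,
    `|\sum_i \sum_j b i * b j * S i j x| <= (\sum_i b i ^+ 2) * nS x ;
  slice_exp : intg (fun x => expR (nS x / m) - 1) ;
  slice_exp1 : \int[leb]_x (expR (nS x / m) - 1) <= 1 ;
  slice_sym : sym_grad U S ;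
  slice_u : field_le a u ;
  slice_U : field_le a U ;
  slice_w : forall x, \sum_i (u i x - U i x) ^+ 2 <= a x ^+ 2 }.

Section one_slice.
Context u U S nS a m (H : good_slice u U S nS a m).

Let s x := nS x / m.
Let m0 : 0 < m. Proof. exact: slice_m H. Qed.
Let ma : measurable_fun setT a. Proof. exact: slice_ma H. Qed.
Let a0 : forall x, 0 <= a x. Proof. exact: slice_a0 H. Qed.
Let Pa : intg (fun x => Pf (a x)). Proof. exact: slice_Pa H. Qed.
Let s0 x : 0 <= s x. Proof. by rewrite divr_ge0 ?(slice_nS0 H)// ltW. Qed.
Let ms : measurable_fun setT s.
Proof. by apply: measurable_funM => //; exact: slice_mnS H. Qed.
Let Pfa x : 0 <= Pf (a x). Proof. exact: le_trans (sqr_ge0 _) (Pf2 (a0 x)). Qed.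
Let mS := slice_mS H.
Let nSE x : nS x = m * s x. Proof. by rewrite mulrC divfK// gt_eqF. Qed.
Let Ss i j x : `|S i j x| <= m * s x. Proof. by rewrite -nSE; exact: slice_SnS H i j x. Qed.
Let US := slice_sym H.
Let Hu := slice_u H.
Let HU := slice_U H.

Let a2 : L2 a.
Proof.
split => //; apply: (intg_le _ _ Pa); first exact: measurable_funX.
by move=> x; rewrite ger0_norm ?sqr_ge0//; exact: Pf2.
Qed.

Let N2a : N2 a <= CP.
Proof.
by apply: le_trans (slice_CP H); apply: Rint_le => //; [case: a2|move=> x; exact: Pf2].
Qed.

Let is_ j : intg (fun x => s x ^+ j.+1).
Proof.
apply: (@intg_le _ _ _ _ _ (fun x => (j.+1)`!%:R * (expR (s x) - 1))).
- exact: measurable_funX.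
- by move=> x; rewrite ger0_norm ?exprn_ge0//; exact: expR_pow_le.
- by apply: intgZ; exact: slice_exp H.
Qed.

Let Rs_ j : \int[leb]_x (s x ^+ j.+1) <= (j.+1)`!%:R.
Proof.
apply: (@le_trans _ _ (\int[leb]_x ((j.+1)`!%:R * (expR (s x) - 1)))).
  apply: Rint_le => //; first by apply: intgZ; exact: slice_exp H.
  by move=> x; exact: expR_pow_le.
rewrite RintZ; last exact: slice_exp H.
by rewrite ler_piMr//; exact: slice_exp1 H.
Qed.

(** The factorials bound the moments of the normalised strain: [s^(j+1) <= (j+1)! (exp s - 1)], and
    the exponential modular is at most 1. *)
Definition form_const : R := ((CP + (N.+1)`!%:R) *+ n *+ n) +
  ((4 * (CP + (N.*2.+2)`!%:R) + CP) *+ n *+ n).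

Lemma forms_le l : `|formA U l u + formB U l u| <= m * form_const.
Proof.
rewrite (le_trans (ler_normD _ _))// mulrDr; apply: lerD.
  apply: (le_trans (formA_le young m0 a0 a2 Pa s0 is_ mS Ss US HU Hu l)).
  rewrite ler_pM2l//; do 2 apply: ler_wMn2r.
  by apply: lerD; [exact: slice_CP H|exact: Rs_].
apply: (le_trans (formB_le young m0 a0 a2 Pa s0 is_ mS Ss US HU Hu l)).
rewrite ler_pM2l//; do 2 apply: ler_wMn2r.
apply: lerD => //; rewrite ler_pM2l//; apply: lerD; [exact: slice_CP H|exact: Rs_].
Qed.

Let w i x := u i x - U i x.

Lemma cvg_forms : (fun l => formA U l u + formB U l u) @ \oo --> quadS S w.
Proof.
have [_ ->] := quadS_sub N0 young m0 ma a0 a2 Pa Pfa s0 is_ mS Ss US HU Hu.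
apply: cvgD.
- exact: (cvg_formA N0 young m0 ma a0 a2 Pa Pfa s0 is_ mS Ss US HU Hu).
- exact: (cvg_formB young m0 a0 a2 Pa s0 is_ mS Ss US HU Hu).
Qed.

Let w2 x := \sum_i w i x ^+ 2.

Let mw i : measurable_fun setT (w i).
Proof. by apply: measurable_funB; [exact: (Hu.2 i).1|exact: (HU.2 i).1]. Qed.

Let mw2 : measurable_fun setT w2.
Proof. by apply: measurable_sum => i; exact: measurable_funX. Qed.

Let w20 x : 0 <= w2 x. Proof. by apply: sumr_ge0 => i _; exact: sqr_ge0. Qed.

Let iw2 : intg w2.
Proof.
apply: (@intg_le _ _ _ _ _ (fun x => a x ^+ 2)) => //; last by case: a2.
by move=> x; rewrite ger0_norm//; exact: slice_w H x.
Qed.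

Lemma Rint_w2 : \int[leb]_x w2 x <= CP.
Proof.
by apply: (le_trans _ N2a); apply: Rint_le => //; [case: a2|move=> x; exact: slice_w H x].
Qed.

Definition slice_osgood_const : R := CP + osgood_const R N.

Let iE (L : R) : intg (fun x => m * (L * w2 x + expR (- (osgood_rate R N * L)) *
    (Pf (a x) + osgood_const R N * (expR (s x) - 1)))).
Proof.
apply: intgZ; apply: intgD; first exact: intgZ.
by apply: intgZ; apply: intgD => //; apply: intgZ; exact: slice_exp H.
Qed.

Let pt (L : R) x : 1 <= L -> w2 x * nS x <=
  m * (L * w2 x + expR (- (osgood_rate R N * L)) * (Pf (a x) + osgood_const R N * (expR (s x) - 1))).
Proof.
move=> L1; rewrite nSE mulrCA ler_pM2l//.
exact (pointwise_osgood N0 young L1 (w20 x) (slice_w H x) (a0 x) (s0 x) (Pfa x)).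
Qed.

Lemma intg_w2nS : intg (fun x => w2 x * nS x).
Proof.
apply: (@intg_le _ _ _ _ _ _ _ _ (iE 1)).
  by apply: measurable_funM => //; exact: slice_mnS H.
by move=> x; rewrite ger0_norm ?pt// mulr_ge0//; exact: slice_nS0 H x.
Qed.

Lemma w2nS_le (L : R) : 1 <= L -> \int[leb]_x (w2 x * nS x) <=
  m * (L * (\int[leb]_x w2 x) + slice_osgood_const * expR (- (osgood_rate R N * L))).
Proof.
move=> L1; apply: (@le_trans _ _ _ _ _ (Rint_le intg_w2nS (iE L) (fun x => pt x L1))).
have i1 : intg (fun x => expR (s x) - 1) by exact: slice_exp H.
have i2 := intgZ (osgood_const R N) i1.
rewrite RintZ; last by apply: intgD; [exact: intgZ|apply: intgZ; exact: intgD].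
rewrite ler_pM2l// RintD; [|exact: intgZ|by apply: intgZ; exact: intgD].
rewrite RintZ// RintZ; last exact: intgD.
rewrite lerD2l [leRHS]mulrC ler_wpM2l ?expR_ge0// RintD// RintZ//.
apply: lerD; first exact: slice_CP H.
rewrite ler_piMr; [by []| |exact: slice_exp1 H].
by rewrite !mulr_ge0// exprn_ge0.
Qed.

Lemma quadS_w_le : `|quadS S w| <= \int[leb]_x (w2 x * nS x).
Proof.
have [iw _] := quadS_sub N0 young m0 ma a0 a2 Pa Pfa s0 is_ mS Ss US HU Hu.
have -> : quadS S w = \int[leb]_x \sum_i \sum_j w i x * w j x * S i j x.
  rewrite Rint_sum; last by move=> i; apply: intg_sum => j; exact: iw.
  by apply: eq_bigr => i _; rewrite Rint_sum// => j; exact: iw.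
apply: Rint_abs_le.
- do 2 apply: measurable_sum => ?; exact: intg_measurable (iw _ _).
- exact: intg_w2nS.
- by move=> x; exact: slice_frob H (fun i => w i x) x.
Qed.

End one_slice.

End slice_bounds.

Section energy_arithmetic.
Context (R : realType).

Lemma sqr_sub_double (a b : R) : (a - b) ^+ 2 = a ^+ 2 + b ^+ 2 - (a * b + a * b).
Proof. by ring. Qed.

Lemma energy_arith (a b c q g : R) : a <= c -> b <= c -> - q <= g ->
  a + b - (c + q + (c + q)) <= 2 * g.
Proof. by lra. Qed.

End energy_arithmetic.

(** * Relative energy and uniqueness of flows *)

Section uniqueness.
Context (R : realType) (n : nat).
Local Notation Rn := 'rV[R]_n.
Local Notation leb := (lebesgue_rV R n).
Local Notation lam := (@lebesgue_measure R).
Local Notation L2 := (L2 leb).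
Local Notation N2 := (N2 leb).

Lemma cvg_pair2 (u v : 'I_n -> Rn -> R) : (forall i, L2 (u i)) -> (forall i, L2 (v i)) ->
  (fun l => pair2 (moll l) u v) @ \oo --> \sum_i \int[leb]_x (u i x * v i x).
Proof.
move=> Lu Lv; apply: cvgn_sum => i.
apply: (@cvgn_squeeze _ _ (fun l => Num.sqrt (N2 (u i)) *
  Num.sqrt (N2 (fun x => convol (moll l) (convol (moll l) (v i)) x - v i x)))); last first.
  rewrite -[X in _ --> X](mulr0 (Num.sqrt (N2 (u i)))) -(sqrtr0 R).
  apply: cvgM; first exact: cvg_cst.
  by apply: (cvg_comp _ _ (cvg_moll2 (Lv i))); exact: sqrt_continuous.
move=> l; have bk := moll_bkernel (mollifier_moll R n l).
have LKK : L2 (mol2 (moll l) v i) by do 2 apply: L2_conv => //.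
rewrite -RintB; [|exact: L2M|exact: L2M].
rewrite (_ : \int[leb]_x _ = \int[leb]_x (u i x * (mol2 (moll l) v i x - v i x))).
  by apply: cauchy_schwarz_abs => //; exact: L2B.
by apply: eq_Rintegral => x _; rewrite mulrBr.
Qed.

Context (Pf : R -> R) (N : nat) (N0 : (0 < N)%N) (CP : R).
Hypothesis young : forall delta x y : R, 0 < delta -> 0 <= x -> 0 <= y ->
  x ^+ 2 * y <= delta * Pf x + (y / delta) ^+ N * y.
Hypothesis Pf2 : forall x, 0 <= x -> x ^+ 2 <= Pf x.
Context (E T : R) (G : set R) (u U : R -> 'I_n -> Rn -> R).
Context (S : R -> 'I_n -> 'I_n -> Rn -> R) (nS a : R -> Rn -> R) (m : R -> R).
Hypothesis T0 : 0 < T.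
Hypothesis G0 : G 0.
Hypothesis GT : forall t, G t -> 0 <= t <= T.
Hypothesis dG : forall a b : R, 0 <= a -> a < b -> b <= T -> exists2 t, G t & a < t < b.
Hypothesis Hu : forall l, euler_flow (@moll R n l) E G u.
Hypothesis HU : forall l, euler_flow (@moll R n l) E G U.
Hypothesis init : forall i, u 0 i = U 0 i.
Hypothesis eu : forall t, G t -> \sum_i N2 (u t i) <= \sum_i N2 (u 0 i).
Hypothesis eU : forall t, G t -> \sum_i N2 (U t i) <= \sum_i N2 (u 0 i).
Hypothesis ok : forall r, G r -> r != 0 ->
  good_slice Pf CP (u r) (U r) (S r) (nS r) (a r) (m r).
Hypothesis jS : forall i j, jmeas (fun r => S r i j).
Hypothesis jnS : jmeas nS.
Hypothesis im : intg lam m.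
Hypothesis m0 : forall r, 0 <= m r.
Hypothesis CP0 : 0 <= CP.

Let w r i x := u r i x - U r i x.
Let w2 r x := \sum_i w r i x ^+ 2.
Let g r := \int[leb]_x (w2 r x * nS r x).
Let e r := \int[leb]_x w2 r x.

Let Lu r i : L2 (u r i). Proof. exact: flow_L2 (Hu 0) r i. Qed.
Let LU r i : L2 (U r i). Proof. exact: flow_L2 (HU 0) r i. Qed.

(** Time 0 belongs to [G] but comes with no slice estimates; there [w] vanishes because the initial
    data agree. *)
Let out r i x : ~ (G r /\ r != 0) -> w r i x = 0.
Proof.
move=> Gr; have [r0|r0] := eqVneq r 0; first by rewrite /w r0 init subrr.
have Gr' : ~ G r by move=> Gr'; apply: Gr.
by rewrite /w (flow_out (Hu 0) i x Gr') (flow_out (HU 0) i x Gr') subrr.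
Qed.

Let out2 r x : ~ (G r /\ r != 0) -> w2 r x = 0.
Proof. by move=> Gr; apply: big1 => i _; rewrite out// expr0n. Qed.

Let jw r0 : jmeas (fun r => w r r0).
Proof. by apply: jmeasB; [exact: flow_jmeas (Hu 0) r0|exact: flow_jmeas (HU 0) r0]. Qed.

Let jw2 : jmeas w2.
Proof. by apply: measurable_sum => i; apply: measurable_funX; exact: jw. Qed.

Let mg : measurable_fun setT g.
Proof. by apply: (jmeas_Rint (f := fun r x => w2 r x * nS r x)); exact: jmeasM. Qed.

Let e0 r : 0 <= e r.
Proof. by apply: Rintegral_ge0 => x _; apply: sumr_ge0 => i _; exact: sqr_ge0. Qed.

Let K := slice_osgood_const N CP.
Let c := osgood_rate R N.

Let K0 : 0 <= K.
Proof. by rewrite addr_ge0// !mulr_ge0// exprn_ge0. Qed.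

Let c0 : 0 < c.
Proof. by rewrite invr_gt0 mulr_gt0// ltr0n. Qed.

Let g_out r : ~ (G r /\ r != 0) -> g r = 0.
Proof.
move=> Gr; rewrite -[RHS](Rint0 leb); apply: eq_Rintegral => x _.
by rewrite out2// mul0r.
Qed.

Let g_ge0 r : 0 <= g r.
Proof.
have [[Gr r0]|Gr] := pselect (G r /\ r != 0); last by rewrite g_out.
apply: Rintegral_ge0 => x _; apply: mulr_ge0; last exact: (slice_nS0 (ok Gr r0)).
by apply: sumr_ge0 => i _; exact: sqr_ge0.
Qed.

Let g_le (L : R) r : 1 <= L -> g r <= m r * (L * e r + K * expR (- (c * L))).
Proof.
move=> L1; have [[Gr r0]|Gr] := pselect (G r /\ r != 0).
  exact (w2nS_le N0 young Pf2 (ok Gr r0) L1).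
rewrite g_out// mulr_ge0// addr_ge0// mulr_ge0//; exact: le_trans L1.
Qed.

Let e_le r : e r <= CP.
Proof.
have [[Gr r0]|Gr] := pselect (G r /\ r != 0); first exact (Rint_w2 Pf2 (ok Gr r0)).
rewrite /e (_ : \int[leb]_x _ = 0)//.
by rewrite -[RHS](Rint0 leb); apply: eq_Rintegral => x _; rewrite out2.
Qed.

Let ig : intg lam g.
Proof.
(* The case [L = 1] already bounds [g] by a multiple of [m]. *)
have := @intg_le _ _ _ lam g (fun r => (CP + K) * m r); apply => //.
  move=> r; rewrite ger0_norm// (le_trans (g_le r (lexx 1)))// mulrC ler_wpM2r//.
  rewrite mul1r mulr1; apply: lerD; first exact: e_le.
  by rewrite ler_piMr// -expR0 ler_expR oppr_le0 ltW.
exact: (@intgZ _ _ _ lam).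
Qed.

Let ip t := \sum_i \int[leb]_x (u t i x * U t i x).

Let F l r := tri (moll l) (u r) (U r) + tri (moll l) (U r) (u r).

Let mF l : measurable_fun setT (F l).
Proof.
apply: measurable_funD.
  exact (measurable_tri (mollifier_moll R n l) (flow_jmeas (Hu l)) (flow_jmeas (HU l))).
exact (measurable_tri (mollifier_moll R n l) (flow_jmeas (HU l)) (flow_jmeas (Hu l))).
Qed.

Let F_out l r : ~ G r -> F l r = 0.
Proof.
move=> Gr; have V0 (V : R -> 'I_n -> Rn -> R) v : (forall i x, V r i x = 0) -> tri (moll l) (V r) v = 0.
  move=> V0; apply: big1 => i _; apply: big1 => j _; rewrite -[RHS](Rint0 leb).
  by apply: eq_Rintegral => x _; rewrite V0 !mul0r.
rewrite /F !V0 ?addr0// => i x; first exact: (flow_out (HU l)).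
exact: (flow_out (Hu l)).
Qed.

Let FC := form_const n N CP.

Let FC0 : 0 <= FC.
Proof. by rewrite addr_ge0//; do 2 apply: mulrn_wge0; rewrite ?addr_ge0 ?mulr_ge0 ?addr_ge0. Qed.

Let F_le l r : r != 0 -> `|F l r| <= FC * m r.
Proof.
move=> r0; rewrite mulrC; have [Gr|Gr] := pselect (G r).
  exact (forms_le young Pf2 (ok Gr r0) l).
by rewrite F_out// normr0 mulr_ge0.
Qed.

Let q r := quadS (S r) (w r).

Let q_out r : ~ (G r /\ r != 0) -> q r = 0.
Proof.
move=> Gr; apply: big1 => i _; apply: big1 => j _; rewrite -[RHS](Rint0 leb).
by apply: eq_Rintegral => x _; rewrite out// !mul0r.
Qed.

Let mq : measurable_fun setT q.
Proof.
apply: measurable_sum => i; apply: measurable_sum => j.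
apply: (jmeas_Rint (f := fun r x => w r i x * w r j x * S r i j x)).
by apply: jmeasM => //; apply: jmeasM; exact: jw.
Qed.

Let q_le r : `|q r| <= g r.
Proof.
have [[Gr r0]|Gr] := pselect (G r /\ r != 0); first exact: (quadS_w_le N0 young Pf2 (ok Gr r0)).
by rewrite q_out// normr0.
Qed.

Let ae_neq0 : \forall r \ae lam, r != 0.
Proof.
exists [set 0]; split => //; first exact: lebesgue_measure_set1.
by move=> r /=; apply: contra_notP => /eqP.
Qed.

(** Dominated convergence in time: the slice limit is [cvg_forms], and the bound [FC * m] does not
    depend on [l]. Both hold for [r != 0], that is, almost everywhere. *)
Let cvg_F t : (fun l => \int[lam]_r (F l r * upto t r)) @ \oo --> \int[lam]_r (q r * upto t r).
Proof.
have mu := measurable_upto t.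
apply: (@Rint_dominated _ _ _ lam (fun l r => F l r * upto t r) _ (fun r => FC * m r)).
- by move=> l; exact (measurable_funM (mF l) mu).
- exact (measurable_funM mq mu).
- apply: (@ae_imp _ _ _ lam _ _ _ ae_neq0) => r r0; apply: cvgM; last exact: cvg_cst.
  have [Gr|Gr] := pselect (G r); first exact (cvg_forms N0 young Pf2 (ok Gr r0)).
  rewrite q_out; last by case.
  by under eq_fun do rewrite F_out//; exact: cvg_cst.
- exact: (@intgZ _ _ _ lam).
- apply: (@ae_imp _ _ _ lam _ _ _ ae_neq0) => r r0 l.
  have /andP[u0 u1] := upto01 t r.
  by rewrite normrM (ger0_norm u0) (le_trans _ (F_le l r0))// ler_piMr.
Qed.

Let ip_identity t : G t -> ip t = ip 0 + \int[lam]_r (q r * upto t r).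
Proof.
move=> Gt; apply: (cvgn_unique (cvg_pair2 (Lu t) (LU t))).
rewrite (_ : (fun l => _) = (fun l => pair2 (moll l) (u 0) (U 0) + \int[lam]_r (F l r * upto t r))).
  by apply: cvgD; [exact: cvg_pair2|exact: cvg_F].
apply/funext => l.
exact: (moll_energy (mollifier_moll R n l) G0 GT dG (Hu l) (HU l) Gt).
Qed.

Let e_ip t : e t = \sum_i N2 (u t i) + \sum_i N2 (U t i) - (ip t + ip t).
Proof.
rewrite /e /w2 Rint_sum; last by move=> i; case: (L2B (Lu t i) (LU t i)).
rewrite -!big_split -sumrB/=; apply: eq_bigr => i _.
have iM := L2M (Lu t i) (LU t i).
have [_ iu] := Lu t i; have [_ iU] := LU t i.
rewrite -(RintD iM iM) -(RintD iu iU) -RintB; [|exact: intgD|exact: intgD].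
by apply: eq_Rintegral => x _; rewrite /w sqr_sub_double.
Qed.

(** Relative energy: [|w|^2 = |u|^2 + |U|^2 - 2 u . U]. Admissibility bounds both energies by that
    of the datum, which is [ip 0], so only the integral of [- 2 q] survives. *)
Let e_le_I t : G t -> e t <= \int[lam]_r (2 * g r * upto t r).
Proof.
move=> Gt.
have mu := measurable_upto t.
have iq : intg lam (fun r => q r * upto t r).
  apply: intg_mul_upto; have := @intg_le _ _ _ lam q g; apply => //.
have igu : intg lam (fun r => g r * upto t r) by exact: intg_mul_upto.
have -> : \int[lam]_r (2 * g r * upto t r) = 2 * \int[lam]_r (g r * upto t r).
  by rewrite -(@RintZ _ _ _ lam)//; apply: eq_Rintegral => r _; rewrite mulrA.
have ip0 : ip 0 = \sum_i N2 (u 0 i).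
  by apply: eq_bigr => i _; apply: eq_Rintegral => x _; rewrite -init -expr2.
have qg : - (\int[lam]_r (q r * upto t r)) <= \int[lam]_r (g r * upto t r).
  apply: (le_trans (ler_norm _)); rewrite normrN.
  apply: (@Rint_abs_le _ _ _ lam) => //; first exact: measurable_funM.
  move=> r; have /andP[u0 _] := upto01 t r.
  by rewrite normrM (ger0_norm u0) ler_wpM2r.
rewrite e_ip (ip_identity Gt) ip0; exact: energy_arith (eu Gt) (eU Gt) qg.
Qed.

Lemma flow_uniqueness t : G t -> \forall x \ae leb, forall i, u t i x = U t i x.
Proof.
move=> Gt; have /andP[t0 tT] := GT Gt.
(* Since [e] is bounded by the integral of [2 g], the criterion is applied to [2 g] and [2 m]. *)
have IT : \int[lam]_r (2 * g r * upto T r) = 0.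
  apply: (@osgood _ (fun r => 2 * g r) (fun r => 2 * m r) T K c) => //.
  - exact: ltW.
  - exact: (@intgZ _ _ _ lam).
  - by move=> r; rewrite mulr_ge0.
  - exact: (@intgZ _ _ _ lam).
  - by move=> r; rewrite mulr_ge0.
  - apply: (@aeW _ _ _ lam) => r /andP[r0 rT] L L1; rewrite -mulrA ler_pM2l//.
    have [Gr|Gr] := pselect (G r); last first.
      rewrite g_out; last by case.
      rewrite mulr_ge0// addr_ge0// mulr_ge0 ?expR_ge0//; first exact: le_trans L1.
      by apply: Rint_upto_ge0 => s; rewrite mulr_ge0.
    apply: (le_trans (g_le r L1)); rewrite ler_wpM2l// lerD2r ler_wpM2l//; first exact: le_trans L1.
    exact: e_le_I.
have et : e t = 0.
  apply/le_anti; rewrite e0 andbT -IT (le_trans (e_le_I Gt))//.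
  apply: Rint_upto_mono => //; first exact: (@intgZ _ _ _ lam).
  by move=> r; rewrite mulr_ge0.
have iw2 : intg leb (w2 t) by apply: intg_sum => j; case: (L2B (Lu t j) (LU t j)).
have w20 x : 0 <= w2 t x by apply: sumr_ge0 => j _; exact: sqr_ge0.
apply: (@ae_imp _ _ _ leb _ _ _ (Rint0_ae iw2 w20 et)) => x /eqP.
rewrite psumr_eq0; last by move=> j _; exact: sqr_ge0.
move=> /allP w0 i; have := w0 i (mem_index_enum _).
by rewrite /= sqrf_eq0 subr_eq0 => /eqP.
Qed.

End uniqueness.

(** * Frobenius, Lebesgue and Orlicz norms *)

Section frobenius.
Context (R : realType) (p q : nat).
Implicit Types (A : 'M[R]_(p, q)).

Lemma mxdotE A : mxdot A A = \sum_i \sum_j A i j ^+ 2.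
Proof. by apply: eq_bigr => i _; apply: eq_bigr => j _; rewrite expr2. Qed.

Lemma mxdot_ge0 A : 0 <= mxdot A A.
Proof. by rewrite mxdotE; do 2 apply: sumr_ge0 => ? _; exact: sqr_ge0. Qed.

Lemma mxnorm2_ge0 A : 0 <= mxnorm2 A.
Proof. exact: sqrtr_ge0. Qed.

Lemma mxnorm2_sqr A : mxnorm2 A ^+ 2 = \sum_i \sum_j A i j ^+ 2.
Proof. by rewrite sqr_sqrtr ?mxdot_ge0// mxdotE. Qed.

Lemma mxnorm2_entry A i j : `|A i j| <= mxnorm2 A.
Proof.
rewrite -[leLHS]sqrtr_sqr ler_wsqrtr// mxdotE (bigD1 i)//= (bigD1 j)//= -addrA lerDl.
by rewrite addr_ge0 ?sumr_ge0// => *; rewrite ?sqr_ge0// sumr_ge0// => *; rewrite sqr_ge0.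
Qed.

Lemma mxnorm20 : mxnorm2 (0 : 'M[R]_(p, q)) = 0.
Proof.
rewrite /mxnorm2 /mxdot big1 ?sqrtr0// => i _.
by rewrite big1// => j _; rewrite mxE mul0r.
Qed.

Lemma mxnorm2_le A (c : R) : (forall i j, `|A i j| <= c) ->
  mxnorm2 A <= Num.sqrt (\sum_(i < p) \sum_(j < q) c ^+ 2).
Proof.
move=> Ac; rewrite ler_wsqrtr// mxdotE; apply: ler_sum => i _; apply: ler_sum => j _.
rewrite -real_normK ?num_real// lerXn2r ?nnegrE//.
exact: le_trans (Ac i j).
Qed.

End frobenius.

Lemma mxnorm2_rowE (R : realType) q (v : 'rV[R]_q) : mxnorm2 v ^+ 2 = \sum_j v 0 j ^+ 2.
Proof. by rewrite mxnorm2_sqr big_ord1. Qed.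

Lemma mxdot_row (R : realType) q (v w : 'rV[R]_q) : mxdot v w = \sum_j v 0 j * w 0 j.
Proof. by rewrite /mxdot big_ord1. Qed.

(** Cauchy-Schwarz between [S] and the matrix [b i * b j], whose Frobenius norm is [B]. *)
Lemma quadratic_form_le (R : realType) n (S : 'M[R]_n) (b : 'I_n -> R) :
  `|\sum_i \sum_j b i * b j * S i j| <= (\sum_i b i ^+ 2) * mxnorm2 S.
Proof.
set B := \sum_i b i ^+ 2; set c := mxnorm2 S.
have B0 : 0 <= B by apply: sumr_ge0 => i _; exact: sqr_ge0.
have c0 : 0 <= c by exact: mxnorm2_ge0.
have [B00|Bn0] := eqVneq B 0.
  rewrite B00 mul0r; move: B00 => /eqP; rewrite psumr_eq0; last by move=> i _; exact: sqr_ge0.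
  move=> /allP b0; rewrite big1 ?normr0// => i _; rewrite big1// => j _.
  by have := b0 i (mem_index_enum _); rewrite /= sqrf_eq0 => /eqP ->; rewrite !mul0r.
have [c00|cn0] := eqVneq c 0.
  rewrite c00 mulr0 big1 ?normr0// => i _; rewrite big1// => j _.
  have := mxnorm2_entry S i j; rewrite -/c c00 normr_le0 => /eqP ->.
  by rewrite mulr0.
have Bp : 0 < B by rewrite lt_neqAle eq_sym Bn0.
have cp : 0 < c by rewrite lt_neqAle eq_sym cn0.
have BB : \sum_i \sum_j (b i * b j) ^+ 2 = B ^+ 2.
  rewrite expr2 {2}/B mulr_sumr exchange_big/=; apply: eq_bigr => j _.
  by rewrite /B mulr_suml; apply: eq_bigr => i _; rewrite exprMn.
(* In [2 B c |x| |y| <= c^2 x^2 + B^2 y^2] the weights are such that each square sums to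
   [B^2 c^2]. *)
rewrite -(ler_pM2l (x := 2 * (B * c))); last by rewrite !mulr_gt0.
apply: (@le_trans _ _ (\sum_i \sum_j (c ^+ 2 * (b i * b j) ^+ 2 + B ^+ 2 * S i j ^+ 2))).
  apply: (@le_trans _ _ (2 * (B * c) * \sum_i \sum_j `|b i * b j * S i j|)).
    rewrite ler_pM2l ?mulr_gt0//; apply: (le_trans (ler_norm_sum _ _ _)).
    by apply: ler_sum => i _; exact: ler_norm_sum.
  rewrite mulr_sumr; apply: ler_sum => i _; rewrite mulr_sumr; apply: ler_sum => j _.
  rewrite normrM; move: (b i * b j) (S i j) => x y.
  rewrite -[x ^+ 2]real_normK ?num_real// -[y ^+ 2]real_normK ?num_real//.
  have := sqr_ge0 (c * `|x| - B * `|y|); rewrite sqrrB !exprMn => h.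
  rewrite -subr_ge0; apply: le_trans h _; rewrite le_eqVlt; apply/orP; left; apply/eqP; ring.
under eq_bigr => i _ do rewrite big_split/= -!mulr_sumr.
rewrite big_split/= -!mulr_sumr BB -mxnorm2_sqr -/c.
by rewrite le_eqVlt; apply/orP; left; apply/eqP; ring.
Qed.

Section measurable_norm.
Context (R : realType) d (X : measurableType d) (p q : nat).

Lemma measurable_fun_entry (f : X -> 'M[R]_(p, q)) i j : measurable_fun setT f ->
  measurable_fun setT (fun x => f x i j).
Proof. by move=> mf; exact: (measurableT_comp (measurable_entry i j) mf). Qed.

Lemma measurable_mxnorm2 (f : X -> 'M[R]_(p, q)) : measurable_fun setT f ->
  measurable_fun setT (fun x => mxnorm2 (f x)).
Proof.
move=> mf; apply: (measurableT_comp (continuous_measurable_fun (@sqrt_continuous R))).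
apply: measurable_sum => i; apply: measurable_sum => j.
by apply: measurable_funM; exact: measurable_fun_entry.
Qed.

End measurable_norm.

Section Lp_norms.
Context (R : realType) (n : nat).
Local Notation Rn := 'rV[R]_n.
Local Notation leb := (lebesgue_rV R n).
Local Notation intg := (intg leb).

Lemma eq_le (x y : \bar R) : x = y -> (x <= y)%E.
Proof. by move=> ->. Qed.

Lemma poweR_inv_le (I : \bar R) (s M : R) : 0 < s -> (0 <= I)%E ->
  (I `^ s^-1 <= M%:E)%E -> (I <= (M `^ s)%:E)%E.
Proof.
move=> s0; case: I => [r| |//].
  rewrite lee_fin => r0; rewrite poweR_EFin !lee_fin => rM.
  rewrite -[r](@powRr1 R)// -(mulVf (lt0r_neq0 s0)) powRrM.
  have M0 : 0 <= M by apply: (le_trans _ rM); exact: powR_ge0.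
  by apply: ge0_ler_powR; rewrite ?nnegrE ?powR_ge0//; exact: ltW.
by move=> _; rewrite poweRyr ?invr_neq0 ?gt_eqF// leye_eq.
Qed.

Lemma Lpnorm_powR (s M : R) p q (f : Rn -> 'M[R]_(p, q)) : 0 < s -> measurable_fun setT f ->
  (Lpnorm s%:E f <= M%:E)%E ->
  intg (fun x => mxnorm2 (f x) `^ s) /\ \int[leb]_x (mxnorm2 (f x) `^ s) <= M `^ s.
Proof.
move=> s0 mf; rewrite /Lpnorm unlock => H.
have {H} : (\int[leb]_x (mxnorm2 (f x) `^ s)%:E <= (M `^ s)%:E)%E.
  apply: (poweR_inv_le s0); first by apply: integral_ge0 => x _; rewrite lee_fin powR_ge0.
  apply: le_trans H; apply: eq_le; congr (_ `^ _)%E.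
  by apply: eq_integral => x _; rewrite /= ger0_norm ?mxnorm2_ge0.
move=> H; have iF : intg (fun x => mxnorm2 (f x) `^ s).
  apply: ge0_intg.
  - by apply: (measurableT_comp (measurable_powR s)); exact: measurable_mxnorm2.
  - by move=> x; exact: powR_ge0.
  - by apply: (le_lt_trans H); exact: ltry.
by split=> //; rewrite -lee_fin -EFin_Rint.
Qed.

Lemma Lpnorm_fin_powR (s : R) p q (f : Rn -> 'M[R]_(p, q)) : 0 < s -> in_Lp s%:E f ->
  intg (fun x => mxnorm2 (f x) `^ s).
Proof.
move=> s0 [mf fy]; apply: (@Lpnorm_powR s (fine (Lpnorm s%:E f)) p q f s0 mf _).1.
by rewrite fineK// ge0_fin_numE//; exact: Lnorm_ge0.
Qed.

Lemma Lpnorm2_sqr p q (f : Rn -> 'M[R]_(p, q)) : in_Lp 2%:E f ->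
  intg (fun x => mxnorm2 (f x) ^+ 2).
Proof.
move=> H; have := Lpnorm_fin_powR (ltr0n R 2) H.
by under eq_fun do rewrite powR_mulrn ?mxnorm2_ge0//.
Qed.

Lemma L2_entry p q (f : Rn -> 'M[R]_(p, q)) i j : measurable_fun setT f ->
  intg (fun x => mxnorm2 (f x) ^+ 2) -> L2 leb (fun x => f x i j).
Proof.
move=> mf iF; have mij := measurable_fun_entry i j mf.
split=> //; apply: (intg_le _ _ iF); first exact: measurable_funX.
move=> x; rewrite ger0_norm ?sqr_ge0// -real_normK ?num_real//.
by rewrite lerXn2r ?nnegrE ?mxnorm2_ge0//; exact: mxnorm2_entry.
Qed.

Lemma in_L2_of_entries p q (f : Rn -> 'M[R]_(p, q)) :
  (forall i j, L2 leb (fun x => f x i j)) -> in_Lp 2%:E f.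
Proof.
move=> Lf; split; first by apply: measurable_fun_matrix => // i j; case: (Lf i j).
have iF : intg (fun x => \sum_i \sum_j f x i j ^+ 2).
  by apply: intg_sum => i; apply: intg_sum => j; case: (Lf i j).
rewrite /Lpnorm unlock; apply: poweR_lty.
rewrite (_ : integral _ _ _ = (\int[leb]_x (\sum_i \sum_j f x i j ^+ 2)%:E)%E).
  by rewrite (EFin_Rint iF) ltry.
apply: eq_integral => x _; rewrite /= ger0_norm ?mxnorm2_ge0//.
by rewrite powR_mulrn ?mxnorm2_ge0// mxnorm2_sqr.
Qed.

Lemma in_Loo_of_bounded p q (f : Rn -> 'M[R]_(p, q)) (c : R) : measurable_fun setT f ->
  (forall x i j, `|f x i j| <= c) -> in_Lp +oo%E f.
Proof.
move=> mf fc; split => //; rewrite /Lpnorm unlock; case: ifP => _; last exact: ltry.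
apply: le_lt_trans (ltry (Num.sqrt (\sum_(i < p) \sum_(j < q) c ^+ 2))).
apply/ess_sup_inf.ess_supP; apply: aeW => x /=; rewrite lee_fin ger0_norm ?mxnorm2_ge0//.
exact: mxnorm2_le.
Qed.

Lemma Lpnorm_const0 (s : \bar R) p q : s != 0%E ->
  Lpnorm s (fun _ : Rn => 0 : 'M[R]_(p, q)) = 0%E.
Proof.
move=> s0; rewrite /Lpnorm (_ : (fun x : Rn => _) = cst 0%E); first exact: Lnorm0.
by apply/funext => x /=; rewrite mxnorm20.
Qed.

End Lp_norms.

(** * Mollified fields as admissible test fields *)

Section test_fields.
Context (R : realType) (n : nat).
Local Notation Rn := 'rV[R]_n.
Local Notation leb := (lebesgue_rV R n).
Local Notation L2 := (L2 leb).
Local Notation N2 := (N2 leb).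
Local Notation intg := (intg leb).
Local Notation e_ := (@basis_vector R n).

(** Steps longer than 1 are covered by the sup bound, which gives the difference at most [2 c];
    negative steps by exchanging the end points. *)
Lemma ddiff_step_le i (A A' M : Rn -> R) (c : R) x t : ddiff i A A' M ->
  (forall x, M x <= c) -> `|A (x + t *: e_ i) - A x| <= 2 * c * `|t|.
Proof.
move=> H Mc; have M0 := ddiff_ge0 H; have c0 : 0 <= c := le_trans (M0 x) (Mc x).
have key y s : 0 <= s -> `|A (y + s *: e_ i) - A y| <= 2 * c * s.
  move=> s0; have [s1|/ltW s1] := leP s 1.
    apply: (@le_trans _ _ (s * M y)); first by apply: ddiff_lip H _ _ _; rewrite s0.
    rewrite mulrC; apply: ler_wpM2r => //; apply: (le_trans (Mc y)).
    by rewrite ler_peMl// ler1n.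
  apply: (@le_trans _ _ (c + c)).
    rewrite (le_trans (ler_normB _ _))//.
    by apply: lerD; apply: (le_trans (ddiff_le H _)).
  rewrite (_ : c + c = 2 * c); last by ring.
  by rewrite ler_peMr// mulr_ge0.
have [t0|/ltW t0] := leP 0 t; first by rewrite (ger0_norm t0); exact: key.
rewrite (ler0_norm t0); have := key (x + t *: e_ i) (- t).
by rewrite scaleNr addrK distrC => -> //; rewrite oppr_ge0.
Qed.

Lemma row_basis_sum (a : Rn) : a = \sum_i a 0 i *: e_ i.
Proof.
apply/rowP => j; rewrite summxE (bigD1 j)//= !mxE !eqxx mulr1 big1 ?addr0// => i ij.
by rewrite !mxE eqxx/= eq_sym (negbTE ij) mulr0.
Qed.

(** The coordinates are changed one at a time, each by at most the sup norm of [x - y]; hence the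
    factor [n]. *)
Lemma ddiff_lipschitz (A : Rn -> R) (A' : 'I_n -> Rn -> R) (M : Rn -> R) (c : R) x y :
  (forall i, ddiff i A (A' i) M) -> (forall x, M x <= c) -> 0 <= c ->
  `|A x - A y| <= 2 * c *+ n * `|x - y|.
Proof.
move=> H Mc c0.
have key (s : seq 'I_n) : `|A (y + \sum_(i <- s) (x - y) 0 i *: e_ i) - A y| <=
    \sum_(i <- s) 2 * c * `|x - y|.
  elim: s => [|i s IH]; first by rewrite !big_nil addr0 subrr normr0.
  rewrite !big_cons [_ *: _ + _]addrC [y + (_ + _)]addrA.
  set z := y + _.
  rewrite (_ : A _ - A y = (A (z + (x - y) 0 i *: e_ i) - A z) + (A z - A y)); last first.
    by rewrite addrA subrK.
  rewrite (le_trans (ler_normD _ _))// lerD//.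
  apply: (le_trans (ddiff_step_le _ _ (H i) Mc)); rewrite ler_wpM2l ?mulr_ge0//.
  by rewrite [leRHS]mx_normrE; exact: (le_bigmax _ (fun k : 'I_1 * 'I_n => `|(x - y) k.1 k.2|) (0, i)).
have := key (index_enum _); rewrite -row_basis_sum [y + _]addrC subrK.
by rewrite sumr_const card_ord (mulrnAl (2 * c)).
Qed.

Lemma compact_loc_integrable (f : Rn -> R) : L2 f -> loc_integrable f.
Proof.
move=> Lf; split; first by case: Lf.
move=> K cK; have [r r0 Kr] := compact_cube cK.
have mK := measurable_compact_rV cK.
have L1 : L2 (\1_(cube r)).
  apply: (bkernel_L2 (k := fun x => \1_(cube r) x)); split.
    by have := intg_measurable (intg_indic_cube n r).
  by exists r, 1 => // x; rewrite mul1r ger0_norm.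
have iF := L2M (L2_norm Lf) L1.
apply: (@le_lt_trans _ _ (\int[leb]_x (`|f x| * \1_(cube r) x)%:E)%E); last first.
  by rewrite (EFin_Rint iF) ltry.
rewrite integral_mkcond; apply: ge0_le_integral => //=.
- by move=> x _; apply: erestrict_ge0 => y _; rewrite lee_fin.
- apply/(measurable_restrictT _ mK); apply: measurable_funTS.
  by apply/measurable_EFinP; apply: measurableT_comp => //; case: Lf.
- by apply/measurable_EFinP; exact: intg_measurable iF.
- move=> x _; rewrite /patch; case: ifP => xK; last by rewrite lee_fin mulr_ge0.
  by rewrite lee_fin indicE mem_set ?mulr1//; apply: Kr; rewrite inE in xK.
Qed.

Section ddiff_represents.
Context (i : 'I_n) (A A' M : Rn -> R) (H : ddiff i A A' M) (LM : L2 M).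

Lemma ddiff_represents : L2 A' -> represents A' (distr_partial A i).
Proof.
move=> LA'; split; first exact: compact_loc_integrable.
move=> psi tpsi; have [r [c c0 [_ D]]] := test_function_ddiff tpsi.
apply: (ddiff_ibp H (D i)); apply: L2M => //.
by apply: bkernel_L2; exact: bkernel_cindic.
Qed.

End ddiff_represents.

(** Incompressibility in the weak formulation is tested on W^{1,2} potentials; this makes it
    available for test functions. *)
Lemma test_function_W12 psi : test_function psi ->
  in_W12 psi (fun x => \row_i ('D_(e_ i) psi x)).
Proof.
move=> tpsi; have [r [c c0 [psic D]]] := test_function_ddiff tpsi.
have bk := bkernel_test tpsi; have [mpsi ipsi] := bkernel_L2 bk.
have Lc : L2 (fun x => c * \1_(cube r) x) by apply: bkernel_L2; exact: bkernel_cindic.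
split => //.
- rewrite /finite_norm unlock; apply: poweR_lty.
  rewrite (_ : integral _ _ _ = (\int[leb]_x (psi x ^+ 2)%:E)%E).
    by rewrite (EFin_Rint ipsi) ltry.
  by apply: eq_integral => x _; rewrite /= powR_mulrn// real_normK ?num_real.
- apply: in_L2_of_entries => j i; under eq_fun do rewrite mxE.
  exact: L2_derive_test.
- move=> i; under eq_fun do rewrite mxE.
  exact: (ddiff_represents (D i) Lc (L2_derive_test i tpsi)).
Qed.

Section constant_in_time.
Context (k : Rn -> R) (r0 : R) (H : mollifier k r0) (v : 'I_n -> Rn -> R) (T : R).
Hypothesis T0 : 0 < T.
Hypothesis Lv : forall i, L2 (v i).
Hypothesis sv : solenoidal v.

Definition mol_field (x : Rn) : Rn := \row_i mol2 k v i x.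

Definition mol_jacobian (x : Rn) : 'M[R]_n := \matrix_(i, j) dmol2 k v i j x.

Let bk : bkernel k. Proof. exact: moll_bkernel H. Qed.

Let LK f : L2 f -> L2 (convol k f). Proof. by move=> Lf; apply: L2_conv. Qed.

Let Lm i : L2 (mol2 k v i). Proof. by do 2 apply: LK. Qed.

Let Ld i j : L2 (dmol2 k v i j).
Proof. by apply: L2_conv; [exact: bkernel_dkernel H j|exact: LK]. Qed.

Let bound : exists c : R, 0 <= c /\ forall i, exists2 M, L2 M /\ (forall x, M x <= c) &
  forall j, ddiff j (mol2 k v i) (dmol2 k v i j) M.
Proof.
have /choice[C HC] : forall i, exists c : R, 0 <= c /\ exists2 M, L2 M /\ (forall x, M x <= c) &
    forall j, ddiff j (mol2 k v i) (dmol2 k v i j) M.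
  move=> i; have [M [LM [c Mc]] D] := mol2_ddiff H Lv i.
  exists c; split; first exact: le_trans (Mc 0).
  by exists M => //; split => // x; exact: le_trans (ler_norm _) (Mc x).
exists (\sum_i C i); split; first by apply: sumr_ge0 => i _; exact: (HC i).1.
move=> i; have [c0 [M [LM Mc] D]] := HC i.
exists M => //; split => // x; apply: (le_trans (Mc x)).
by rewrite (bigD1 i)//= lerDl sumr_ge0// => j _; exact: (HC j).1.
Qed.

Lemma mol_field_lipschitz : exists2 c : R, 0 <= c &
  forall x y, `|mol_field x - mol_field y| <= c * `|x - y|.
Proof.
have [c [c0 HC]] := bound; have cn0 : 0 <= 2 * c *+ n by rewrite mulrn_wge0// mulr_ge0.
exists (2 * c *+ n) => // x y.
rewrite [leLHS]mx_normrE; apply: bigmax_le; first by rewrite mulr_ge0.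
move=> [i j] _ /=; rewrite !mxE.
have [M [_ Mc] D] := HC j; exact: ddiff_lipschitz D Mc c0.
Qed.

(* Test fields that do not depend on time suffice. *)
Lemma mol_field_test : euler_test_field T (fun=> mol_field) (fun=> mol_jacobian).
Proof.
have [c [c0 HC]] := bound.
have mf : measurable_fun setT mol_field.
  by apply: measurable_fun_matrix => // i j; under eq_fun do rewrite mxE; case: (Lm j).
have mJ : measurable_fun setT mol_jacobian.
  by apply: measurable_fun_matrix => // i j; under eq_fun do rewrite mxE; case: (Ld i j).
have fb x i j : `|mol_field x i j| <= c.
  rewrite mxE; have [M [_ Mc] D] := HC j.
  exact: le_trans (ddiff_le (D j) x) (Mc x).
have Jb x i j : `|mol_jacobian x i j| <= c.
  rewrite mxE; have [M [_ Mc] D] := HC i.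
  exact: le_trans (ddiff_le' (D j) x) (Mc x).
split.
- have [K K0 HK] := mol_field_lipschitz.
  apply: (@klipschitzW _ _ _ K).
    (* The Lipschitz condition is phrased with a filter, which is proper because the domain contains
       a point at time 0. *)
    apply: (@globally_properfilter _ _ ((0 : R, 0 : Rn), (0 : R, 0 : Rn))).
    by do 2 split => //=; rewrite in_itv/= lexx ltW.
  move=> [x y] _ /=; apply: (le_trans (HK _ _)); rewrite ler_wpM2l//.
  by rewrite [leRHS]prod_normE/= le_max lexx orbT.
- move=> t _; split.
  + by apply: in_L2_of_entries => i j; under eq_fun do rewrite mxE; exact: Lm.
  + exact: in_Loo_of_bounded mf fb.
  + exact: in_Loo_of_bounded mJ Jb.
  + move=> i j; have [M [LM Mc] D] := HC i.
    have := ddiff_represents (D j) LM (Ld i j).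
    by congr represents; [|congr distr_partial]; apply/funext => x; rewrite mxE.
(* The field is constant in time, so the Lipschitz constant in time is 0. *)
- exists 0 => s t _ _; rewrite mul0r.
  have E p q (f : Rn -> 'M[R]_(p, q)) : (f \- f)%R = (fun _ : Rn => 0 : 'M[R]_(p, q)).
    by apply/funext => x; rewrite /= subrr.
  by rewrite !E; split; rewrite Lpnorm_const0.
- move=> t _; apply: aeW => x; rewrite /mxtrace -[RHS](div_conv2 H Lv sv x).
  by apply: eq_bigr => i _; rewrite mxE.
Qed.

Lemma mxdot_mol_field (f : Rn -> Rn) x :
  mxdot (f x) (mol_field x) = \sum_i f x 0 i * mol2 k v i x.
Proof. by rewrite mxdot_row; apply: eq_bigr => i _; rewrite mxE. Qed.

Lemma mxdot_mol_jacobian (f : Rn -> Rn) x :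
  mxdot ((f x)^T *m f x) (mol_jacobian x) =
  \sum_i \sum_j f x 0 i * f x 0 j * dmol2 k v i j x.
Proof.
apply: eq_bigr => i _; apply: eq_bigr => j _.
by rewrite !mxE big_ord1 mxE.
Qed.

End constant_in_time.

End test_fields.

Section integral_mono.
Context d (X : measurableType d) (R : realType) (mu : {measure set X -> \bar R}).

(* Unlike [ge0_le_integral], this requires no measurability. *)
Lemma ge0_integral_mono (f g : X -> \bar R) : (forall x, (0 <= f x)%E) ->
  (forall x, (f x <= g x)%E) -> (\int[mu]_x f x <= \int[mu]_x g x)%E.
Proof.
move=> f0 fg; have g0 x : (0 <= g x)%E := le_trans (f0 x) (fg x).
rewrite !ge0_integralTE//; apply: ereal_sup_le => _ [h hf <-].
exists h => // x.
exact: le_trans (hf x) (fg x).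
Qed.

End integral_mono.

Lemma bernoulli (R : realType) (y : R) (k : nat) : 1 <= y ->
  k.+1%:R * (y - 1) <= y ^+ k.+1 - 1.
Proof.
move=> y1; elim: k => [|k IH]; first by rewrite mul1r expr1.
have h : 1 <= y ^+ k.+1 by exact: exprn_ege1.
rewrite exprS -natr1 mulrDl mul1r (@le_trans _ _ (y ^+ k.+1 - 1 + (y - 1)))//.
  by rewrite lerD2r.
by nra.
Qed.

(** * Measurable control of the Luxemburg norm *)

Section exponential_modular.
Context (R : realType) (n p q : nat).
Local Notation Rn := 'rV[R]_n.
Local Notation leb := (lebesgue_rV R n).
Local Notation lam := (@lebesgue_measure R).

Lemma measurable_exp_integrand d (X : measurableType d) (f : X -> 'M[R]_(p, q)) (b : R) :
  measurable_fun setT f -> measurable_fun setT (fun x => expR (mxnorm2 (f x) / b) - 1).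
Proof.
move=> mf; apply: measurable_funB => //.
apply: (measurableT_comp (@measurable_expR R)).
by apply: measurable_funM => //; exact: measurable_mxnorm2.
Qed.

Lemma exp_integrand_ge0 (A : 'M[R]_(p, q)) (b : R) : 0 < b -> 0 <= expR (mxnorm2 A / b) - 1.
Proof.
by move=> b0; rewrite subr_ge0 -expR0 ler_expR divr_ge0 ?mxnorm2_ge0// ltW.
Qed.

Lemma exp_modular_mono (f : Rn -> 'M[R]_(p, q)) (b c : R) : 0 < b -> b <= c ->
  (exp_modular f c <= exp_modular f b)%E.
Proof.
move=> b0 bc; have c0 : 0 < c := lt_le_trans b0 bc.
apply: ge0_integral_mono => x; first by rewrite lee_fin exp_integrand_ge0.
by rewrite lee_fin lerD2r ler_expR ler_wpM2l ?mxnorm2_ge0// lef_pV2.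
Qed.

(** Convexity of the exponential, in the form of Bernoulli's inequality. It brings a finite modular
    below 1 by enlarging the denominator. *)
Lemma exp_modular_scale (f : Rn -> 'M[R]_(p, q)) (b : R) (k : nat) : measurable_fun setT f -> 0 < b ->
  (exp_modular f (k.+1%:R * b) <= k.+1%:R^-1%:E * exp_modular f b)%E.
Proof.
move=> mf b0; rewrite /exp_modular -ge0_integralZl_EFin//; last 2 first.
- by move=> x _; rewrite lee_fin exp_integrand_ge0.
- by apply/measurable_EFinP; exact: measurable_exp_integrand.
apply: ge0_integral_mono => x; first by rewrite lee_fin exp_integrand_ge0// mulr_gt0.
rewrite -EFinM lee_fin ler_pdivlMl ?ltr0n//.
set z := mxnorm2 _ / (_ * _); have -> : mxnorm2 (f x) / b = k.+1%:R * z.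
  by rewrite /z invfM mulrCA mulVKf.
rewrite expRM_natl; apply: bernoulli; rewrite -expR0 ler_expR.
by rewrite divr_ge0 ?mxnorm2_ge0// mulr_ge0// ltW.
Qed.

Context (S : R -> Rn -> 'M[R]_(p, q)).
Hypothesis mS : measurable_fun setT (fun z : measurableTypeR R * Rn => S z.1 z.2).

(** The index [k] stands for the level [k + 1], so that the denominator is positive. *)
Definition mod_le1 t k := (exp_modular (S t) k.+1%:R <= 1)%E.

Lemma measurable_exp_modular (b : R) : 0 < b ->
  measurable_fun setT (fun t : measurableTypeR R => exp_modular (S t) b).
Proof.
move=> b0.
apply: (measurable_fun_fubini_tonelli_F (m2 := leb)
  (fun z : measurableTypeR R * Rn => (expR (mxnorm2 (S z.1 z.2) / b) - 1)%:E)).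
  by apply/measurable_EFinP; exact: measurable_exp_integrand.
by move=> z; rewrite lee_fin exp_integrand_ge0.
Qed.

Lemma measurable_mod_le1 k : measurable [set t : measurableTypeR R | mod_le1 t k].
Proof.
by have := emeasurable_fun_infty_c measurableT (measurable_exp_modular (ltr0Sn R k)) 1%E; rewrite setTI.
Qed.

(* The least integer at which the exponential modular is at most 1 (0 if there is none):
   a measurable substitute for the Luxemburg norm, which it exceeds by at most 1. *)
Definition mexp t : nat :=
  if pselect (exists k, mod_le1 t k) is left h then (ex_minn h).+1 else 0.

Lemma mexpS t k : mexp t = k.+1 <-> mod_le1 t k /\ forall j, (j < k)%N -> ~~ mod_le1 t j.
Proof.
rewrite /mexp; case: pselect => [h|h]; last first.
  by split => // -[tk _]; case: h; exists k.
case: ex_minnP => l tl lmin; split => [[<-]|[tk kmin]].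
  by split => // j; rewrite ltnNge; apply: contraNN; exact: lmin.
congr _.+1; apply/eqP; rewrite eqn_leq lmin//= leqNgt; apply/negP => /kmin.
by rewrite tl.
Qed.

Lemma mexp_gt0 t : (exists k, mod_le1 t k) -> (0 < mexp t)%N.
Proof. by move=> h; rewrite /mexp; case: pselect. Qed.

(** The level sets of [mexp] are countable combinations of the sets where the modular is at most 1.
    An arbitrary [g] covers both [mexp] and its predecessor. *)
Lemma measurable_mexp (g : nat -> R) : measurable_fun setT (fun t : measurableTypeR R => g (mexp t)).
Proof.
have mk k : measurable [set t : measurableTypeR R | mexp t = k].
  case: k => [|k].
    rewrite [X in measurable X](_ : _ = ~` \bigcup_k [set t | mod_le1 t k]).
      by apply: measurableC; apply: bigcupT_measurable => k; exact: measurable_mod_le1.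
    apply/seteqP; split => t /=.
      by move=> t0 [k _ tk]; have := mexp_gt0 (ex_intro _ k tk); rewrite t0.
    by move=> H; rewrite /mexp; case: pselect => // -[k tk]; case: H; exists k.
  rewrite [X in measurable X](_ : _ = [set t | mod_le1 t k] `&`
    \bigcap_j (if (j < k)%N then ~` [set t | mod_le1 t j] else setT)).
    apply: measurableI; first exact: measurable_mod_le1.
    apply: bigcapT_measurable => j; case: ifP => _ //.
    by apply: measurableC; exact: measurable_mod_le1.
  apply/seteqP; split => t /=.
    move=> /mexpS[tk H]; split => // j _ /=; case: ifP => //= /H.
    by move=> /negP.
  move=> [tk H]; apply/mexpS; split => // j jk.
  by have := H j I; rewrite jk => /negP.
move=> _ B mB; rewrite setTI.
rewrite [X in measurable X](_ : _ = \bigcup_k (if g k \in B then [set t | mexp t = k] else set0)).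
  by apply: bigcupT_measurable => k; case: ifP.
apply/seteqP; split => t /=.
  by move=> gB; exists (mexp t) => //=; rewrite mem_set.
by move=> [k _] /=; case: ifP => [|//]; rewrite inE => gk ->.
Qed.

(** An admissible real below the predecessor of [mexp t] would make that predecessor admissible by
    monotonicity, against minimality. *)
Lemma mexp_le_Lexp_norm t : (((mexp t).-1)%:R%:E <= Lexp_norm (S t))%E.
Proof.
apply: le_ereal_inf_tmp => _ [b [b0 mb] <-]; rewrite lee_fin.
case E : (mexp t) => [|[|k]]; [exact: ltW|exact: ltW|].
have [_ H] := (mexpS t k.+1).1 E.
rewrite leNgt; apply/negP => bk; have := H k (leqnn _).
rewrite /mod_le1 => /negP; apply; apply: le_trans mb.
by apply: exp_modular_mono => //; exact: ltW.
Qed.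

Lemma exp_modular_mexp t : (0 < mexp t)%N -> (exp_modular (S t) (mexp t)%:R <= 1)%E.
Proof. by case E : (mexp t) => [//|k] _; have [] := (mexpS t k).1 E. Qed.

Lemma in_Lexp_mod_le1 t : in_Lexp (S t) -> exists k, mod_le1 t k.
Proof.
move=> [mSt [b b0 mb]].
have I0 : (0 <= exp_modular (S t) b)%E.
  by apply: integral_ge0 => x _; rewrite lee_fin exp_integrand_ge0.
pose r := fine (exp_modular (S t) b).
have rE : exp_modular (S t) b = r%:E by rewrite fineK// ge0_fin_numE.
(* [j + 1] exceeds the modular at [b], so the modular at [(j + 1) b] is at most 1; the level is then
   rounded up to an integer. *)
pose j := Num.truncn r; have rj : r <= j.+1%:R by rewrite ltW// truncnS_gt.
pose k := Num.truncn (j.+1%:R * b).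
exists k; rewrite /mod_le1; apply: (@le_trans _ _ (exp_modular (S t) (j.+1%:R * b))).
  by apply: exp_modular_mono; rewrite ?mulr_gt0// ltW// truncnS_gt.
apply: (le_trans (exp_modular_scale j mSt b0)).
by rewrite rE -EFinM lee_fin ler_pdivrMl ?ltr0n// mulr1.
Qed.

End exponential_modular.

(** * Weak solutions as flows *)

Section ae_witness.
Context d (X : measurableType d) (R : realType) (mu : {measure set X -> \bar R}).

Lemma ae_outside (P : X -> Prop) : (\forall x \ae mu, P x) ->
  exists A, [/\ measurable A, mu A = 0%E & forall x, ~ A x -> P x].
Proof.
move=> [A [mA A0 H]]; exists A; split => // x; apply: contra_notP => Px.
exact: H.
Qed.

Lemma ae_of_outside (P : X -> Prop) A : measurable A -> mu A = 0%E ->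
  (forall x, ~ A x -> P x) -> \forall x \ae mu, P x.
Proof. by move=> mA A0 H; exists A; split => // x /=; apply: contra_notP => /H. Qed.

End ae_witness.

Lemma null_complement_dense (R : realType) (A : set (measurableTypeR R)) (a b : R) :
  measurable A -> @lebesgue_measure R A = 0%E -> a < b ->
  exists2 t, a < t < b & ~ A t.
Proof.
move=> mA A0 ab; have [//|H] := pselect (exists2 t, a < t < b & ~ A t).
have sub : `]a, b[ `<=` A.
  move=> t; rewrite /= in_itv/= => tab; apply: contra_notP H => tA.
  by exists t.
have : (@lebesgue_measure R `]a, b[%classic <= 0)%E.
  by rewrite -A0; apply: le_measure => //; rewrite inE//; exact: measurable_itv.
by rewrite lebesgue_measure_itv/= lte_fin ab -EFinD lee_fin subr_le0 leNgt ab.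
Qed.

Section extension.
Context (R : realType) (n : nat).
Local Notation Rn := 'rV[R]_n.
Local Notation leb := (lebesgue_rV R n).
Local Notation lam := (@lebesgue_measure R).
Local Notation L2 := (L2 leb).
Local Notation N2 := (N2 leb).
Local Notation intg := (intg leb).
Local Notation RX := (measurableTypeR R * Rn)%type.

Definition cutoff (D : set R) V (f : R -> Rn -> V) (z : V) r x := if r \in D then f r x else z.

Lemma measurable_cutoff (D : set (measurableTypeR R)) T p q (f : R -> Rn -> 'M[R]_(p, q)) :
  measurable D -> D `<=` `[0, T] -> jointly_measurable T f ->
  measurable_fun setT (fun z : RX => cutoff D f 0 z.1 z.2).
Proof.
move=> mD DT mf.
have mDX : measurable (D `*` [set: Rn]) by exact: measurableX.
apply: measurable_fun_matrix => // i j.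
rewrite (_ : (fun z : RX => _) = (fun z : RX => f z.1 z.2 i j) \_ (D `*` [set: Rn])); last first.
  apply/funext => z; rewrite /patch /cutoff /=.
  have -> : (z \in D `*` setT) = (z.1 \in D).
    by apply/idP/idP; rewrite !inE => //= -[].
  by case: ifP => _ //; rewrite mxE.
apply/(measurable_restrictT _ mDX).
apply: (measurableT_comp (measurable_entry i j)); apply: measurable_funS mf.
  by apply: measurableX => //; exact: measurable_itv.
by move=> z [Dz _]; split => //; exact: DT.
Qed.

Lemma jmeas_cutoff (D : set (measurableTypeR R)) T p q (f : R -> Rn -> 'M[R]_(p, q))
    i j : measurable D -> D `<=` `[0, T] -> jointly_measurable T f ->
  jmeas (fun r x => cutoff D f 0 r x i j).
Proof.
by move=> mD DT mf; exact: (measurable_fun_entry i j (measurable_cutoff mD DT mf)).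
Qed.

(* Initial datum at time 0, [u] on the good times [D], and 0 elsewhere, so that bounds,
   measurability and solenoidality hold at every time. *)
Definition extension (D : set R) (u0 : Rn -> Rn) (u : R -> Rn -> Rn) r (i : 'I_n) x : R :=
  if r == 0 then u0 x 0 i else cutoff D u 0 r x 0 i.

Lemma jmeas_extension D T u0 u i : measurable (D : set (measurableTypeR R)) ->
  D `<=` `[0, T] -> jointly_measurable T u -> measurable_fun setT u0 ->
  jmeas (fun r => extension D u0 u r i).
Proof.
move=> mD DT mu mu0; rewrite /jmeas /extension.
apply: measurable_fun_ifT.
- apply: (measurableT_comp (f := fun r : measurableTypeR R => r == 0)); last exact: measurable_fst.
  apply: (@measurable_fun_bool _ _ _ _ true) => //.
  rewrite setTI (_ : _ @^-1` _ = [set 0])//.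
  by apply/seteqP; split => r /= /eqP.
- exact: (measurableT_comp (measurable_fun_entry 0 i mu0) measurable_snd).
- exact: jmeas_cutoff mD DT mu.
Qed.

Definition weak_identities (T : R) (u0 : Rn -> Rn) (u : R -> Rn -> Rn) (s : R) : Prop :=
  (forall phi G, euler_test_field T phi G ->
     \int[lam]_(t in `[0, s]) \int[leb]_x
       (mxdot (u t x) (derive1 (phi^~ x) t) +
        mxdot ((u t x)^T *m u t x) (G t x)) =
     (\int[leb]_x mxdot (u s x) (phi s x)) -
     \int[leb]_x mxdot (u0 x) (phi 0 x)) /\
  (forall q g, in_W12 q g -> \int[leb]_x mxdot (u s x) (g x) = 0).

Definition energy_le (u0 : Rn -> Rn) (u : R -> Rn -> Rn) (t : R) : Prop :=
  (\int[leb]_x (mxnorm2 (u t x) ^+ 2)%:E <= \int[leb]_x (mxnorm2 (u0 x) ^+ 2)%:E)%E.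

Lemma solenoidal_W12 (f : Rn -> Rn) : (forall i, L2 (fun x => f x 0 i)) ->
  (forall q g, in_W12 q g -> \int[leb]_x mxdot (f x) (g x) = 0) ->
  solenoidal (fun i x => f x 0 i).
Proof.
move=> Lf H psi tpsi; rewrite -[RHS](H _ _ (test_function_W12 tpsi)).
rewrite -Rint_sum; last by move=> i; apply: L2M => //; exact: L2_derive_test.
apply: eq_Rintegral => x _; rewrite mxdot_row; apply: eq_bigr => i _.
by rewrite mxE.
Qed.

Lemma solenoidal_div_free (f : Rn -> Rn) : div_free f -> solenoidal (fun i x => f x 0 i).
Proof.
move=> H psi tpsi; have := H psi tpsi; rewrite /distr_div /distr_partial sumrN.
by move/eqP; rewrite oppr_eq0 => /eqP.
Qed.

Section flow.
Context (T : R) (u0 : Rn -> Rn) (u : R -> Rn -> Rn) (A : set (measurableTypeR R)).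
Hypothesis T0 : 0 < T.
Hypothesis mA : measurable A.
Hypothesis A0 : lam A = 0%E.
Hypothesis mu0 : measurable_fun setT u0.
Hypothesis iu0 : intg (fun x => mxnorm2 (u0 x) ^+ 2).
Hypothesis du0 : div_free u0.
Hypothesis mu : jointly_measurable T u.
Hypothesis good : forall t, 0 < t < T -> ~ A t -> weak_identities T u0 u t /\ energy_le u0 u t.

Definition good_times : set (measurableTypeR R) := `]0, T[ `\` A.

Local Notation D := good_times.

Lemma measurable_good_times : measurable D.
Proof. by apply: measurableD => //; exact: measurable_itv. Qed.

Lemma good_timesP t : D t -> 0 < t < T /\ ~ A t.
Proof. by move=> [/=]; rewrite in_itv. Qed.

Lemma good_times_sub : D `<=` `[0, T].
Proof. by move=> t /good_timesP[/andP[t0 tT] _]; rewrite /= in_itv/= !ltW. Qed.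

(** Time 0 is added by hand: the weak identities are known at almost every time of the open
    interval, and the evolution has to start from the datum. *)
Definition start_or_good : set R := [set t | t = 0 \/ D t].

Lemma start_or_good_bound t : start_or_good t -> 0 <= t <= T.
Proof.
by move=> [->|/good_timesP[/andP[t0 tT] _]]; rewrite ?lexx ltW// ltW.
Qed.

Lemma start_or_good_dense (a b : R) : 0 <= a -> a < b -> b <= T ->
  exists2 t, start_or_good t & a < t < b.
Proof.
move=> a0 ab bT.
have [t /andP[at_ tb] tA] := null_complement_dense mA A0 ab.
exists t; last by rewrite at_ tb.
by right; split => //=; rewrite in_itv/= (le_lt_trans a0 at_) (lt_le_trans tb).
Qed.

Let ut := extension D u0 u.

Let D0 t : D t -> t != 0.
Proof. by move=> /good_timesP[/andP[t0 _] _]; rewrite gt_eqF. Qed.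

Lemma extension_good t : D t -> ut t = fun i x => u t x 0 i.
Proof.
move=> Dt; apply/funext => i; apply/funext => x.
by rewrite /ut /extension (negbTE (D0 Dt)) /cutoff mem_set.
Qed.

Lemma extension0 : ut 0 = fun i x => u0 x 0 i.
Proof. by apply/funext => i; apply/funext => x; rewrite /ut /extension eqxx. Qed.

Lemma extension_out t i x : ~ start_or_good t -> ut t i x = 0.
Proof.
move=> Gt; rewrite /ut /extension /cutoff.
have [t0|_] := eqVneq t 0; first by case: Gt; left.
by rewrite memNset ?mxE// => Dt; apply: Gt; right.
Qed.

Lemma measurable_good_slice t : D t -> measurable_fun setT (u t).
Proof.
move=> Dt; apply: measurable_fun_matrix => // i j.
have := jmeas_slice t (jmeas_cutoff i j measurable_good_times good_times_sub mu).
by rewrite /cutoff mem_set.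
Qed.

Lemma good_slice_energy t : D t -> intg (fun x => mxnorm2 (u t x) ^+ 2) /\
  \int[leb]_x (mxnorm2 (u t x) ^+ 2) <= \int[leb]_x (mxnorm2 (u0 x) ^+ 2).
Proof.
move=> Dt; have [tT At] := good_timesP Dt.
have [_ H] := good tT At; rewrite /energy_le (EFin_Rint iu0) in H.
have iu : intg (fun x => mxnorm2 (u t x) ^+ 2).
  apply: ge0_intg; last exact: (le_lt_trans H (ltry _)).
    by apply: measurable_funX; apply: measurable_mxnorm2; exact: measurable_good_slice.
  by move=> x; exact: sqr_ge0.
by split=> //; rewrite (EFin_Rint iu) lee_fin in H.
Qed.

Definition init_energy := \int[leb]_x (mxnorm2 (u0 x) ^+ 2).

Lemma N2_rowE (f : Rn -> Rn) : (forall i, L2 (fun x => f x 0 i)) ->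
  \sum_i N2 (fun x => f x 0 i) = \int[leb]_x (mxnorm2 (f x) ^+ 2).
Proof.
move=> Lf; rewrite -Rint_sum; last by move=> i; case: (Lf i).
by apply: eq_Rintegral => x _; rewrite mxnorm2_rowE.
Qed.

Lemma extension_cases (P : R -> ('I_n -> Rn -> R) -> Prop) t :
  (D t -> P t (fun i x => u t x 0 i)) -> P 0 (fun i x => u0 x 0 i) ->
  P t (fun _ _ => 0) -> P t (ut t).
Proof.
move=> P1 P0 P2; have [[->|Dt]|Gt] := pselect (start_or_good t).
- by rewrite extension0.
- by rewrite extension_good//; exact: P1.
- rewrite (_ : ut t = fun _ _ => 0)//.
  by apply/funext => i; apply/funext => x; exact: extension_out.
Qed.

Lemma L2_init i : L2 (fun x => u0 x 0 i). Proof. exact: L2_entry. Qed.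

Lemma L2_good t i : D t -> L2 (fun x => u t x 0 i).
Proof.
move=> Dt; apply: L2_entry; first exact: measurable_good_slice.
by case: (good_slice_energy Dt).
Qed.

Lemma L2_extension t i : L2 (ut t i).
Proof.
apply: (extension_cases (P := fun _ v => L2 (v i))) => [Dt| |].
- exact: L2_good.
- exact: L2_init.
- exact: (@L20 _ _ _ leb).
Qed.

Lemma extension_energy t : \sum_i N2 (ut t i) <= init_energy.
Proof.
apply: (extension_cases (P := fun _ v => \sum_i N2 (v i) <= init_energy)) => [Dt| |].
- rewrite (N2_rowE (f := u t)); last by move=> i; exact: L2_good.
  by case: (good_slice_energy Dt).
- by rewrite (N2_rowE (f := u0)) => [|i]; [exact: lexx|exact: L2_init].
- rewrite big1; first by apply: Rintegral_ge0 => x _; exact: sqr_ge0.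
  by move=> i _; rewrite -[RHS](Rint0 leb); apply: eq_Rintegral => x _; rewrite expr0n.
Qed.

Lemma extension_N2 t i : N2 (ut t i) <= init_energy.
Proof.
apply: le_trans (extension_energy t); rewrite (bigD1 i)//= lerDl.
by apply: sumr_ge0 => j _; exact: N2_ge0.
Qed.

Lemma extension_solenoidal t : solenoidal (ut t).
Proof.
apply: (extension_cases (P := fun _ v => solenoidal v)) => [Dt| |].
- have [tT At] := good_timesP Dt; have [[_ H] _] := good tT At.
  by apply: (solenoidal_W12 _ H) => i; exact: L2_good.
- exact: solenoidal_div_free.
- move=> psi _; apply: big1 => i _; rewrite -[RHS](Rint0 leb).
  by apply: eq_Rintegral => x _; rewrite mul0r.
Qed.

Lemma ae_good s : s < T -> \forall t \ae lam, 0 <= t <= s -> D t.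
Proof.
move=> sT; apply: (@ae_of_outside _ _ _ lam _ (A `|` [set 0])).
- by apply: measurableU => //; exact: measurable_set1.
- by apply: (etrans _ A0); apply: measureU0 => //; exact: lebesgue_measure_set1.
- move=> t H /andP[t0 ts]; split; last by move=> At; apply: H; left.
  rewrite /= in_itv/= (le_lt_trans ts sT) andbT lt_neqAle t0 andbT.
  by apply/eqP => t00; apply: H; right.
Qed.

Section mollified_flow.
Context (k : Rn -> R) (r0 : R) (H : mollifier k r0).
Context (v : 'I_n -> Rn -> R) (Lv : forall i, L2 (v i)) (sv : solenoidal v).

Let LKK i : L2 (mol2 k v i).
Proof. by have bk := moll_bkernel H; do 2 apply: L2_conv => //. Qed.

Lemma pair2_rowE (f : Rn -> Rn) : (forall i, L2 (fun x => f x 0 i)) ->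
  \int[leb]_x mxdot (f x) (mol_field k v x) = pair2 k (fun i x => f x 0 i) v.
Proof.
move=> Lf; rewrite /pair2 -Rint_sum; last by move=> i; exact: L2M.
by apply: eq_Rintegral => x _; rewrite mxdot_mol_field.
Qed.

(** [u] is measurable on the strip only, and [ut] may differ from it at bad times. This measurable
    extension equals [u] on all of [[0, T]] and so mediates between the integral of the weak
    formulation and that of [ut]. *)
Let uc := cutoff `[0, T] u 0.

Let juc i : jmeas (fun r x => uc r x 0 i).
Proof. by apply: (jmeas_cutoff 0 i _ _ mu) => //; exact: measurable_itv. Qed.

Let inner r := \int[leb]_x mxdot ((uc r x)^T *m uc r x) (mol_jacobian k v x).

Let minner : measurable_fun setT (inner : measurableTypeR R -> R).
Proof.
apply: (jmeas_Rint (f := fun r x => mxdot ((uc r x)^T *m uc r x) (mol_jacobian k v x))).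
rewrite (_ : (fun r x => _) = (fun r x => \sum_i \sum_j uc r x 0 i * uc r x 0 j * dmol2 k v i j x)).
  apply: measurable_sum => i; apply: measurable_sum => j.
  apply: (jmeasM (f := fun r x => uc r x 0 i * uc r x 0 j) (g := fun r => dmol2 k v i j)).
    exact: jmeasM.
  by apply: jmeas_space; exact: measurable_dmol2 H _ _ j (Lv i).
by apply/funext => r; apply/funext => x; exact: mxdot_mol_jacobian.
Qed.

Lemma extension_eq s : start_or_good s ->
  pair2 k (ut s) v - pair2 k (ut 0) v = \int[lam]_r (tri k (ut r) v * upto s r).
Proof.
move=> [->|Ds]; first by rewrite subrr Rint_upto0.
have [sT As] := good_timesP Ds; have [[W _] _] := good sT As.
rewrite extension0 extension_good// -!pair2_rowE => [|i|i]; last 2 first.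
- exact: L2_init.
- exact: L2_good.
rewrite -(W _ _ (mol_field_test H T0 Lv sv)).
case/andP: sT => s0 sT.
transitivity (\int[lam]_(r in `[0, s]) inner r).
  apply: eq_Rintegral => r; rewrite inE/= in_itv/= => /andP[r0' rs].
  (* The test field does not depend on time, so the term with its time derivative drops out. *)
  apply: eq_Rintegral => x _; rewrite derive1_cst.
  rewrite (_ : uc r x = u r x).
    by rewrite [X in X + _](_ : _ = 0) ?add0r// mxdot_row big1// => i _; rewrite mxE mulr0.
  by rewrite /uc /cutoff mem_set//= in_itv/= r0'/= (le_trans rs)// ltW.
rewrite -Rint_upto_itv; apply: (@ae_eq_Rint _ _ _ lam).
- exact (measurable_funM minner (measurable_upto s)).
- apply: measurable_funM; last exact: measurable_upto.
  apply: (measurable_tri H (v := fun=> v)) => i; last first.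
    by apply: jmeas_space; case: (Lv i).
  by apply: (jmeas_extension i measurable_good_times good_times_sub).
- apply: (@ae_imp _ _ _ lam _ _ _ (ae_good sT)) => r Hr.
  have [r0s|r0s] := boolP (0 <= r <= s); last first.
    by rewrite /upto indicE memNset ?mulr0//= in_itv/=; exact/negP.
  congr (_ * _); have Dr := Hr r0s; rewrite extension_good//.
  rewrite /inner /tri.
  have Lr i := L2_good i Dr.
  rewrite (_ : \sum_i _ = \int[leb]_x (\sum_i \sum_j u r x 0 i * u r x 0 j * dmol2 k v i j x)).
    apply: eq_Rintegral => x _; rewrite mxdot_mol_jacobian /uc /cutoff mem_set//.
    exact: good_times_sub.
  rewrite Rint_sum; last by move=> i; apply: intg_sum => j; exact: (tri_intg H j Lr (Lv i)).
  apply: eq_bigr => i _; rewrite Rint_sum// => j.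
  exact: (tri_intg H j Lr (Lv i)).
Qed.

End mollified_flow.

Lemma extension_flow k r0 (H : mollifier k r0) : euler_flow k init_energy start_or_good ut.
Proof.
split.
- by move=> i; exact: (jmeas_extension i measurable_good_times good_times_sub).
- exact: L2_extension.
- exact: extension_N2.
- exact: extension_solenoidal.
- by move=> r i x; exact: extension_out.
- by move=> v Lv sv s; exact: (extension_eq H Lv sv).
Qed.

End flow.

End extension.

Section powers.
Context (R : realType).

(** The two solutions come with their own exponents; this allows working with the smaller one for
    both. *)
Lemma powR_interpolation (x s s1 : R) : 0 <= x -> 0 < s -> s <= s1 ->
  x `^ (2 + s) <= x ^+ 2 + x `^ (2 + s1).
Proof.
move=> x0 s0 ss1; have [x1|/ltW x1] := leP x 1.
  apply: (@le_trans _ _ (x ^+ 2)); last by rewrite lerDl powR_ge0.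
  rewrite powRD; last by rewrite gt_eqF// addr_gt0.
  rewrite powR_mulrn// ler_piMr ?sqr_ge0//.
  have one : 1 `^ s = 1 :> R by rewrite powR1.
  rewrite -[leRHS]one; apply: ge0_ler_powR; rewrite ?nnegrE//; exact: ltW.
apply: (@le_trans _ _ (x `^ (2 + s1))); last by rewrite lerDr sqr_ge0.
by apply: ler_powR => //; rewrite lerD2l.
Qed.

Lemma max_sqr_le (x y : R) : 0 <= x -> 0 <= y ->
  2 * x ^+ 2 + 2 * y ^+ 2 <= 2 ^+ 2 * Num.max x y ^+ 2.
Proof. by move=> x0 y0; case: (leP x y) => ?; nra. Qed.

Lemma max_dominated (x y s s1 s2 : R) : 0 <= x -> 0 <= y -> 0 < s -> s <= s1 -> s <= s2 ->
  (2 * Num.max x y) ^+ 2 + (2 * Num.max x y) `^ (2 + s) <=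
  (4 + 2 `^ (2 + s)) * ((x ^+ 2 + x `^ (2 + s1)) + (y ^+ 2 + y `^ (2 + s2))).
Proof.
move=> x0 y0 s0 s01 s02; set z := Num.max x y.
have z0 : 0 <= z by rewrite le_max x0.
set X := x ^+ 2 + _; set Y := y ^+ 2 + _.
have X0 : 0 <= X by rewrite addr_ge0 ?sqr_ge0 ?powR_ge0.
have Y0 : 0 <= Y by rewrite addr_ge0 ?sqr_ge0 ?powR_ge0.
have z2 : z ^+ 2 <= X + Y.
  rewrite /z; case: (leP x y) => _.
    by apply: (@le_trans _ _ Y); [rewrite lerDl powR_ge0|rewrite lerDr].
  by apply: (@le_trans _ _ X); [rewrite lerDl powR_ge0|rewrite lerDl].
have zs : z `^ (2 + s) <= X + Y.
  rewrite /z; case: (leP x y) => _.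
    by apply: (le_trans (powR_interpolation y0 s0 s02)); rewrite lerDr.
  by apply: (le_trans (powR_interpolation x0 s0 s01)); rewrite lerDl.
rewrite powRM// (mulrDl 4); apply: lerD; last by rewrite ler_wpM2l// powR_ge0.
rewrite exprMn (_ : 2 ^+ 2 = 4 :> R) ?ler_wpM2l//.
by rewrite -natrX.
Qed.

End powers.

(** * From weak solutions to good slices *)

Section core.
Context (R : realType) (n : nat) (T : R).
Local Notation Rn := 'rV[R]_n.
Local Notation leb := (lebesgue_rV R n).
Local Notation lam := (@lebesgue_measure R).
Context (u0 : Rn -> Rn) (u U : R -> Rn -> Rn) (S : R -> Rn -> 'M[R]_n).
Context (A : set (measurableTypeR R)) (s1 s2 M1 M2 : R).
Hypotheses (T0 : 0 < T) (mA : measurable A) (A0 : lam A = 0%E).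
Hypothesis iu0 : in_Lp 2%:E u0.
Hypothesis du0 : div_free u0.
Hypothesis mu : jointly_measurable T u.
Hypothesis mU : jointly_measurable T U.
Hypothesis mS : jointly_measurable T S.
Hypotheses (s10 : 0 < s1) (s20 : 0 < s2).
Hypothesis gu : forall t, 0 < t < T -> ~ A t -> weak_identities T u0 u t /\ energy_le u0 u t.
Hypothesis gU : forall t, 0 < t < T -> ~ A t -> weak_identities T u0 U t /\ energy_le u0 U t.
Hypothesis pu : forall t, 0 < t < T -> ~ A t -> (Lpnorm (2 + s1)%:E (u t) <= M1%:E)%E.
Hypothesis pU : forall t, 0 < t < T -> ~ A t -> (Lpnorm (2 + s2)%:E (U t) <= M2%:E)%E.
Hypothesis eS : forall t, 0 < t < T -> ~ A t -> in_Lexp (S t) /\ sym_gradient (U t) (S t).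
Hypothesis iS : (\int[lam]_(t in `[0%R, T]) Lexp_norm (S t) < +oo)%E.

Local Notation D := (good_times T A).
Local Notation G := (start_or_good T A).
Local Notation E := (init_energy u0).

Let i0 : intg leb (fun x => mxnorm2 (u0 x) ^+ 2). Proof. exact: Lpnorm2_sqr. Qed.
Let mu0 : measurable_fun setT u0. Proof. by case: iu0. Qed.
Let mD : measurable D. Proof. exact: measurable_good_times. Qed.
Let DT : D `<=` `[0, T]. Proof. exact: good_times_sub. Qed.

Let s := Num.min s1 s2.
Let s0 : 0 < s. Proof. by rewrite lt_min s10. Qed.
Let ss1 : s <= s1. Proof. by rewrite ge_min lexx. Qed.
Let ss2 : s <= s2. Proof. by rewrite ge_min lexx orbT. Qed.
Let Pf (x : R) := x ^+ 2 + x `^ (2 + s).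
Let CP := (4 + 2 `^ (2 + s)) * ((E + M1 `^ (2 + s1)) + (E + M2 `^ (2 + s2))).
(** The factor 2 makes [a^2] dominate [|u - U|^2 <= 2 |u|^2 + 2 |U|^2] as well as each field. *)
Let a r x := 2 * Num.max (mxnorm2 (u r x)) (mxnorm2 (U r x)).
Let Sc := cutoff D S 0.
Let m r : R := if r \in D then (mexp Sc r)%:R else 0.

Let mSc : measurable_fun setT (fun z : measurableTypeR R * Rn => Sc z.1 z.2).
Proof. exact: measurable_cutoff mD DT mS. Qed.

Let E0 : 0 <= E. Proof. by apply: Rintegral_ge0 => x _; exact: sqr_ge0. Qed.

Let CP0 : 0 <= CP.
Proof. by rewrite mulr_ge0// !addr_ge0// ?powR_ge0. Qed.

Let Sc_good t : D t -> Sc t = S t.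
Proof. by move=> Dt; rewrite /Sc; apply/funext => x; rewrite /cutoff mem_set. Qed.

Let mexp_good t : D t -> (0 < mexp Sc t)%N.
Proof.
move=> Dt; have [tT At] := good_timesP Dt; have [H _] := eS tT At.
by apply: mexp_gt0; apply: in_Lexp_mod_le1; rewrite Sc_good.
Qed.

Let row_le (b : 'rV[R]_n) i : `|b 0 i| <= mxnorm2 b. Proof. exact: mxnorm2_entry. Qed.

Let a_ge x r : mxnorm2 (u r x) <= a r x /\ mxnorm2 (U r x) <= a r x.
Proof.
have z0 : 0 <= Num.max (mxnorm2 (u r x)) (mxnorm2 (U r x)) by rewrite le_max mxnorm2_ge0.
have H : Num.max (mxnorm2 (u r x)) (mxnorm2 (U r x)) <= a r x by rewrite /a ler_peMl// ler1n.
by split; apply: le_trans H; rewrite le_max lexx ?orbT.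
Qed.

Let a0 r x : 0 <= a r x.
Proof. by apply: le_trans (a_ge x r).1; exact: mxnorm2_ge0. Qed.

Let sqr_sub_le (x y : R) : (x - y) ^+ 2 <= 2 * x ^+ 2 + 2 * y ^+ 2.
Proof. by have := sqr_ge0 (x + y); nra. Qed.

Let slice t : D t ->
  good_slice Pf CP (extension D u0 u t) (extension D u0 U t)
    (fun i j x => Sc t x i j) (fun x => mxnorm2 (Sc t x)) (a t) (m t).
Proof.
move=> Dt; have [tT At] := good_timesP Dt.
have mut : measurable_fun setT (u t) by exact: (measurable_good_slice mA mu Dt).
have mUt : measurable_fun setT (U t) by exact: (measurable_good_slice mA mU Dt).
have mnu := measurable_mxnorm2 mut; have mnU := measurable_mxnorm2 mUt.
have ma : measurable_fun setT (a t) by apply: measurable_funM => //; exact: measurable_maxr.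
have p10 : 0 < 2 + s1 by rewrite addr_gt0.
have p20 : 0 < 2 + s2 by rewrite addr_gt0.
have [iu1 ru1] := Lpnorm_powR p10 mut (pu tT At).
have [iU1 rU1] := Lpnorm_powR p20 mUt (pU tT At).
have [iu2 ru2] := good_slice_energy mA i0 mu gu Dt.
have [iU2 rU2] := good_slice_energy mA i0 mU gU Dt.
pose Q x := (4 + 2 `^ (2 + s)) * ((mxnorm2 (u t x) ^+ 2 + mxnorm2 (u t x) `^ (2 + s1)) +
  (mxnorm2 (U t x) ^+ 2 + mxnorm2 (U t x) `^ (2 + s2))).
have iQ : intg leb Q by apply: intgZ; apply: intgD; exact: intgD.
have PQ x : Pf (a t x) <= Q x.
  by apply: max_dominated => //; exact: mxnorm2_ge0.
have P0 x : 0 <= Pf x by rewrite addr_ge0 ?sqr_ge0 ?powR_ge0.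
have iP : intg leb (fun x => Pf (a t x)).
  apply: (intg_le _ _ iQ); last by move=> x; rewrite ger0_norm.
  apply: measurable_funD; first exact: measurable_funX.
  exact: (measurableT_comp (measurable_powR _) ma).
have mt : m t = (mexp Sc t)%:R by rewrite /m mem_set.
have m0 : 0 < m t by rewrite mt ltr0n; exact: mexp_good.
have [_ symS] := eS tT At.
have mSt : measurable_fun setT (Sc t).
  by apply: measurable_fun_matrix => // i j; exact: (jmeas_slice t (jmeas_cutoff i j mD DT mS)).
have mod1 : (exp_modular (Sc t) (m t) <= 1)%E by rewrite mt exp_modular_mexp// mexp_good.
have iexp : intg leb (fun x => expR (mxnorm2 (Sc t x) / m t) - 1).
  apply: ge0_intg.
  - exact: measurable_exp_integrand.
  - by move=> x; exact: exp_integrand_ge0.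
  - exact: (le_lt_trans mod1 (ltry _)).
split.
- exact: m0.
- exact: ma.
- exact: a0.
- exact: iP.
- apply: (@le_trans _ _ (\int[leb]_x Q x)); first exact: Rint_le.
  rewrite RintZ; last by apply: intgD; exact: intgD.
  apply: ler_wpM2l; first by rewrite addr_ge0 ?powR_ge0.
  rewrite RintD; [|exact: intgD|exact: intgD].
  by rewrite RintD// RintD//; apply: lerD; exact: lerD.
- exact: measurable_mxnorm2.
- by move=> x; exact: mxnorm2_ge0.
- by move=> i j; exact: measurable_fun_entry.
- by move=> i j x; exact: mxnorm2_entry.
- by move=> b x; exact: quadratic_form_le.
- exact: iexp.
- by rewrite /exp_modular (EFin_Rint iexp) lee_fin in mod1.
- rewrite (extension_good u0 U Dt) Sc_good// => i j psi tpsi.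
  have [_ H] := symS i j; rewrite (H psi tpsi) /distr_sym_grad /distr_partial.
  by rewrite -opprD.
- split; first exact: (extension_solenoidal mA i0 du0 mu gu).
  move=> i; rewrite (extension_good u0 u Dt); split; first exact: measurable_fun_entry.
  by move=> x; apply: (le_trans (row_le _ _)); exact: (a_ge x t).1.
- split; first exact: (extension_solenoidal mA i0 du0 mU gU).
  move=> i; rewrite (extension_good u0 U Dt); split; first exact: measurable_fun_entry.
  by move=> x; apply: (le_trans (row_le _ _)); exact: (a_ge x t).2.
- move=> x; rewrite (extension_good u0 u Dt) (extension_good u0 U Dt).
  apply: (@le_trans _ _ (\sum_i (2 * u t x 0 i ^+ 2 + 2 * U t x 0 i ^+ 2))).
    by apply: ler_sum => i _; exact: sqr_sub_le.
  rewrite big_split/= -!mulr_sumr -!mxnorm2_rowE /a exprMn.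
  by apply: max_sqr_le; exact: mxnorm2_ge0.
Qed.

(** On good times [mexp] exceeds by 1 its predecessor, which is at most the Luxemburg norm, and
    [upto T] accounts for the extra 1. The Luxemburg norm is not known to be measurable in time, so
    the comparison goes through [ge0_integral_mono]. *)
Let im : intg lam m.
Proof.
have mm : measurable_fun setT (m : measurableTypeR R -> R).
  apply: measurable_fun_ifT => //.
    apply: (@measurable_fun_bool _ _ _ _ true) => //.
    by rewrite setTI (_ : _ @^-1` _ = D)//; apply/seteqP; split => r /=; [exact: set_mem|exact: mem_set].
  exact: (measurable_mexp mSc (fun k => k%:R)).
pose h (r : R) : R := if r \in D then ((mexp Sc r).-1)%:R else 0.
have mh : measurable_fun setT (h : measurableTypeR R -> R).
  apply: measurable_fun_ifT => //.
    apply: (@measurable_fun_bool _ _ _ _ true) => //.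
    by rewrite setTI (_ : _ @^-1` _ = D)//; apply/seteqP; split => r /=; [exact: set_mem|exact: mem_set].
  exact: (measurable_mexp mSc (fun k => (k.-1)%:R)).
have h0 r : 0 <= h r by rewrite /h; case: ifP.
have ih : intg lam h.
  apply: (@ge0_intg _ _ _ lam) => //.
  apply: le_lt_trans iS; rewrite [X in (_ <= X)%E]integral_mkcond.
  apply: (@ge0_integral_mono _ _ _ lam); first by move=> r; rewrite lee_fin.
  move=> r; rewrite /h /patch; case: ifPn => [rD|_].
    rewrite mem_set; last by apply: DT; rewrite inE in rD.
    by rewrite -(Sc_good (set_mem rD)); exact: mexp_le_Lexp_norm.
  case: ifP => _ //; apply: le_ereal_inf_tmp => _ [b [b0 _] <-].
  by rewrite lee_fin ltW.
have := @intg_le _ _ _ lam m (fun r => h r + upto T r); apply => //.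
  move=> r; rewrite /m /h; have /andP[up0 _] := upto01 T r; case: ifPn => [rD|_].
    have -> : upto T r = 1 by rewrite /upto indicE mem_set//; apply: DT; rewrite inE in rD.
    by rewrite ger0_norm// natr1 prednK//; apply: mexp_good; rewrite inE in rD.
  by rewrite normr0 add0r.
by apply: (@intgD _ _ _ lam) => //; exact: intg_upto.
Qed.

Lemma good_times_uniqueness t : D t -> \forall x \ae leb, u t x = U t x.
Proof.
move=> Dt; have [N N0 young] := young_powR s0.
have Pf2 x : 0 <= x -> x ^+ 2 <= Pf x by move=> _; rewrite lerDl powR_ge0.
have ext0 : \sum_i N2 leb (extension D u0 u 0 i) = E.
  by rewrite extension0; apply: N2_rowE => i; exact: L2_init.
have H := @flow_uniqueness R n Pf N N0 CP young Pf2 E T G (extension D u0 u) (extension D u0 U)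
  (fun r i j x => Sc r x i j) (fun r x => mxnorm2 (Sc r x)) a m T0.
have {}H : \forall x \ae leb, forall i, extension D u0 u t i x = extension D u0 U t i x.
  apply: H.
  - by left.
  - exact: start_or_good_bound.
  - exact: (start_or_good_dense mA A0).
  - by move=> l; exact: (extension_flow T0 mA A0 iu0.1 i0 du0 mu gu (mollifier_moll R n l)).
  - by move=> l; exact: (extension_flow T0 mA A0 iu0.1 i0 du0 mU gU (mollifier_moll R n l)).
  - by move=> i; rewrite !extension0.
  - by move=> r _; rewrite ext0; exact: (extension_energy mA iu0.1 i0 mu gu).
  - by move=> r _; rewrite ext0; exact: (extension_energy mA iu0.1 i0 mU gU).
  - by move=> r [->|Dr]; [rewrite eqxx|move=> _; exact: slice].
  - by move=> i j; exact: (jmeas_cutoff i j mD DT mS).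
  - exact: (measurable_mxnorm2 mSc).
  - exact: im.
  - by move=> r; rewrite /m; case: ifP.
  - exact: CP0.
  - by right.
rewrite (extension_good u0 u Dt) (extension_good u0 U Dt) in H.
by apply: (@ae_imp _ _ _ leb _ _ _ H) => x Hx; apply/rowP.
Qed.

End core.

Lemma ae_and d (X : measurableType d) (R : realType) (mu : {measure set X -> \bar R})
    (P Q : X -> Prop) : (\forall x \ae mu, P x) -> (\forall x \ae mu, Q x) ->
  \forall x \ae mu, P x /\ Q x.
Proof. exact: filterI. Qed.

(** * Uniqueness almost everywhere and for weakly continuous representatives *)

Section representatives.
Context (R : realType) (n : nat) (T : R).
Local Notation Rn := 'rV[R]_n.
Local Notation leb := (lebesgue_rV R n).
Local Notation lam := (@lebesgue_measure R).
Hypothesis T0 : 0 < T.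

(** A null set has dense complement in [[0, T]], so a nonzero value would persist at some point
    outside it. *)
Lemma continuous_ae0 (h : R -> R) : {within `[0, T], continuous h} ->
  (\forall s \ae lam, s \in `[0, T] -> h s = 0) -> forall t, t \in `[0, T] -> h t = 0.
Proof.
move=> ch /(@ae_outside _ _ _ lam)[A [mA A0 hA]] t tT.
apply/eqP; apply/negP => /negP ht; have ht0 : 0 < `|h t| by rewrite normr_gt0.
have tT' : `[0, T]%classic t by [].
have /cvgrPdist_lt/(_ _ ht0) := (subspace_continuousP _ _).1 ch t tT'.
rewrite /= near_withinE => /nbhs_ballP[e /= e0 He].
move: tT; rewrite in_itv/= => /andP[t0 tT].
have ab : Num.max 0 (t - e) < Num.min T (t + e).
  by rewrite lt_min !gt_max T0 /=; apply/and3P; split; lra.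
have [s /andP[]] := null_complement_dense mA A0 ab.
rewrite gt_max lt_min => /andP[s0 se] /andP[sT es] sA.
have sI : s \in `[0, T] by rewrite in_itv/= !ltW.
have bs : ball t e s by rewrite /ball/= ltr_distlC; apply/andP; split; lra.
have : `|h t - h s| < `|h t| := He s bs sI; rewrite (hA s sA sI) subr0.
by rewrite ltxx.
Qed.

Lemma in_L2_row (f : Rn -> Rn) i : in_Lp 2%:E f -> L2 leb (fun x => f x 0 i).
Proof. by move=> Lf; apply: L2_entry; [case: Lf|exact: Lpnorm2_sqr]. Qed.

Lemma intg_mxdot (f g : Rn -> Rn) : in_Lp 2%:E f -> in_Lp 2%:E g ->
  intg leb (fun x => mxdot (f x) (g x)).
Proof.
move=> Lf Lg; under eq_fun do rewrite mxdot_row.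
by apply: intg_sum => i; apply: L2M; exact: in_L2_row.
Qed.

Lemma weakly_continuous_unique (u U w W : R -> Rn -> Rn) : eq_as_L2_valued T u U ->
  weakly_continuous_repr T u w -> weakly_continuous_repr T U W ->
  forall t, t \in `[0, T] -> \forall x \ae leb, w t x = W t x.
Proof.
move=> uU [Lw cw uw] [LW cW UW] t tT.
(* The difference at the fixed time [t] is itself the test vector: the continuous function [h]
   vanishes almost everywhere, hence at [t], where it is the squared norm of [v]. *)
pose v x := w t x - W t x.
have Lv : in_Lp 2%:E v.
  apply: in_L2_of_entries => i j; rewrite ord1.
  rewrite (_ : (fun x => v x 0 j) = (fun x => w t x 0 j - W t x 0 j)).
    by apply: L2B; apply: in_L2_row; [exact: Lw|exact: LW].
  by apply/funext => x; rewrite !mxE.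
pose h s := (\int[leb]_x mxdot (w s x) (v x)) - \int[leb]_x mxdot (W s x) (v x).
have ch : {within `[0, T], continuous h}.
  by move=> s; apply: cvgB; [exact: cw Lv s|exact: cW Lv s].
have h0 : h t = 0.
  apply: (continuous_ae0 ch _ tT).
  apply: (@ae_imp _ _ _ lam _ _ _ (ae_and (ae_and uU uw) UW)) => s [[H1 H2] H3] sT.
  apply/eqP; rewrite subr_eq0; apply/eqP.
  have iw := intg_mxdot (Lw s sT) Lv; have iW := intg_mxdot (LW s sT) Lv.
  apply: ae_eq_Rint; [exact: intg_measurable iw|exact: intg_measurable iW|].
  apply: (@ae_imp _ _ _ leb _ _ _ (ae_and (ae_and (H1 sT) (H2 sT)) (H3 sT))) => x.
  by move=> [[e1 e2] e3]; rewrite -e2 -e3 e1.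
have iv := Lpnorm2_sqr Lv.
have {h0}v0 : \int[leb]_x (mxnorm2 (v x) ^+ 2) = 0.
  rewrite -h0 /h -RintB; [|exact: intg_mxdot (Lw t tT) Lv|exact: intg_mxdot (LW t tT) Lv].
  apply: eq_Rintegral => x _; rewrite mxnorm2_rowE !mxdot_row -sumrB.
  by apply: eq_bigr => i _; rewrite !mxE -mulrBl expr2.
have v20 x : 0 <= mxnorm2 (v x) ^+ 2 by exact: sqr_ge0.
apply: (@ae_imp _ _ _ leb _ _ _ (Rint0_ae iv v20 v0)) => x /eqP.
rewrite sqrf_eq0 => /eqP v0x; apply/rowP => i; apply/eqP; rewrite -subr_eq0.
have := mxnorm2_entry (v x) 0 i; rewrite v0x normr_le0 !mxE.
by [].
Qed.

Lemma in_X_good (u0 : Rn -> Rn) (u : R -> Rn -> Rn) : in_X T u0 u ->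
  jointly_measurable T u /\ exists s M : R, 0 < s /\
  \forall t \ae lam, 0 < t < T ->
    (weak_identities T u0 u t /\ energy_le u0 u t) /\ (Lpnorm (2 + s)%:E (u t) <= M%:E)%E.
Proof.
move=> [[[ju _] wu] au [s s0 [_ [M HM]]]]; split => //; exists s, M; split => //.
apply: (@ae_imp _ _ _ lam _ _ _ (ae_and (ae_and wu au) HM)) => t [[Hw Ha] HM'] tT.
have tT' : t \in `]0, T[ by rewrite in_itv.
have tT'' : t \in `[0, T] by move: tT => /andP[? ?]; rewrite in_itv/= !ltW.
split; last exact: HM'.
by split; [exact: Hw|exact: Ha].
Qed.

Lemma uniqueness_L2_valued (u0 : Rn -> Rn) (u U : R -> Rn -> Rn) : in_Lp 2%:E u0 -> div_free u0 ->
  in_X T u0 u -> in_X T u0 U -> sym_gradient_in_L1_Lexp T U -> eq_as_L2_valued T u U.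
Proof.
move=> Lu0 du0 Xu XU [S [jS eS iS] sS].
have [ju [s1 [M1 [s10 Hu]]]] := in_X_good Xu.
have [jU [s2 [M2 [s20 HU]]]] := in_X_good XU.
(* A single null set collects the exceptional times of all the hypotheses. *)
have [A [mA A0 HA]] := ae_outside (ae_and (ae_and Hu HU) (ae_and eS sS)).
have H t : good_times T A t -> \forall x \ae leb, u t x = U t x.
  apply: (good_times_uniqueness T0 mA A0 Lu0 du0 ju jU jS s10 s20 (M1 := M1) (M2 := M2)) => //.
  - by move=> r rT /HA[[H1 _] _]; exact: (H1 rT).1.
  - by move=> r rT /HA[[_ H1] _]; exact: (H1 rT).1.
  - by move=> r rT /HA[[H1 _] _]; exact: (H1 rT).2.
  - by move=> r rT /HA[[_ H1] _]; exact: (H1 rT).2.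
  - move=> r /andP[r0 rT] /HA[_ [H1 H2]].
    have rT' : r \in `[0, T] by rewrite in_itv/= !ltW.
    by split; [exact: H1|exact: H2].
(* Good times lie in the open interval, so the two end points join the null set. *)
apply: (@ae_of_outside _ _ _ lam _ (A `|` ([set 0] `|` [set T]))).
- by apply: measurableU => //; apply: measurableU; exact: measurable_set1.
- apply: (etrans _ A0); apply: measureU0 => //.
    by apply: measurableU; exact: measurable_set1.
  apply: (etrans _ (lebesgue_measure_set1 (0 : R))); apply: measureU0 => //.
  exact: lebesgue_measure_set1.
- move=> t tA; rewrite in_itv/= => /andP[t0 tT]; apply: H; split; last by move=> At; apply: tA; left.
  rewrite /= in_itv/= !lt_neqAle t0 tT !andbT; apply/andP; split; apply/eqP => E; apply: tA; right.
    by left.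
  by right.
Qed.

End representatives.

Theorem theorem1p5 (R : realType) (d : nat) (T : R) (u0 : 'rV[R]_d -> 'rV[R]_d)
    (u U : R -> 'rV[R]_d -> 'rV[R]_d) :
  0 < T ->
  in_Lp 2%:E u0 ->
  div_free u0 ->
  in_X T u0 u ->
  in_X T u0 U ->
  sym_gradient_in_L1_Lexp T U ->
  eq_as_L2_valued T u U /\
  (forall w W : R -> 'rV[R]_d -> 'rV[R]_d,
     weakly_continuous_repr T u w -> weakly_continuous_repr T U W ->
     forall t, t \in `[0, T] ->
       \forall x \ae lebesgue_rV R d, w t x = W t x).
Proof.
move=> T0 Lu0 du0 Xu XU sU.
have uU := uniqueness_L2_valued T0 Lu0 du0 Xu XU sU.
split=> // w W uw UW t tT.
exact: weakly_continuous_unique T0 _ _ _ _ uU uw UW t tT.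
Qed.
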